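(* Let $\delta>0$ and let $(a_n)_{n\in\mathbb Z}$, $(b_n)_{n\in\mathbb Z}$ be bounded real sequences with $a_n\ge\delta$ for all $n$. Then for every $\epsilon>0$ there exist real sequences $(\tilde a_n)$, $(\tilde b_n)$ with $\|\tilde a-a\|_\infty<\epsilon$ and $\|\tilde b-b\|_\infty<\epsilon$ such that the Jacobi operator $\widetilde J=J(\tilde a,\tilde b)$ on $\ell^2(\mathbb Z)$ has purely pure point spectrum, with an orthonormal basis of eigenfunctions each of which decays exponentially (i.e. for each eigenfunction $u$ there are $C_u,\eta_u>0$ with $|u(m)|\le C_u e^{-\eta_u|m|}$ for all $m$).
   Context: For bounded real sequences $a,b$ on $\mathbb Z$, the Jacobi operator $J(a,b)$ on $\ell^2(\mathbb Z)$ is $(J(a,b)\phi)(n)=a_n\phi(n+1)+a_{n-1}\phi(n-1)+b_n\phi(n)$. *)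

(* Defs.v *)
From Stdlib Require Import Reals Lra Lia ZArith.
Open Scope R_scope.

Definition bounded_seq (a : Z -> R) : Prop :=
  exists M : R, forall n : Z, Rabs (a n) <= M.

Definition sup_dist_lt (x y : Z -> R) (eps : R) : Prop :=
  exists e', e' < eps /\ forall n : Z, Rabs (x n - y n) <= e'.

Definition jacobi (a b : Z -> R) (phi : Z -> R) (n : Z) : R :=
  a n * phi (n + 1)%Z + a (n - 1)%Z * phi (n - 1)%Z + b n * phi n.

Definition zsum_to (f : Z -> R) (l : R) : Prop :=
  infinite_sum (fun k : nat => f (Z.of_nat k) + f (- Z.of_nat (S k))%Z) l.

Definition in_l2 (u : Z -> R) : Prop :=
  exists l : R, zsum_to (fun n => u n ^ 2) l.

Definition inner_is (u v : Z -> R) (l : R) : Prop :=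
  zsum_to (fun n => u n * v n) l.

Definition is_eigenfunction (a b : Z -> R) (u : Z -> R) (lam : R) : Prop :=
  in_l2 u /\ forall n : Z, jacobi a b u n = lam * u n.

Definition exp_decaying (u : Z -> R) : Prop :=
  exists C eta : R, 0 < C /\ 0 < eta /\
    forall m : Z, Rabs (u m) <= C * exp (- eta * Rabs (IZR m)).

Definition orthonormal_basis {I : Type} (u : I -> Z -> R) : Prop :=
  (forall i, in_l2 (u i)) /\
  (forall i, inner_is (u i) (u i) 1) /\
  (forall i j, i <> j -> inner_is (u i) (u j) 0) /\
  (forall psi : Z -> R, in_l2 psi ->
     (forall i, inner_is psi (u i) 0) -> forall n, psi n = 0).

(* Main.v *)
Require Import Defs.
From Stdlib Require Import Reals ZArith Lra Lia Psatz Classical ClassicalChoice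
  FunctionalExtensionality ProofIrrelevance.
From mathcomp Require all_boot all_order all_algebra complex Rstruct.
Open Scope R_scope.

(** Only [b] is perturbed, by [v + om].

    The part [v] creates buffers. For a fixed energy and independent signs [+-eps], the average
    of the squared norm of a transported vector grows exponentially, uniformly in the background,
    because the determinant of the averaged quadratic form grows at every step. So some choice of
    signs produces a uniformly expanding direction, hence uniform hyperbolicity in a whole window
    of energies, and every bounded solution with energy in that window is exponentially small in
    the middle of the buffer. Finitely many windows cover the spectrum, and the dyadic annulus of
    scale [p] serves as a buffer for the window [p mod M].

    The part [om] removes resonances. An eigenfunction of the box [[-R_k, R_k)] is tiny at the
    centres of the buffers of its window, hence small on the region between two consecutive
    centres unless its energy is within [tau_p ^ 2] of an eigenvalue of that region. At a site
    inside, where [om] does not affect these eigenvalues, averaging over the value of [om] shows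
    that the resonant eigenfunctions carry only mass of order [tau_p] up to powers of [R_p], and
    [tau_p] is doubly exponentially small in [p]. So some [om] makes the eigenfunctions that do
    not decay from scale [P] on carry mass [O(2^-P)] at every site of the box of radius [R_P],
    in all boxes.

    Let finally [k] tend to infinity along a subsequence. A square summable vector with
    [psi m <> 0] overlaps, uniformly in [k], some decaying eigenfunction of the box, and a limit of
    these is an exponentially decaying eigenfunction on the line that is not orthogonal to [psi]. *)

(** * Finite sums *)

(** Buffers alone do not localize: a solution that is tiny inside the buffers may still live on
    several distant regions whose energies nearly coincide, and no choice of [v] made in advance
    excludes this. That is the task of [om]. Buffers as long as their distance from the origin serve
    two purposes: decay over the last buffer crossed is already exponential in the distance, and
    tunnelling through scale p is of order 2^(-4 * 2^p), while sites and region eigenvalues at that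
    scale number only O(2^p), so that the averaged mass of resonant eigenfunctions is summable over
    the scales. Probability is reduced to finite averages over grids, and spectral theory to finite
    matrices. The [om] found for different boxes need not agree; compactness provides one limit, so
    every bound must be uniform in k. Completeness is tested on square summable vectors orthogonal
    to all decaying eigenfunctions, and no spectral measure is constructed. *)

Fixpoint rsum (n : nat) (f : nat -> R) : R :=
  match n with O => 0 | S m => rsum m f + f m end.

Lemma rsum_ext (n : nat) (f g : nat -> R) :
  (forall i, (i < n)%nat -> f i = g i) -> rsum n f = rsum n g.
Proof.
  induction n as [|n IH]; intros H; simpl; [reflexivity|].
  rewrite IH, H; auto.
Qed.

Lemma rsum_le (n : nat) (f g : nat -> R) :
  (forall i, (i < n)%nat -> f i <= g i) -> rsum n f <= rsum n g.
Proof.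
  induction n as [|n IH]; intros H; simpl; [lra|].
  apply Rplus_le_compat; auto.
Qed.

Lemma rsum_plus (n : nat) (f g : nat -> R) :
  rsum n (fun i => f i + g i) = rsum n f + rsum n g.
Proof. induction n as [|n IH]; simpl; [|rewrite IH]; ring. Qed.

Lemma rsum_minus (n : nat) (f g : nat -> R) :
  rsum n (fun i => f i - g i) = rsum n f - rsum n g.
Proof. induction n as [|n IH]; simpl; [|rewrite IH]; ring. Qed.

Lemma rsum_scal (n : nat) (c : R) (f : nat -> R) :
  rsum n (fun i => c * f i) = c * rsum n f.
Proof. induction n as [|n IH]; simpl; [|rewrite IH]; ring. Qed.

Lemma rsum_const (n : nat) (c : R) : rsum n (fun _ => c) = INR n * c.
Proof. induction n as [|n IH]; [simpl; ring|]. rewrite S_INR; simpl rsum; rewrite IH; ring. Qed.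

Lemma rsum_le_const (n : nat) (f : nat -> R) (c : R) :
  (forall i, (i < n)%nat -> f i <= c) -> rsum n f <= INR n * c.
Proof. intros H; rewrite <- rsum_const; now apply rsum_le. Qed.

Lemma rsum_nonneg (n : nat) (f : nat -> R) :
  (forall i, (i < n)%nat -> 0 <= f i) -> 0 <= rsum n f.
Proof.
  intros H; replace 0 with (INR n * 0) by ring.
  rewrite <- rsum_const; now apply rsum_le.
Qed.

Lemma rsum_exchange (n m : nat) (f : nat -> nat -> R) :
  rsum n (fun i => rsum m (fun j => f i j)) = rsum m (fun j => rsum n (fun i => f i j)).
Proof.
  induction n as [|n IH]; simpl.
  - rewrite rsum_const; ring.
  - rewrite IH, <- rsum_plus; reflexivity.
Qed.

Lemma rsum_add (n m : nat) (f : nat -> R) :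
  rsum (n + m) f = rsum n f + rsum m (fun i => f (n + i)%nat).
Proof.
  induction m as [|m IH]; [rewrite Nat.add_0_r; simpl; ring|].
  rewrite Nat.add_succ_r; simpl; rewrite IH; ring.
Qed.

Lemma Rabs_rsum (n : nat) (f : nat -> R) : Rabs (rsum n f) <= rsum n (fun i => Rabs (f i)).
Proof.
  induction n as [|n IH]; simpl; [rewrite Rabs_R0; lra|].
  eapply Rle_trans; [apply Rabs_triang|lra].
Qed.

Lemma rsum_term_le (n : nat) (f : nat -> R) (i : nat) :
  (forall j, (j < n)%nat -> 0 <= f j) -> (i < n)%nat -> f i <= rsum n f.
Proof.
  induction n as [|n IH]; intros H Hi; [lia|]; simpl.
  destruct (Nat.eq_dec i n) as [->|Hn].
  - assert (0 <= rsum n f) by (apply rsum_nonneg; auto). lra.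
  - assert (f i <= rsum n f) by (apply IH; [auto|lia]). assert (0 <= f n) by auto. lra.
Qed.

Lemma rsum_single (n : nat) (f : nat -> R) (i : nat) :
  (i < n)%nat -> (forall j, (j < n)%nat -> j <> i -> f j = 0) -> rsum n f = f i.
Proof.
  induction n as [|n IH]; intros Hi H; [lia|]; simpl.
  destruct (Nat.eq_dec i n) as [->|Hn].
  - rewrite (rsum_ext n f (fun _ => 0)), rsum_const; [ring|intros; apply H; lia].
  - rewrite IH by (try lia; auto). rewrite (H n); [ring|lia|lia].
Qed.

Definition zint (l : Z) (n : nat) (f : Z -> R) : R := rsum n (fun i => f (l + Z.of_nat i)%Z).

(** Half-open, because the partial sums of [zsum_to] pair the site [k] with [-(k+1)]. *)
Definition zbox (n : nat) (f : Z -> R) : R := zint (- Z.of_nat n) (2 * n) f.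

Lemma zint_ext (l : Z) (n : nat) (f g : Z -> R) :
  (forall x, (l <= x < l + Z.of_nat n)%Z -> f x = g x) -> zint l n f = zint l n g.
Proof. intros H; apply rsum_ext; intros i Hi; apply H; lia. Qed.

Lemma zint_le (l : Z) (n : nat) (f g : Z -> R) :
  (forall x, (l <= x < l + Z.of_nat n)%Z -> f x <= g x) -> zint l n f <= zint l n g.
Proof. intros H; apply rsum_le; intros i Hi; apply H; lia. Qed.

Lemma zint_single (l : Z) (n : nat) (f : Z -> R) (x : Z) :
  (l <= x < l + Z.of_nat n)%Z ->
  (forall y, (l <= y < l + Z.of_nat n)%Z -> y <> x -> f y = 0) -> zint l n f = f x.
Proof.
  intros Hx H; unfold zint.
  rewrite (rsum_single _ _ (Z.to_nat (x - l))).
  - f_equal; lia.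
  - lia.
  - intros j Hj Hne; apply H; lia.
Qed.

Lemma zint_add (l : Z) (n m : nat) (f : Z -> R) :
  zint l (n + m) f = zint l n f + zint (l + Z.of_nat n) m f.
Proof.
  unfold zint; rewrite rsum_add; f_equal; apply rsum_ext; intros; f_equal; lia.
Qed.

Lemma zint_telescope (l : Z) (n : nat) (f : Z -> R) :
  zint l n (fun x => f x - f (x - 1)%Z) = f (l + Z.of_nat n - 1)%Z - f (l - 1)%Z.
Proof.
  unfold zint; induction n as [|n IH].
  - simpl; replace (l + 0 - 1)%Z with (l - 1)%Z by lia; ring.
  - simpl rsum; cbn beta; rewrite IH.
    replace (l + Z.of_nat (S n) - 1)%Z with (l + Z.of_nat n)%Z by lia. ring.
Qed.

Lemma zint_1 (l : Z) (f : Z -> R) : zint l 1 f = f l.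
Proof. unfold zint; simpl; rewrite Z.add_0_r; ring. Qed.

Lemma zbox_S (n : nat) (f : Z -> R) :
  zbox (S n) f = zbox n f + (f (Z.of_nat n) + f (- Z.of_nat (S n))%Z).
Proof.
  unfold zbox. replace (2 * S n)%nat with (1 + (2 * n + 1))%nat by lia.
  rewrite zint_add, zint_add, !zint_1.
  replace (- Z.of_nat (S n) + Z.of_nat 1)%Z with (- Z.of_nat n)%Z by lia.
  replace (- Z.of_nat n + Z.of_nat (2 * n))%Z with (Z.of_nat n) by lia. ring.
Qed.

Lemma zsum_to_zbox (f : Z -> R) (l : R) :
  zsum_to f l <-> Un_cv (fun n => zbox n f) l.
Proof.
  assert (Hs : forall n, sum_f_R0 (fun k => f (Z.of_nat k) + f (- Z.of_nat (S k))%Z) n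
                         = zbox (S n) f).
  { induction n as [|n IH]; rewrite zbox_S.
    - unfold zbox, zint; simpl; ring.
    - rewrite <- IH; reflexivity. }
  unfold zsum_to, infinite_sum, Un_cv; split; intros H eps Heps;
    destruct (H eps Heps) as [n0 Hn0].
  - exists (S n0). intros [|n] Hn; [lia|]. rewrite <- Hs. apply Hn0; lia.
  - exists n0. intros n Hn. rewrite Hs. apply Hn0; lia.
Qed.

Lemma zbox_ext (n : nat) (f g : Z -> R) :
  (forall x, (- Z.of_nat n <= x < Z.of_nat n)%Z -> f x = g x) -> zbox n f = zbox n g.
Proof. intros H; apply zint_ext; intros; apply H; lia. Qed.

(** * Spectral theorem for finite Jacobi matrices *)

(** The eigenvectors are [re j + i im j]. Real functions on [nat] keep matrix types out of the rest
    of the proof. Unitarity is recorded as normalization and as the completeness relation, a sum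
    over eigenvectors. *)
Definition has_eigenbasis (n : nat) (A : nat -> nat -> R) : Prop :=
  exists (lam : nat -> R) (re im : nat -> nat -> R),
    (forall j x, (j < n)%nat -> (x < n)%nat ->
       rsum n (fun y => A x y * re j y) = (lam j * re j x) /\
       rsum n (fun y => A x y * im j y) = (lam j * im j x)) /\
    (forall j, (j < n)%nat -> rsum n (fun x => re j x ^ 2 + im j x ^ 2) = 1) /\
    (forall x y, (x < n)%nat -> (y < n)%nat ->
       rsum n (fun j => re j x * re j y + im j x * im j y)
       = if Nat.eq_dec x y then 1 else 0).

Module SymmetricSpectrum.
Import all_boot all_order all_algebra complex Rstruct.
Import GRing.Theory Num.Theory.
Local Open Scope ring_scope.
Local Open Scope sesquilinear_scope.
Local Open Scope complex_scope.
Local Notation Re := complex.Re.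
Local Notation Im := complex.Im.

Lemma rsumE (n : nat) (f : nat -> R) : rsum n f = \sum_(i < n) f i.
Proof. by elim: n => [|n IH] /=; rewrite ?big_ord0 // big_ord_recr /= -IH. Qed.

Lemma Re_sum (n : nat) (f : 'I_n -> R[i]) :
  Re (\sum_i f i) = \sum_i Re (f i).
Proof. by apply: (big_morph (@Re _)) => [[x1 x2] [y1 y2]|]. Qed.

Lemma Im_sum (n : nat) (f : 'I_n -> R[i]) :
  Im (\sum_i f i) = \sum_i Im (f i).
Proof. by apply: (big_morph (@Im _)) => [[x1 x2] [y1 y2]|]. Qed.

Lemma exists_eigenbasis (n : nat) (A : nat -> nat -> R)
  (Asym : forall x y, A x y = A y x) :
  has_eigenbasis n A.
Proof.
pose B := \matrix_(i < n, j < n) ((A i j)%:C : R[i]).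
have Breal : B \is a realmx.
  by apply/mxOverP => i j; rewrite mxE complex_real.
have Bsym : B \is symmetricmx.
  by apply/is_hermitianmxP; apply/matrixP => i j; rewrite !mxE mul1r /= Asym.
have Bherm := realsym_hermsym Bsym Breal.
have /orthomx_spectralP Beq := hermitian_normalmx Bherm.
have dreal := hermitian_spectral_diag_real Bherm.
have Punit := spectral_unitarymx B.
move: Beq dreal Punit.
set P := spectralmx B; set d := spectral_diag B => Beq dreal Punit.
(* The rows of [P] are eigenvectors, as [B] is symmetric. Below, [PP] yields their normalization and
   [PP'] their completeness. *)
have PB : P *m B = diag_mx d *m P.
  by rewrite {1}Beq !mulmxA mulmxV ?unitarymx_unit // mul1mx.
have PP : P *m P^t* = 1%:M by apply/unitarymxP.
have PP' : P^t* *m P = 1%:M by apply: mulmx1C.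
pose get (f : 'I_n -> R) (j : nat) : R :=
  if insub j is Some k then f k else 0.
have getE f (k : 'I_n) : get f k = f k by rewrite /get valK.
exists (get (fun j => Re (d 0 j))).
exists (fun j x => get (fun j => get (fun x => Re (P j x)) x) j).
exists (fun j x => get (fun j => get (fun x => Im (P j x)) x) j).
have dRe j : d 0 j = (Re (d 0 j))%:C.
  by rewrite RRe_real //; apply: (mxOverP dreal).
split; [|split].
- move=> j x /ltP jn /ltP xn.
  rewrite !rsumE -[j]/(val (Ordinal jn)) -[x]/(val (Ordinal xn)).
  move: (Ordinal jn) (Ordinal xn) => {jn xn} {}j {}x.
  have := congr1 (fun M : 'M_n => M j x) PB.
  rewrite !mxE => H.
  have {}H : \sum_k P j k * B k x = d 0 j * P j x.
    rewrite H (bigD1 j) //= big1 ?addr0 ?mxE ?eqxx ?mulr1n //.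
    by move=> i nij; rewrite mxE eq_sym (negbTE nij) mulr0n mul0r.
  rewrite !getE; split.
  + transitivity (Re (d 0 j * P j x)); last first.
      by rewrite dRe; case: (P j x) => u v /=; rewrite mul0r subr0.
    rewrite -H Re_sum; apply: eq_bigr => k _; rewrite !getE mxE.
    by case: (P j k) => u v /=; rewrite mulr0 subr0 mulrC Asym.
  + transitivity (Im (d 0 j * P j x)); last first.
      by rewrite dRe; case: (P j x) => u v /=; rewrite mul0r addr0.
    rewrite -H Im_sum; apply: eq_bigr => k _; rewrite !getE mxE.
    by case: (P j k) => u v /=; rewrite mulr0 add0r mulrC Asym.
- move=> j /ltP jn; rewrite rsumE -[j]/(val (Ordinal jn)).
  move: (Ordinal jn) => {jn} {}j.
  have := congr1 (fun M : 'M_n => Re (M j j)) PP.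
  rewrite !mxE eqxx Re_sum /= => H; rewrite -[RHS]H.
  apply: eq_bigr => k _; rewrite !getE !mxE.
  by case: (P j k) => u v /=; rewrite mulrN opprK !Rmult_1_r.
- move=> x y /ltP xn /ltP yn.
  rewrite rsumE -[x]/(val (Ordinal xn)) -[y]/(val (Ordinal yn)).
  move: (Ordinal xn) (Ordinal yn) => {xn yn} {}x {}y.
  have := congr1 (fun M : 'M_n => Re (M x y)) PP'.
  rewrite !mxE Re_sum => H.
  transitivity (Re ((x == y)%:R : R[i])); last first.
    case: Nat.eq_dec => [e|ne]; first by rewrite (val_inj e) eqxx.
    by case: eqP => [e|//]; case: ne; rewrite e.
  rewrite -H; apply: eq_bigr => k _; rewrite !getE !mxE.
  by case: (P k x) => u v; case: (P k y) => u' v' /=; rewrite mulNr opprK.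
Qed.

End SymmetricSpectrum.

Lemma jacobi_linear (a b : Z -> R) (c d : R) (f g : Z -> R) (x : Z) :
  jacobi a b (fun y => c * f y + d * g y) x = c * jacobi a b f x + d * jacobi a b g x.
Proof. unfold jacobi; ring. Qed.

(** Each equation can be solved for the value on the right since [a] is positive. For vectors
    vanishing left of an interval this gives simplicity of the eigenvalues. *)
Lemma jacobi_zero_right (a b : Z -> R) (E : R) (h : Z -> R) (x0 : Z) (n : nat) :
  (forall x, 0 < a x) ->
  (forall x, (x0 <= x < x0 + Z.of_nat n)%Z -> jacobi a b h x = E * h x) ->
  h (x0 - 1)%Z = 0 -> h x0 = 0 ->
  forall x, (x0 <= x <= x0 + Z.of_nat n)%Z -> h x = 0.
Proof.
  intros Ha H H1 H0.
  assert (K : forall i, (i <= n)%nat ->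
    h (x0 + Z.of_nat i - 1)%Z = 0 /\ h (x0 + Z.of_nat i)%Z = 0).
  { induction i as [|i IH]; intros Hi.
    - simpl; rewrite Z.add_0_r; auto.
    - destruct IH as [IH1 IH0]; [lia|].
      replace (x0 + Z.of_nat (S i) - 1)%Z with (x0 + Z.of_nat i)%Z by lia.
      split; [exact IH0|].
      replace (x0 + Z.of_nat (S i))%Z with (x0 + Z.of_nat i + 1)%Z by lia.
      specialize (H (x0 + Z.of_nat i)%Z ltac:(lia)); unfold jacobi in H.
      rewrite IH1, IH0 in H. specialize (Ha (x0 + Z.of_nat i)%Z).
      apply Rmult_eq_reg_l with (a (x0 + Z.of_nat i)%Z); lra. }
  intros x Hx. replace x with (x0 + Z.of_nat (Z.to_nat (x - x0)))%Z by lia.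
  apply K; lia.
Qed.

Definition jac_entry (a b : Z -> R) (x y : Z) : R :=
  (if Z.eq_dec y (x + 1) then a x else 0) + (if Z.eq_dec y (x - 1) then a y else 0)
  + (if Z.eq_dec y x then b x else 0).

Lemma zint_delta (l : Z) (n : nat) (x : Z) (f : Z -> R) :
  (~ (l <= x < l + Z.of_nat n)%Z -> f x = 0) ->
  zint l n (fun y => if Z.eq_dec y x then f y else 0) = f x.
Proof.
  intros H. destruct (classic (l <= x < l + Z.of_nat n)%Z) as [Hx|Hx].
  - rewrite (zint_single _ _ _ x); auto.
    + destruct (Z.eq_dec x x); congruence.
    + intros y _ Hy; destruct (Z.eq_dec y x); congruence.
  - rewrite (H Hx), (zint_ext _ _ _ (fun _ => 0)).
    + unfold zint; rewrite rsum_const; ring.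
    + intros y Hy; destruct (Z.eq_dec y x); [subst; tauto|reflexivity].
Qed.

Lemma zint_plus (l : Z) (n : nat) (f g : Z -> R) :
  zint l n (fun x => f x + g x) = zint l n f + zint l n g.
Proof. apply rsum_plus. Qed.

Lemma zint_minus (l : Z) (n : nat) (f g : Z -> R) :
  zint l n (fun x => f x - g x) = zint l n f - zint l n g.
Proof. apply rsum_minus. Qed.

Lemma zint_scal (l : Z) (n : nat) (c : R) (f : Z -> R) :
  zint l n (fun x => c * f x) = c * zint l n f.
Proof. apply rsum_scal. Qed.

Lemma zint_nonneg (l : Z) (n : nat) (f : Z -> R) :
  (forall x, (l <= x < l + Z.of_nat n)%Z -> 0 <= f x) -> 0 <= zint l n f.
Proof. intros H; apply rsum_nonneg; intros; apply H; lia. Qed.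

Lemma zint_term_le (l : Z) (n : nat) (f : Z -> R) (x : Z) :
  (forall x, (l <= x < l + Z.of_nat n)%Z -> 0 <= f x) ->
  (l <= x < l + Z.of_nat n)%Z -> f x <= zint l n f.
Proof.
  intros H Hx. unfold zint.
  replace x with (l + Z.of_nat (Z.to_nat (x - l)))%Z at 1 by lia.
  apply (rsum_term_le n (fun i => f (l + Z.of_nat i)%Z)); [|lia].
  intros; apply H; lia.
Qed.

Lemma zint_jac_entry (a b : Z -> R) (l : Z) (n : nat) (g : Z -> R) (x : Z) :
  (forall y, ~ (l <= y < l + Z.of_nat n)%Z -> g y = 0) ->
  zint l n (fun y => jac_entry a b x y * g y) = jacobi a b g x.
Proof.
  intros Hg.
  rewrite (zint_ext _ _ _ (fun y =>
    ((if Z.eq_dec y (x + 1) then a x * g y else 0)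
     + (if Z.eq_dec y (x - 1) then a y * g y else 0))
    + (if Z.eq_dec y x then b x * g y else 0))).
  - rewrite !zint_plus.
    rewrite (zint_delta l n (x + 1) (fun y => a x * g y)),
      (zint_delta l n (x - 1) (fun y => a y * g y)),
      (zint_delta l n x (fun y => b x * g y)).
    + reflexivity.
    + intros; rewrite Hg; [ring|assumption].
    + intros; rewrite Hg; [ring|assumption].
    + intros; rewrite Hg; [ring|assumption].
  - intros y _; unfold jac_entry.
    destruct (Z.eq_dec y (x + 1)), (Z.eq_dec y (x - 1)), (Z.eq_dec y x); ring.
Qed.

(** Dirichlet eigenvectors of the interval [[l, l + n)], extended by zero so that the operator
    [jacobi] of the whole line applies to them; the eigenvalue equation is required inside only. *)
Definition spectral_data (a b : Z -> R) (l : Z) (n : nat) (E : nat -> R)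
    (phi : nat -> Z -> R) : Prop :=
  (forall j x, ~ (l <= x < l + Z.of_nat n)%Z -> phi j x = 0) /\
  (forall j x, (j < n)%nat -> (l <= x < l + Z.of_nat n)%Z ->
     jacobi a b (phi j) x = E j * phi j x) /\
  (forall j, (j < n)%nat -> zint l n (fun x => phi j x ^ 2) = 1) /\
  (forall x y, (l <= x < l + Z.of_nat n)%Z -> (l <= y < l + Z.of_nat n)%Z ->
     rsum n (fun j => phi j x * phi j y) = if Z.eq_dec x y then 1 else 0).

(* A unitary eigenbasis is made real: by simplicity of the eigenvalues the real and
   imaginary parts of an eigenvector are proportional, so that rotating its value at
   the left end to the positive half-line makes it real. *)
Lemma spectral_data_exists (a b : Z -> R) (l : Z) (n : nat) :
  (forall x, 0 < a x) -> exists E phi, spectral_data a b l n E phi.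
Proof.
  intros Ha.
  pose (A := fun i j => jac_entry a b (l + Z.of_nat i) (l + Z.of_nat j)).
  assert (Asym : forall i j, A i j = A j i).
  { intros i j; unfold A, jac_entry.
    destruct (Nat.eq_dec i j) as [->|Hij]; [reflexivity|].
    destruct (Z.eq_dec (l + Z.of_nat j) (l + Z.of_nat i)),
      (Z.eq_dec (l + Z.of_nat j) (l + Z.of_nat i + 1)) as [e1|],
      (Z.eq_dec (l + Z.of_nat j) (l + Z.of_nat i - 1)) as [e2|],
      (Z.eq_dec (l + Z.of_nat i) (l + Z.of_nat j + 1)),
      (Z.eq_dec (l + Z.of_nat i) (l + Z.of_nat j - 1)),
      (Z.eq_dec (l + Z.of_nat i) (l + Z.of_nat j)); try lia; ring. }
  destruct (SymmetricSpectrum.exists_eigenbasis n A Asym)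
    as (E & re & im & Heig & Hnorm & Hcomp).
  pose (ext := fun (f : nat -> R) (x : Z) =>
    if Z_le_dec l x then if Z_lt_dec x (l + Z.of_nat n) then f (Z.to_nat (x - l)) else 0 else 0).
  assert (Hout : forall f x, ~ (l <= x < l + Z.of_nat n)%Z -> ext f x = 0).
  { intros f x Hx; unfold ext.
    destruct (Z_le_dec l x), (Z_lt_dec x (l + Z.of_nat n)); auto; lia. }
  assert (Hin : forall f i, (i < n)%nat -> ext f (l + Z.of_nat i)%Z = f i).
  { intros f i Hi; unfold ext.
    destruct (Z_le_dec l (l + Z.of_nat i)), (Z_lt_dec (l + Z.of_nat i) (l + Z.of_nat n)); try lia.
    f_equal; lia. }
  assert (Hsol : forall f lam,
    (forall x, (x < n)%nat -> rsum n (fun y => A x y * f y) = lam * f x) ->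
    forall x, (l <= x < l + Z.of_nat n)%Z -> jacobi a b (ext f) x = lam * ext f x).
  { intros f lam Hf x Hx. rewrite <- (zint_jac_entry a b l n) by apply Hout.
    replace x with (l + Z.of_nat (Z.to_nat (x - l)))%Z by lia.
    rewrite Hin by lia. rewrite <- Hf by lia. apply rsum_ext.
    intros i Hi; rewrite Hin by lia; reflexivity. }
  pose (u := fun j => ext (re j)); pose (v := fun j => ext (im j)).
  (* The difference of the two sides solves the eigenvalue equation and vanishes at [l - 1] and at
     [l]. *)
  assert (Hprop : forall j x, (j < n)%nat -> (l <= x < l + Z.of_nat n)%Z ->
    v j l * u j x = u j l * v j x).
  { intros j x Hj Hx.
    enough (H : v j l * u j x + - u j l * v j x = 0) by lra.
    apply (jacobi_zero_right a b (E j) (fun x => v j l * u j x + - u j l * v j x) l n Ha).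
    - intros y Hy. rewrite jacobi_linear. unfold u, v.
      rewrite !(Hsol _ (E j)); [ring|..]; auto; intros; apply Heig; auto.
    - unfold u, v; rewrite !(Hout _ (l - 1)%Z) by lia; ring.
    - ring.
    - lia. }
  pose (r := fun j => sqrt (u j l ^ 2 + v j l ^ 2)).
  (* An eigenvector vanishing at the left end would vanish identically, against its
     normalization. *)
  assert (Hr : forall j, (j < n)%nat -> r j <> 0).
  { intros j Hj Hr.
    assert (Hr2 : u j l ^ 2 + v j l ^ 2 = 0).
    { apply sqrt_eq_0; [|exact Hr]. pose proof (pow2_ge_0 (u j l)).
      pose proof (pow2_ge_0 (v j l)). lra. }
    assert (Hu : u j l = 0) by nra. assert (Hv : v j l = 0) by nra.
    specialize (Hnorm j Hj). rewrite (rsum_ext _ _ (fun _ => 0)), rsum_const in Hnorm; [lra|].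
    intros i Hi.
    assert (Hz : forall f, ext f l = 0 ->
      (forall x, (x < n)%nat -> rsum n (fun y => A x y * f y) = E j * f x) -> f i = 0).
    { intros f H0 Hf. rewrite <- (Hin f i Hi).
      apply (jacobi_zero_right a b (E j) (ext f) l n Ha);
        [intros; apply Hsol; auto|apply Hout; lia|exact H0|lia]. }
    rewrite (Hz (re j)), (Hz (im j)); auto; try ring; intros; apply Heig; auto. }
  assert (Hr2 : forall j, r j * r j = u j l ^ 2 + v j l ^ 2).
  { intros j; apply sqrt_sqrt. pose proof (pow2_ge_0 (u j l)).
    pose proof (pow2_ge_0 (v j l)). lra. }
  pose (phi := fun j x => u j l / r j * u j x + v j l / r j * v j x).
  (* A unit complex factor does not change the real part of the product of one value with the
     conjugate of another, so normalization and completeness carry over to [phi]. *)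
  assert (Hphi : forall j x y, (j < n)%nat -> (l <= x < l + Z.of_nat n)%Z ->
    (l <= y < l + Z.of_nat n)%Z -> phi j x * phi j y = u j x * u j y + v j x * v j y).
  { intros j x y Hj Hx Hy.
    assert (H1 : forall z, (l <= z < l + Z.of_nat n)%Z ->
      phi j z * u j l = r j * u j z /\ phi j z * v j l = r j * v j z).
    { intros z Hz. specialize (Hprop j z Hj Hz). specialize (Hr j Hj). specialize (Hr2 j).
      unfold phi; split.
      - replace ((u j l / r j * u j z + v j l / r j * v j z) * u j l)
          with ((u j l ^ 2 * u j z + v j l * (u j l * v j z)) / r j) by (field; auto).
        rewrite <- Hprop.
        replace (u j l ^ 2 * u j z + v j l * (v j l * u j z))
          with (r j * r j * u j z) by (rewrite Hr2; ring).
        field; auto.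
      - replace ((u j l / r j * u j z + v j l / r j * v j z) * v j l)
          with ((u j l * (v j l * u j z) + v j l ^ 2 * v j z) / r j) by (field; auto).
        rewrite Hprop.
        replace (u j l * (u j l * v j z) + v j l ^ 2 * v j z)
          with (r j * r j * v j z) by (rewrite Hr2; ring).
        field; auto. }
    destruct (H1 x Hx) as [H1u H1v]; destruct (H1 y Hy) as [H2u H2v].
    specialize (Hr j Hj). specialize (Hr2 j).
    apply Rmult_eq_reg_l with (r j * r j); [|nra].
    replace (r j * r j * (phi j x * phi j y)) with
      ((phi j x * u j l) * (phi j y * u j l) + (phi j x * v j l) * (phi j y * v j l))
      by (rewrite Hr2; ring).
    rewrite H1u, H1v, H2u, H2v. ring. }
  exists E, phi; split; [|split; [|split]].
  - intros j x Hx. unfold phi, u, v; rewrite !(Hout _ x Hx); ring.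
  - intros j x Hj Hx. unfold phi at 1. rewrite jacobi_linear. unfold u at 2, v at 2.
    rewrite !(Hsol _ (E j)); auto; try (intros; apply Heig; auto).
    unfold phi, u, v; ring.
  - intros j Hj. rewrite <- (Hnorm j Hj). apply rsum_ext. intros i Hi; cbv beta.
    replace (phi j (l + Z.of_nat i)%Z ^ 2)
      with (phi j (l + Z.of_nat i)%Z * phi j (l + Z.of_nat i)%Z) by ring.
    rewrite Hphi by (auto; lia). unfold u, v. rewrite !Hin by auto. ring.
  - intros x y Hx Hy.
    rewrite (rsum_ext _ _ (fun j => re j (Z.to_nat (x - l)) * re j (Z.to_nat (y - l))
      + im j (Z.to_nat (x - l)) * im j (Z.to_nat (y - l)))).
    + rewrite Hcomp by lia.
      destruct (Nat.eq_dec (Z.to_nat (x - l)) (Z.to_nat (y - l))), (Z.eq_dec x y); auto; lia.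
    + intros j Hj. rewrite Hphi by auto.
      replace x with (l + Z.of_nat (Z.to_nat (x - l)))%Z at 1 2 by lia.
      replace y with (l + Z.of_nat (Z.to_nat (y - l)))%Z at 1 2 by lia.
      unfold u, v. rewrite !Hin by lia. reflexivity.
Qed.

(** * Growth of transfer matrices under sign perturbations *)

Definition sqn (w : R * R) : R := fst w ^ 2 + snd w ^ 2.

(* Transfer matrices act on the states [(u x, a (x-1) * u (x-1))], for which they have determinant 1. *)
Definition jstep (al e : R) (w : R * R) : R * R := ((e * fst w - snd w) / al, al * fst w).

Fixpoint orbit (a e : Z -> R) (x : Z) (n : nat) (w : R * R) : R * R :=
  match n with O => w | S m => orbit a e (x + 1)%Z m (jstep (a x) (e x) w) end.

Lemma orbit_ext (a e e' : Z -> R) (n : nat) : forall x w,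
  (forall y, (x <= y < x + Z.of_nat n)%Z -> e y = e' y) ->
  orbit a e x n w = orbit a e' x n w.
Proof.
  induction n as [|n IH]; intros x w H; [reflexivity|]; simpl.
  rewrite (H x) by lia. apply IH; intros; apply H; lia.
Qed.

(* Trace of the average of [w w^T] over independent uniform signs of the perturbation,
   started from the symmetric matrix with entries [A], [B], [C]. *)
Fixpoint avg_trace (eps : R) (a e : Z -> R) (x : Z) (n : nat) (A B C : R) : R :=
  match n with
  | O => A + C
  | S m => avg_trace eps a e (x + 1)%Z m
      (((e x ^ 2 + eps ^ 2) * A - 2 * e x * B + C) / a x ^ 2)
      (e x * A - B) (a x ^ 2 * A)
  end.

Lemma avg_trace_linear (eps : R) (a e : Z -> R) (n : nat) :
  forall x c d A B C A' B' C',
  avg_trace eps a e x n (c * A + d * A') (c * B + d * B') (c * C + d * C')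
  = c * avg_trace eps a e x n A B C + d * avg_trace eps a e x n A' B' C'.
Proof.
  induction n as [|n IH]; intros; simpl; [ring|].
  rewrite <- IH; f_equal; unfold Rdiv; ring.
Qed.

(** Method of conditional expectations: the average is the mean of the two averages with the sign at
    [x] fixed, so one of these signs does not decrease it. *)
Lemma exists_signs_ge_avg (eps : R) (a e : Z -> R) (n : nat) :
  0 <= eps -> (forall x, 0 < a x) ->
  forall x w, exists v : Z -> R, (forall y, Rabs (v y) <= eps) /\
    avg_trace eps a e x n (fst w ^ 2) (fst w * snd w) (snd w ^ 2)
    <= sqn (orbit a (fun y => e y - v y) x n w).
Proof.
  intros Heps Ha; induction n as [|n IH]; intros x w.
  - exists (fun _ => 0); split; [intros; rewrite Rabs_R0; lra|]. unfold sqn; simpl; lra.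
  - assert (K : forall s, Rabs s <= eps -> exists v : Z -> R,
      (forall y, Rabs (v y) <= eps) /\
      (let w' := jstep (a x) (e x - s) w in
       avg_trace eps a e (x + 1) n (fst w' ^ 2) (fst w' * snd w') (snd w' ^ 2))
      <= sqn (orbit a (fun y => e y - v y) x (S n) w)).
    { intros s Hs. destruct (IH (x + 1)%Z (jstep (a x) (e x - s) w)) as (v & Hv & Hle).
      exists (fun y => if Z.eq_dec y x then s else v y). split.
      - intros y; destruct (Z.eq_dec y x); auto.
      - eapply Rle_trans; [exact Hle|]. right; f_equal; simpl.
        destruct (Z.eq_dec x x) as [_|]; [|congruence].
        apply orbit_ext; intros y Hy. destruct (Z.eq_dec y x); [lia|reflexivity]. }
    assert (Heq : avg_trace eps a e x (S n) (fst w ^ 2) (fst w * snd w) (snd w ^ 2)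
      = 1 / 2 * (let w' := jstep (a x) (e x - eps) w in
          avg_trace eps a e (x + 1) n (fst w' ^ 2) (fst w' * snd w') (snd w' ^ 2))
      + 1 / 2 * (let w' := jstep (a x) (e x - - eps) w in
          avg_trace eps a e (x + 1) n (fst w' ^ 2) (fst w' * snd w') (snd w' ^ 2))).
    { cbv zeta. rewrite <- avg_trace_linear. specialize (Ha x).
      simpl avg_trace; unfold jstep; simpl fst; simpl snd. f_equal; field; lra. }
    destruct (K eps) as (v1 & Hv1 & H1); [rewrite Rabs_pos_eq; lra|].
    destruct (K (- eps)) as (v2 & Hv2 & H2); [rewrite Rabs_Ropp, Rabs_pos_eq; lra|].
    rewrite Heq. cbv zeta in *.
    destruct (Rle_dec (sqn (orbit a (fun y => e y - v1 y) x (S n) w))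
      (sqn (orbit a (fun y => e y - v2 y) x (S n) w))).
    + exists v2; split; [auto|lra].
    + exists v1; split; [auto|lra].
Qed.

Definition psd (A B C : R) : Prop := 0 <= A /\ 0 <= C /\ B ^ 2 <= A * C.

Lemma psd_form_nonneg (A B C t : R) : psd A B C -> 0 <= t ^ 2 * A - 2 * t * B + C.
Proof.
  intros (HA & HC & HD). destruct (Req_dec A 0) as [->|HA0].
  - assert (B = 0) by nra. subst; nra.
  - apply Rmult_le_reg_l with A; [lra|]. rewrite Rmult_0_r.
    replace (A * (t ^ 2 * A - 2 * t * B + C)) with ((t * A - B) ^ 2 + (A * C - B ^ 2)) by ring.
    pose proof (pow2_ge_0 (t * A - B)). lra.
Qed.

(* One step of [avg_trace] raises the determinant by [(eps * A)^2]. *)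
Lemma psd_step (eps al e A B C : R) : 0 < al -> psd A B C ->
  let A' := ((e ^ 2 + eps ^ 2) * A - 2 * e * B + C) / al ^ 2 in
  let B' := e * A - B in
  let C' := al ^ 2 * A in
  psd A' B' C' /\ A' * C' - B' ^ 2 = A * C - B ^ 2 + (eps * A) ^ 2.
Proof.
  intros Hal HS A' B' C'. pose proof (psd_form_nonneg A B C e HS) as Hf.
  destruct HS as (HA & HC & HD).
  assert (Hdet : A' * C' - B' ^ 2 = A * C - B ^ 2 + (eps * A) ^ 2)
    by (unfold A', B', C'; field; lra).
  assert (Hal2 : 0 < al ^ 2) by nra.
  split; [|exact Hdet]. split; [|split].
  - unfold A', Rdiv. apply Rmult_le_pos; [|left; apply Rinv_0_lt_compat; exact Hal2].
    pose proof (pow2_ge_0 eps). nra.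
  - unfold C'. nra.
  - pose proof (pow2_ge_0 (eps * A)). lra.
Qed.

(** A single step gains nothing if [A = 0]. Two steps gain [eps^2 (A^2 + A'^2) >= 2 eps^2 A A'], and
    [al^2 A A' = A' C'] dominates the determinant, which turns the gain into a factor. The last
    bound serves matrices of determinant 0, where a factor is worthless. *)
Lemma psd_two_steps (eps al al' e e' A B C alpha : R) :
  0 < al <= alpha -> 0 < al' -> psd A B C ->
  let A' := ((e ^ 2 + eps ^ 2) * A - 2 * e * B + C) / al ^ 2 in
  let B' := e * A - B in
  let C' := al ^ 2 * A in
  let A'' := ((e' ^ 2 + eps ^ 2) * A' - 2 * e' * B' + C') / al' ^ 2 in
  let B'' := e' * A' - B' in
  let C'' := al' ^ 2 * A' in
  psd A'' B'' C'' /\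
  (1 + 2 * eps ^ 2 / alpha ^ 2) * (A * C - B ^ 2) <= A'' * C'' - B'' ^ 2 /\
  eps ^ 2 * (A ^ 2 + A' ^ 2) <= A'' * C'' - B'' ^ 2.
Proof.
  intros Hal Hal' HS A' B' C' A'' B'' C''.
  destruct (psd_step eps al e A B C (proj1 Hal) HS) as [HS' Hdet'].
  fold A' B' C' in HS', Hdet'.
  destruct (psd_step eps al' e' A' B' C' Hal' HS') as [HS'' Hdet''].
  fold A'' B'' C'' in HS'', Hdet''.
  split; [exact HS''|]. rewrite Hdet'', Hdet'.
  destruct HS as (HA & HC & HD). destruct HS' as (HA' & HC' & HD').
  split; [|nra].
  assert (Hp : A * C - B ^ 2 <= A * A' * alpha ^ 2).
  { apply Rle_trans with (A' * C').
    - pose proof (pow2_ge_0 (eps * A)). pose proof (pow2_ge_0 B'). lra.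
    - unfold C'. replace (A' * (al ^ 2 * A)) with (A * A' * al ^ 2) by ring.
      apply Rmult_le_compat_l; [nra|]. apply pow_incr; lra. }
  assert (Ha2 : 0 < alpha ^ 2) by nra.
  assert (Hq : (A * C - B ^ 2) / alpha ^ 2 <= A * A').
  { apply Rmult_le_reg_r with (alpha ^ 2); [exact Ha2|].
    unfold Rdiv; rewrite Rmult_assoc, Rinv_l; lra. }
  replace ((1 + 2 * eps ^ 2 / alpha ^ 2) * (A * C - B ^ 2))
    with (A * C - B ^ 2 + 2 * eps ^ 2 * ((A * C - B ^ 2) / alpha ^ 2)) by (field; lra).
  pose proof (pow2_ge_0 eps). pose proof (pow2_ge_0 (A - A')). nra.
Qed.

(** The squared trace is at least four times the determinant, and the determinant grows by a factor
    every two steps. *)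
Lemma avg_trace_growth (eps : R) (a e : Z -> R) (alpha : R) (m : nat) :
  (forall x, 0 < a x <= alpha) -> forall x A B C, psd A B C ->
  0 <= avg_trace eps a e x (2 * m) A B C /\
  4 * (1 + 2 * eps ^ 2 / alpha ^ 2) ^ m * (A * C - B ^ 2)
  <= avg_trace eps a e x (2 * m) A B C ^ 2.
Proof.
  intros Ha; induction m as [|m IH]; intros x A B C HS.
  - destruct HS as (HA & HC & HD). simpl avg_trace. split; [lra|].
    pose proof (pow2_ge_0 (A - C)). pose proof (pow2_ge_0 B). simpl pow at 1. nra.
  - replace (2 * S m)%nat with (S (S (2 * m))) by lia.
    destruct (psd_two_steps eps (a x) (a (x + 1)%Z) (e x) (e (x + 1)%Z) A B C alpha
      (Ha x) (proj1 (Ha (x + 1)%Z)) HS) as (HS'' & H1 & _).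
    destruct (IH (x + 1 + 1)%Z _ _ _ HS'') as [IH1 IH2].
    change (avg_trace eps a e x (S (S (2 * m))) A B C) with
      (avg_trace eps a e (x + 1 + 1) (2 * m)
      (((e (x + 1)%Z ^ 2 + eps ^ 2) * (((e x ^ 2 + eps ^ 2) * A - 2 * e x * B + C) / a x ^ 2)
       - 2 * e (x + 1)%Z * (e x * A - B) + a x ^ 2 * A) / a (x + 1)%Z ^ 2)
      (e (x + 1)%Z * (((e x ^ 2 + eps ^ 2) * A - 2 * e x * B + C) / a x ^ 2) - (e x * A - B))
      (a (x + 1)%Z ^ 2 * (((e x ^ 2 + eps ^ 2) * A - 2 * e x * B + C) / a x ^ 2))).
    split; [exact IH1|]. eapply Rle_trans; [|exact IH2].
    set (th := 1 + 2 * eps ^ 2 / alpha ^ 2) in *.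
    assert (Hth : 0 <= th ^ m).
    { apply pow_le. unfold th. pose proof (Ha x).
      pose proof (Rmult_le_pos (2 * eps ^ 2) (/ alpha ^ 2)) as Hm.
      assert (0 <= 2 * eps ^ 2) by (pose proof (pow2_ge_0 eps); lra).
      assert (0 < / alpha ^ 2) by (apply Rinv_0_lt_compat; nra).
      unfold Rdiv. nra. }
    simpl pow at 1. replace (4 * (th * th ^ m) * (A * C - B ^ 2))
      with (4 * th ^ m * (th * (A * C - B ^ 2))) by ring.
    apply Rmult_le_compat_l; [lra|exact H1].
Qed.

(** The matrix [w w^T] has determinant 0: the first two steps create a determinant comparable with
    [sqn w ^ 2], and the other [2 * m] steps multiply it. [N] depends on the bounds alone and not on
    [a] and [e]. *)
Lemma orbit_growth (alpha K eps Lam : R) :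
  0 < alpha -> 0 < eps -> 0 < Lam ->
  exists N : nat, (0 < N)%nat /\ forall a e : Z -> R,
    (forall x, 0 < a x <= alpha) -> (forall x, Rabs (e x) <= K) ->
    forall x w, exists v : Z -> R, (forall y, Rabs (v y) <= eps) /\
      Lam ^ 2 * sqn w <= sqn (orbit a (fun y => e y - v y) x N w).
Proof.
  intros Halpha Heps HLam.
  set (th := 1 + 2 * eps ^ 2 / alpha ^ 2).
  assert (Hth : 1 < th).
  { unfold th. assert (0 < 2 * eps ^ 2 / alpha ^ 2); [|lra].
    apply Rdiv_lt_0_compat; nra. }
  set (k1 := 1 + 2 * K ^ 2 + 2 * alpha ^ 2).
  assert (Hk1 : 0 < k1) by (unfold k1; nra).
  destruct (Pow_x_infinity th ltac:(rewrite Rabs_pos_eq; lra)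
    (Lam ^ 4 * k1 ^ 2 / eps ^ 2)) as [m Hm].
  specialize (Hm m (Nat.le_refl m)). rewrite Rabs_pos_eq in Hm by (apply pow_le; lra).
  exists (S (S (2 * m))). split; [lia|].
  intros a e Ha He x w.
  destruct (exists_signs_ge_avg eps a e (S (S (2 * m))) ltac:(lra)
    (fun x => proj1 (Ha x)) x w) as (v & Hv & Hle).
  exists v; split; [exact Hv|]. eapply Rle_trans; [|exact Hle].
  set (A := fst w ^ 2) in *. set (B := fst w * snd w) in *. set (C := snd w ^ 2) in *.
  assert (HS : psd A B C) by (unfold psd, A, B, C; repeat split; nra).
  destruct (psd_two_steps eps (a x) (a (x + 1)%Z) (e x) (e (x + 1)%Z) A B C alpha
      (Ha x) (proj1 (Ha (x + 1)%Z)) HS) as (HS'' & _ & H2).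
  destruct (avg_trace_growth eps a e alpha m Ha (x + 1 + 1)%Z _ _ _ HS'') as [G1 G2].
  fold th in G2.
  set (T := avg_trace eps a e (x + 1 + 1) (2 * m) _ _ _) in G1, G2.
  change (avg_trace eps a e x (S (S (2 * m))) A B C) with T.
  set (A' := ((e x ^ 2 + eps ^ 2) * A - 2 * e x * B + C) / a x ^ 2) in *.
  set (D := _ * _ - _ ^ 2) in H2, G2.
  (* The second component of [w] enters the first one after one step, so [A'] sees [C] up to a
     multiple of [A]. *)
  assert (HAC : A + C <= k1 * (A + A')).
  { assert (Hax := Ha x).
    assert (HA' : a x ^ 2 * A' = (e x ^ 2 + eps ^ 2) * A - 2 * e x * B + C)
      by (unfold A'; field; lra).
    assert (HA'0 : 0 <= A').
    { apply (psd_step eps (a x) (e x) A B C); [lra|exact HS]. }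
    assert (Hf : 0 <= 2 * (e x ^ 2 * A) - 2 * e x * B + C / 2).
    { pose proof (psd_form_nonneg A B C (2 * e x) HS) as Hq. nra. }
    assert (He2 : e x ^ 2 <= K ^ 2).
    { rewrite <- (pow2_abs (e x)). apply pow_incr. split; [apply Rabs_pos|apply He]. }
    assert (Ha2 : a x ^ 2 <= alpha ^ 2) by (apply pow_incr; lra).
    destruct HS as (HA & HC & _).
    assert (C <= 2 * (a x ^ 2 * A') + 2 * (e x ^ 2 * A)).
    { rewrite HA'. assert (0 <= eps ^ 2 * A) by (pose proof (pow2_ge_0 eps); nra). nra. }
    assert (a x ^ 2 * A' <= alpha ^ 2 * A') by (apply Rmult_le_compat_r; auto).
    assert (e x ^ 2 * A <= K ^ 2 * A) by (apply Rmult_le_compat_r; auto).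
    unfold k1. assert (0 <= K ^ 2 * A') by (pose proof (pow2_ge_0 K); nra).
    assert (0 <= alpha ^ 2 * A) by (pose proof (pow2_ge_0 alpha); nra). nra. }
  assert (HACp : 0 <= A + C) by (unfold A, C; nra).
  assert (Hsq : (A + C) ^ 2 <= 2 * k1 ^ 2 * (A ^ 2 + A' ^ 2)).
  { apply Rle_trans with ((k1 * (A + A')) ^ 2); [apply pow_incr; lra|].
    pose proof (pow2_ge_0 (A - A')). pose proof (pow2_ge_0 k1).
    replace ((k1 * (A + A')) ^ 2) with (k1 ^ 2 * (A + A') ^ 2) by ring.
    replace (2 * k1 ^ 2 * (A ^ 2 + A' ^ 2)) with (k1 ^ 2 * (2 * (A ^ 2 + A' ^ 2))) by ring.
    apply Rmult_le_compat_l; nra. }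
  assert (HT2 : (Lam ^ 2 * (A + C)) ^ 2 <= T ^ 2).
  { eapply Rle_trans; [|exact G2].
    apply Rle_trans with (4 * th ^ m * (eps ^ 2 * (A ^ 2 + A' ^ 2))).
    - assert (He2 : 0 < eps ^ 2) by nra.
      assert (Hm' : Lam ^ 4 * k1 ^ 2 <= th ^ m * eps ^ 2).
      { apply Rge_le in Hm. apply Rmult_le_compat_r with (r := eps ^ 2) in Hm; [|lra].
        unfold Rdiv in Hm. rewrite Rmult_assoc, Rinv_l, Rmult_1_r in Hm; lra. }
      replace ((Lam ^ 2 * (A + C)) ^ 2) with (Lam ^ 4 * (A + C) ^ 2) by ring.
      apply Rle_trans with (Lam ^ 4 * (2 * k1 ^ 2 * (A ^ 2 + A' ^ 2))).
      + apply Rmult_le_compat_l; [apply pow_le; lra|exact Hsq].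
      + assert (0 <= A ^ 2 + A' ^ 2) by nra.
        replace (Lam ^ 4 * (2 * k1 ^ 2 * (A ^ 2 + A' ^ 2)))
          with (2 * (Lam ^ 4 * k1 ^ 2) * (A ^ 2 + A' ^ 2)) by ring.
        replace (4 * th ^ m * (eps ^ 2 * (A ^ 2 + A' ^ 2)))
          with (4 * (th ^ m * eps ^ 2) * (A ^ 2 + A' ^ 2)) by ring.
        apply Rmult_le_compat_r; [assumption|].
        assert (0 <= Lam ^ 4 * k1 ^ 2) by (apply Rmult_le_pos; apply pow_le; lra). lra.
    - apply Rmult_le_compat_l; [|exact H2].
      assert (0 <= th ^ m) by (apply pow_le; lra). lra. }
  unfold sqn. fold A C.
  apply Rsqr_incr_0_var; [|exact G1]. unfold Rsqr. simpl in HT2. lra.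
Qed.

(** * Buffers *)

Lemma div_nonneg (x y : R) : 0 <= x -> 0 < y -> 0 <= x / y.
Proof. intros Hx Hy; apply Rmult_le_pos; [exact Hx|left; apply Rinv_0_lt_compat; exact Hy]. Qed.

Definition comb (c d : R) (w z : R * R) : R * R :=
  (c * fst w + d * fst z, c * snd w + d * snd z).
Definition dot (w z : R * R) : R := fst w * fst z + snd w * snd z.
Definition cross (w z : R * R) : R := fst w * snd z - snd w * fst z.
Definition perp (w : R * R) : R * R := (- snd w, fst w).
(** Used for entrywise error bounds, whereas [norm2] goes with the orthogonal coordinates along [w]
    and [perp w]. *)
Definition norm1 (w : R * R) : R := Rabs (fst w) + Rabs (snd w).
Definition norm2 (w : R * R) : R := sqrt (sqn w).

Lemma norm1_comb (c d : R) (w z : R * R) :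
  norm1 (comb c d w z) <= Rabs c * norm1 w + Rabs d * norm1 z.
Proof.
  unfold norm1, comb; simpl.
  pose proof (Rabs_triang (c * fst w) (d * fst z)).
  pose proof (Rabs_triang (c * snd w) (d * snd z)).
  rewrite !Rabs_mult in *. lra.
Qed.

Lemma norm2_nonneg (w : R * R) : 0 <= norm2 w.
Proof. apply sqrt_pos. Qed.

Lemma norm2_sqr (w : R * R) : norm2 w * norm2 w = sqn w.
Proof.
  apply sqrt_sqrt. unfold sqn.
  pose proof (pow2_ge_0 (fst w)); pose proof (pow2_ge_0 (snd w)); lra.
Qed.

Lemma abs_fst_le_norm2 (w : R * R) : Rabs (fst w) <= norm2 w.
Proof.
  rewrite <- (sqrt_Rsqr_abs (fst w)). apply sqrt_le_1_alt. unfold sqn, Rsqr.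
  pose proof (pow2_ge_0 (snd w)); lra.
Qed.

Lemma abs_snd_le_norm2 (w : R * R) : Rabs (snd w) <= norm2 w.
Proof.
  rewrite <- (sqrt_Rsqr_abs (snd w)). apply sqrt_le_1_alt. unfold sqn, Rsqr.
  pose proof (pow2_ge_0 (fst w)); lra.
Qed.

Lemma abs_dot_le (w z : R * R) : Rabs (dot w z) <= norm2 w * norm1 z.
Proof.
  unfold dot, norm1. eapply Rle_trans; [apply Rabs_triang|]. rewrite !Rabs_mult.
  pose proof (abs_fst_le_norm2 w); pose proof (abs_snd_le_norm2 w).
  pose proof (Rabs_pos (fst z)); pose proof (Rabs_pos (snd z)). nra.
Qed.

Lemma abs_cross_le (w z : R * R) : Rabs (cross w z) <= norm2 w * norm1 z.
Proof.
  unfold cross, norm1, Rminus. eapply Rle_trans; [apply Rabs_triang|].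
  rewrite Rabs_Ropp, !Rabs_mult.
  pose proof (abs_fst_le_norm2 w); pose proof (abs_snd_le_norm2 w).
  pose proof (Rabs_pos (fst z)); pose proof (Rabs_pos (snd z)). nra.
Qed.

Lemma comb_dot_cross (w z : R * R) : 0 < sqn w ->
  z = comb (dot w z / sqn w) (cross w z / sqn w) w (perp w).
Proof.
  intros Hw. destruct z as [z1 z2], w as [w1 w2].
  unfold comb, dot, cross, perp, sqn in *; simpl in *. f_equal; field; lra.
Qed.

Lemma norm1_le_dot_cross (w z : R * R) : 0 < norm2 w ->
  norm1 z <= 2 * (Rabs (dot w z) / norm2 w + Rabs (cross w z) / norm2 w).
Proof.
  intros Hw. pose proof (norm2_sqr w) as Hs.
  assert (Hsq : 0 < sqn w) by nra.
  rewrite (comb_dot_cross w z Hsq) at 1.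
  eapply Rle_trans; [apply norm1_comb|].
  assert (H1 : norm1 w <= 2 * norm2 w).
  { unfold norm1. pose proof (abs_fst_le_norm2 w); pose proof (abs_snd_le_norm2 w). lra. }
  assert (H2 : norm1 (perp w) <= 2 * norm2 w).
  { unfold norm1, perp; simpl. rewrite Rabs_Ropp.
    pose proof (abs_fst_le_norm2 w); pose proof (abs_snd_le_norm2 w). lra. }
  assert (H3 : forall t, Rabs (t / sqn w) * (2 * norm2 w) = 2 * (Rabs t / norm2 w)).
  { intros t. unfold Rdiv. rewrite Rabs_mult, (Rabs_pos_eq (/ sqn w)).
    - rewrite <- Hs. field; lra.
    - left; apply Rinv_0_lt_compat; exact Hsq. }
  rewrite Rmult_plus_distr_l, <- !H3.
  apply Rplus_le_compat; apply Rmult_le_compat_l; auto; apply Rabs_pos.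
Qed.

Lemma orbit_comb (a e : Z -> R) (c d : R) (n : nat) : forall x w z,
  orbit a e x n (comb c d w z) = comb c d (orbit a e x n w) (orbit a e x n z).
Proof.
  induction n as [|n IH]; intros x w z; [reflexivity|]; simpl. rewrite <- IH. f_equal.
  unfold jstep, comb; simpl; f_equal; unfold Rdiv; ring.
Qed.

Lemma orbit_cross (a e : Z -> R) (n : nat) : (forall x, 0 < a x) -> forall x w z,
  cross (orbit a e x n w) (orbit a e x n z) = cross w z.
Proof.
  intros Ha; induction n as [|n IH]; intros x w z; [reflexivity|]; simpl. rewrite IH.
  specialize (Ha x). unfold jstep, cross; simpl; field; lra.
Qed.

Lemma jstep_norm1 (delta alpha K al e : R) (w : R * R) :
  0 < delta -> delta <= al <= alpha -> Rabs e <= K ->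
  norm1 (jstep al e w) <= ((K + 1) / delta + alpha) * norm1 w.
Proof.
  intros Hd Hal He. unfold jstep, norm1; simpl. unfold Rdiv.
  rewrite !Rabs_mult, (Rabs_pos_eq (/ al)), (Rabs_pos_eq al)
    by (try (left; apply Rinv_0_lt_compat); lra).
  set (p := Rabs (fst w)); set (q := Rabs (snd w)).
  assert (Hp : 0 <= p) by apply Rabs_pos. assert (Hq : 0 <= q) by apply Rabs_pos.
  assert (H1 : Rabs (e * fst w - snd w) <= K * p + q).
  { unfold Rminus. eapply Rle_trans; [apply Rabs_triang|].
    rewrite Rabs_Ropp, Rabs_mult. fold p q. nra. }
  assert (Hi : / al <= / delta) by (apply Rinv_le_contravar; lra).
  assert (Hi0 : 0 < / al) by (apply Rinv_0_lt_compat; lra).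
  pose proof (Rabs_pos (e * fst w - snd w)) as Hpos. pose proof (Rabs_pos e).
  assert (H2 : Rabs (e * fst w - snd w) * / al <= (K * p + q) * / delta)
    by (apply Rmult_le_compat; lra).
  assert (H3 : (K * p + q) * / delta <= (K + 1) * (p + q) * / delta).
  { apply Rmult_le_compat_r; [lra|]. nra. }
  nra.
Qed.

Lemma orbit_norm1 (delta alpha K : R) (a e : Z -> R) (n : nat) :
  0 < delta -> (forall x, delta <= a x <= alpha) -> (forall x, Rabs (e x) <= K) ->
  forall x w, norm1 (orbit a e x n w) <= ((K + 1) / delta + alpha) ^ n * norm1 w.
Proof.
  intros Hd Ha He; induction n as [|n IH]; intros x w; simpl; [lra|].
  set (L := (K + 1) / delta + alpha) in *.
  assert (HL : 0 <= L).
  { unfold L, Rdiv. specialize (Ha x). specialize (He x). pose proof (Rabs_pos (e x)).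
    assert (0 < / delta) by (apply Rinv_0_lt_compat; lra). nra. }
  eapply Rle_trans; [apply IH|].
  rewrite (Rmult_comm L), Rmult_assoc. apply Rmult_le_compat_l; [apply pow_le; exact HL|].
  apply jstep_norm1; auto.
Qed.

Lemma orbit_perturb (delta alpha K : R) (n : nat) : 0 < delta ->
  exists c, 0 <= c /\ forall (a e e' : Z -> R) (mu : R),
    (forall x, delta <= a x <= alpha) -> (forall x, Rabs (e x) <= K) ->
    (forall x, Rabs (e' x) <= K) -> (forall x, Rabs (e x - e' x) <= mu) ->
    forall x w, norm1 (comb 1 (- 1) (orbit a e x n w) (orbit a e' x n w)) <= mu * c * norm1 w.
Proof.
  intros Hd; induction n as [|n IH].
  - exists 0; split; [lra|]; intros. unfold comb, norm1; simpl.
    replace (1 * fst w + - 1 * fst w) with 0 by ring.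
    replace (1 * snd w + - 1 * snd w) with 0 by ring. rewrite Rabs_R0. lra.
  - destruct IH as (c & Hc & IH).
    (* Absolute values, because the constant is chosen before any [a] and [e] are given whose bounds
       would show that [K] and [alpha] are nonnegative. *)
    set (L := (Rabs K + 1) / delta + Rabs alpha).
    assert (HL : 0 <= L).
    { unfold L, Rdiv. pose proof (Rabs_pos K). pose proof (Rabs_pos alpha).
      assert (0 < / delta) by (apply Rinv_0_lt_compat; lra). nra. }
    exists (L ^ n / delta + c * L); split.
    { apply Rplus_le_le_0_compat; [|apply Rmult_le_pos; auto].
      apply Rmult_le_pos; [apply pow_le; auto|left; apply Rinv_0_lt_compat; lra]. }
    intros a e e' mu Ha He He' Hee x w. simpl.
    assert (HLe : (K + 1) / delta + alpha = L).
    { unfold L. pose proof (He x); pose proof (Rabs_pos (e x)); pose proof (Ha x).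
      rewrite !Rabs_pos_eq by lra. reflexivity. }
    set (s := jstep (a x) (e x) w); set (s' := jstep (a x) (e' x) w).
    (* Telescoping: the one-step error transported along [e], plus the difference of the two orbits
       of the same vector [s']. *)
    assert (Hsplit : comb 1 (-1) (orbit a e (x + 1) n s) (orbit a e' (x + 1) n s')
      = comb 1 1 (orbit a e (x + 1) n (comb 1 (-1) s s'))
          (comb 1 (-1) (orbit a e (x + 1) n s') (orbit a e' (x + 1) n s'))).
    { rewrite orbit_comb. unfold comb; simpl; f_equal; ring. }
    rewrite Hsplit. eapply Rle_trans; [apply norm1_comb|]. rewrite !Rabs_R1, !Rmult_1_l.
    assert (H1 : norm1 (orbit a e (x + 1) n (comb 1 (-1) s s')) <= L ^ n * (mu / delta * norm1 w)).
    { eapply Rle_trans; [apply (orbit_norm1 delta alpha K); auto|]. rewrite HLe.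
      apply Rmult_le_compat_l; [apply pow_le; exact HL|].
      unfold comb, s, s', jstep, norm1; simpl.
      replace (1 * (a x * fst w) + -1 * (a x * fst w)) with 0 by ring.
      replace (1 * ((e x * fst w - snd w) / a x) + -1 * ((e' x * fst w - snd w) / a x))
        with ((e x - e' x) * fst w * / a x) by (unfold Rdiv; ring).
      specialize (Ha x). rewrite Rabs_R0, !Rabs_mult, (Rabs_pos_eq (/ a x))
        by (left; apply Rinv_0_lt_compat; lra).
      specialize (Hee x). pose proof (Rabs_pos (e x - e' x)).
      pose proof (Rabs_pos (fst w)). pose proof (Rabs_pos (snd w)).
      assert (Hi : / a x <= / delta) by (apply Rinv_le_contravar; lra).
      assert (Hi0 : 0 < / a x) by (apply Rinv_0_lt_compat; lra).
      assert (Rabs (e x - e' x) * Rabs (fst w) * / a x <= mu * Rabs (fst w) * / delta).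
      { apply Rmult_le_compat; try lra; [apply Rmult_le_pos; lra|].
        apply Rmult_le_compat_r; lra. }
      assert (0 <= mu * Rabs (snd w) * / delta).
      { apply Rmult_le_pos; [apply Rmult_le_pos; lra|lra]. }
      unfold Rdiv. lra. }
    assert (H2 : norm1 (comb 1 (-1) (orbit a e (x + 1) n s') (orbit a e' (x + 1) n s'))
      <= mu * c * (L * norm1 w)).
    { eapply Rle_trans; [apply IH; auto|]. rewrite <- HLe. apply Rmult_le_compat_l.
      - apply Rmult_le_pos; [|exact Hc]. specialize (Hee x).
        pose proof (Rabs_pos (e x - e' x)); lra.
      - apply jstep_norm1; auto. }
    eapply Rle_trans; [apply Rplus_le_compat; [exact H1|exact H2]|].
    right; unfold Rdiv; ring.
Qed.

(** The cone [Y <= X] is invariant and [X] at least doubles in it. If the state at time [g] lies in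
    the cone, [X] doubles until [2 * g], yet stays below [M]. Otherwise no earlier state lies in the
    cone, and [Y] has halved at each step since time 0. *)
Lemma cone_decay (X Y : nat -> R) (M : R) (g : nat) :
  (forall j, 0 <= X j) -> (forall j, 0 <= Y j) ->
  (forall j, (j < 2 * g)%nat -> 4 * X j - (X j + Y j) / 2 <= X (S j)) ->
  (forall j, (j < 2 * g)%nat -> Y (S j) <= Y j / 4 + (X j + Y j) / 8) ->
  (forall j, (j <= 2 * g)%nat -> X j + Y j <= M) ->
  X g + Y g <= 2 * M / 2 ^ g.
Proof.
  intros HX HY H1 H2 HM.
  assert (Hp : forall i, 0 < 2 ^ i) by (intros; apply pow_lt; lra).
  destruct (Rle_dec (Y g) (X g)) as [Hc|Hc].
  - assert (K : forall i, (i <= g)%nat -> 2 ^ i * X g <= X (g + i)%nat /\ Y (g + i)%nat <= X (g + i)%nat).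
    { induction i as [|i IH]; intros Hi.
      - rewrite Nat.add_0_r; simpl; lra.
      - destruct IH as [IH1 IH2]; [lia|]. rewrite Nat.add_succ_r.
        specialize (H1 (g + i)%nat ltac:(lia)). specialize (H2 (g + i)%nat ltac:(lia)).
        specialize (HX (g + i)%nat). specialize (HY (g + i)%nat). simpl; lra. }
    destruct (K g (Nat.le_refl g)) as [K1 _].
    assert (Hb : X (g + g)%nat <= M).
    { specialize (HM (g + g)%nat ltac:(lia)). specialize (HY (g + g)%nat). lra. }
    apply Rmult_le_reg_r with (2 ^ g); [apply Hp|].
    unfold Rdiv; rewrite Rmult_assoc, Rinv_l by (specialize (Hp g); lra). specialize (Hp g). nra.
  - assert (K : forall i, (i <= g)%nat -> X (g - i)%nat < Y (g - i)%nat).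
    { induction i as [|i IH]; intros Hi; [rewrite Nat.sub_0_r; lra|].
      specialize (IH ltac:(lia)). apply Rnot_le_lt; intros Hle.
      specialize (H1 (g - S i)%nat ltac:(lia)). specialize (H2 (g - S i)%nat ltac:(lia)).
      replace (S (g - S i)) with (g - i)%nat in * by lia.
      specialize (HX (g - S i)%nat). specialize (HY (g - S i)%nat). lra. }
    assert (K2 : forall i, (i <= g)%nat -> 2 ^ i * Y i <= Y 0%nat).
    { induction i as [|i IH]; intros Hi; [simpl; lra|].
      specialize (IH ltac:(lia)). specialize (K (g - i)%nat ltac:(lia)).
      replace (g - (g - i))%nat with i in K by lia.
      specialize (H2 i ltac:(lia)). simpl.
      assert (Y (S i) <= Y i / 2) by lra. specialize (Hp i). nra. }
    specialize (K2 g (Nat.le_refl g)). specialize (HM 0%nat ltac:(lia)). specialize (HX 0%nat).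
    apply Rmult_le_reg_r with (2 ^ g); [apply Hp|].
    unfold Rdiv; rewrite Rmult_assoc, Rinv_l by (specialize (Hp g); lra). specialize (Hp g). nra.
Qed.

Definition state (a u : Z -> R) (x : Z) : R * R := (u x, a (x - 1)%Z * u (x - 1)%Z).

Lemma orbit_state (a b u : Z -> R) (E : R) (n : nat) : (forall x, 0 < a x) -> forall x,
  (forall y, (x <= y < x + Z.of_nat n)%Z -> jacobi a b u y = E * u y) ->
  orbit a (fun y => E - b y) x n (state a u x) = state a u (x + Z.of_nat n)%Z.
Proof.
  intros Ha; induction n as [|n IH]; intros x H.
  - simpl; rewrite Z.add_0_r; reflexivity.
  - simpl orbit.
    replace (jstep (a x) (E - b x) (state a u x)) with (state a u (x + 1)%Z).
    + rewrite IH; [f_equal; lia|]. intros y Hy; apply H; lia.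
    + unfold jstep, state; simpl. replace (x + 1 - 1)%Z with x by lia. f_equal.
      specialize (H x ltac:(lia)). unfold jacobi in H. specialize (Ha x).
      apply Rmult_eq_reg_l with (a x); [|lra]. field_simplify; [|lra]. lra.
Qed.

(* The coordinates of a state along the expanding direction [W] and across it. *)
Lemma cone_step (W W' PT z z' Tz : R * R) (tau mu : R) :
  0 < norm2 W -> 4 * norm2 W <= norm2 W' -> 0 <= tau -> 0 <= mu ->
  Tz = comb (dot W z / sqn W) (cross W z / sqn W) W' PT ->
  cross W' Tz = cross W z ->
  norm1 PT <= tau * norm2 W ->
  norm1 (comb 1 (-1) Tz z') <= mu * norm1 z ->
  let X := Rabs (dot W z) / norm2 W in let Y := Rabs (cross W z) / norm2 W in
  let X' := Rabs (dot W' z') / norm2 W' in let Y' := Rabs (cross W' z') / norm2 W' in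
  4 * X - tau * Y - 2 * mu * (X + Y) <= X' /\ Y' <= Y / 4 + 2 * mu * (X + Y).
Proof.
  intros HW HW' Htau Hmu HT Hcr HPT Herr X Y X' Y'.
  assert (HW'0 : 0 < norm2 W') by lra.
  pose proof (norm1_le_dot_cross W z HW) as Hz. fold X Y in Hz.
  assert (HX : 0 <= X) by (apply div_nonneg; [apply Rabs_pos|exact HW]).
  assert (HY : 0 <= Y) by (apply div_nonneg; [apply Rabs_pos|exact HW]).
  (* [Tz] is the image under the reference transfer matrix and [z'] the actual next state. *)
  assert (Herr2 : norm1 (comb 1 (-1) Tz z') <= 2 * mu * (X + Y)) by nra.
  assert (Hinv : 0 < / norm2 W') by (apply Rinv_0_lt_compat; exact HW'0).
  assert (Hlin : forall c, 0 <= c -> norm2 W' * c / norm2 W' = c) by (intros; field; lra).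
  split.
  - assert (H1 : Rabs (dot W' Tz) / norm2 W' - 2 * mu * (X + Y) <= X').
    { unfold X'.
      replace (dot W' Tz) with (dot W' z' + dot W' (comb 1 (-1) Tz z'))
        by (unfold dot, comb; simpl; ring).
      pose proof (Rabs_triang (dot W' z') (dot W' (comb 1 (-1) Tz z'))) as Ht.
      pose proof (abs_dot_le W' (comb 1 (-1) Tz z')) as Hd.
      assert (Hd' : Rabs (dot W' (comb 1 (-1) Tz z')) <= norm2 W' * (2 * mu * (X + Y))) by nra.
      apply Rmult_le_reg_l with (norm2 W'); [exact HW'0|]. unfold Rdiv. field_simplify; lra. }
    (* The component of [z] along [W] is stretched by [norm2 W' / norm2 W >= 4]; the part across [W]
       leaks at most [tau * Y] into it. *)
    assert (H2 : 4 * X - tau * Y <= Rabs (dot W' Tz) / norm2 W'); [|lra].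
    assert (Hdot : dot W' Tz = dot W z / sqn W * sqn W' + cross W z / sqn W * dot W' PT).
    { rewrite HT. unfold dot, comb, sqn; simpl; ring. }
    assert (Hs : 0 < sqn W) by (rewrite <- norm2_sqr; nra).
    pose proof (Rabs_triang (dot W' Tz) (- (cross W z / sqn W * dot W' PT))) as Ht.
    replace (dot W' Tz + - (cross W z / sqn W * dot W' PT))
      with (dot W z / sqn W * sqn W') in Ht by (rewrite Hdot; ring).
    rewrite Rabs_Ropp in Ht.
    assert (Ha : Rabs (dot W z / sqn W * sqn W') = X * norm2 W' * (norm2 W' / norm2 W)).
    { unfold X. rewrite <- !norm2_sqr. unfold Rdiv.
      rewrite !Rabs_mult, (Rabs_inv (_ * _)), !Rabs_mult, !(Rabs_pos_eq (norm2 _)) by apply norm2_nonneg.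
      field; lra. }
    assert (Hb : Rabs (cross W z / sqn W * dot W' PT) <= tau * Y * norm2 W').
    { rewrite Rabs_mult.
      replace (Rabs (cross W z / sqn W)) with (Y / norm2 W).
      - pose proof (abs_dot_le W' PT) as Hd.
        assert (Hd' : Rabs (dot W' PT) <= norm2 W' * (tau * norm2 W)) by nra.
        apply Rle_trans with (Y / norm2 W * (norm2 W' * (tau * norm2 W))).
        + apply Rmult_le_compat_l; [|exact Hd']. apply div_nonneg; auto.
        + right; field; lra.
      - unfold Y. rewrite <- norm2_sqr. unfold Rdiv.
        rewrite Rabs_mult, (Rabs_inv (_ * _)), Rabs_mult, !(Rabs_pos_eq (norm2 _)) by apply norm2_nonneg.
        field; lra. }
    assert (Hr : 4 <= norm2 W' / norm2 W).
    { apply Rmult_le_reg_r with (norm2 W); [exact HW|].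
      unfold Rdiv; rewrite Rmult_assoc, Rinv_l by lra. lra. }
    apply Rmult_le_reg_r with (norm2 W'); [exact HW'0|].
    unfold Rdiv at 1; rewrite Rmult_assoc, Rinv_l by lra.
    assert (X * norm2 W' * 4 <= X * norm2 W' * (norm2 W' / norm2 W)).
    { apply Rmult_le_compat_l; [nra|exact Hr]. }
    lra.
  - assert (H1 : Y' <= Rabs (cross W' Tz) / norm2 W' + 2 * mu * (X + Y)).
    { unfold Y'.
      replace (cross W' z') with (cross W' Tz + - cross W' (comb 1 (-1) Tz z'))
        by (unfold cross, comb; simpl; ring).
      pose proof (Rabs_triang (cross W' Tz) (- cross W' (comb 1 (-1) Tz z'))) as Ht.
      rewrite Rabs_Ropp in Ht.
      pose proof (abs_cross_le W' (comb 1 (-1) Tz z')) as Hd.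
      assert (Hd' : Rabs (cross W' (comb 1 (-1) Tz z')) <= norm2 W' * (2 * mu * (X + Y))) by nra.
      apply Rmult_le_reg_l with (norm2 W'); [exact HW'0|]. unfold Rdiv. field_simplify; lra. }
    rewrite Hcr in H1.
    (* The contraction comes from determinant 1: the cross product is preserved while its
       normalization grows by 4. *)
    assert (H2 : Rabs (cross W z) / norm2 W' <= Y / 4); [|lra].
    unfold Y. unfold Rdiv. rewrite Rmult_assoc. apply Rmult_le_compat_l; [apply Rabs_pos|].
    rewrite <- Rinv_mult. apply Rinv_le_contravar; lra.
Qed.

(* Near energy [E0] a suitable perturbation makes the transfer matrices uniformly
   hyperbolic, so a bounded solution is tiny in the middle of a long interval. *)
Lemma buffer (delta alpha K eps : R) : 0 < delta -> 0 < eps ->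
  exists (N : nat) (kappa C : R), (0 < N)%nat /\ 0 < kappa /\ 0 < C /\
  forall (a b : Z -> R) (E0 : R),
    (forall x, delta <= a x <= alpha) -> (forall x, Rabs (E0 - b x) <= K) ->
  forall x0 : Z, exists v : Z -> R, (forall x, Rabs (v x) <= eps) /\
  forall (om u : Z -> R) (E : R) (g : nat),
    Rabs (E - E0) <= kappa -> (forall x, Rabs (om x) <= kappa) ->
    (forall x, Rabs (u x) <= 1) ->
    (forall x, (x0 <= x < x0 + Z.of_nat (2 * g * N))%Z ->
       jacobi a (fun y => b y + v y + om y) u x = E * u x) ->
    Rabs (u (x0 + Z.of_nat (g * N))%Z) <= C / 2 ^ g /\
    Rabs (u (x0 + Z.of_nat (g * N) - 1)%Z) <= C / 2 ^ g.
Proof.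
  intros Hd Heps.
  set (al := Rabs alpha + delta).
  assert (Hal : 0 < al) by (unfold al; pose proof (Rabs_pos alpha); lra).
  set (K' := Rabs K + eps + 2).
  (* Expansion by 4 per block of [N] sites leaves room for errors in [cone_decay], which needs only
     2 in the end. *)
  destruct (orbit_growth al (Rabs K) eps 4 Hal Heps ltac:(lra)) as (N & HN & Hgrow).
  destruct (orbit_perturb delta al K' N Hd) as (c & Hc & Hpert).
  set (L := ((K' + 1) / delta + al) ^ N).
  assert (HL : 0 <= L).
  { apply pow_le. unfold Rdiv, K'. pose proof (Rabs_pos K).
    assert (0 < / delta) by (apply Rinv_0_lt_compat; lra). nra. }
  (* [tau] bounds the transported [perp W] relative to [W]. Weighting [Y] by [sigma] absorbs this
     shear: [tau * Y <= sigma * Y / 4]. *)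
  set (tau := 2 * L). set (sigma := 4 * tau + 1).
  assert (Hsig : 1 <= sigma) by (unfold sigma, tau; lra).
  (* The energy and [om] deviate by at most [kappa] each, so the transfer over a block errs by
     [2 * kappa * c]; the choice makes the weighted error term at most [(X + Y) / 8]. *)
  set (kappa := Rmin 1 (/ (32 * (c + 1) * sigma))).
  assert (Hkap : 0 < kappa).
  { apply Rmin_glb_lt; [lra|]. apply Rinv_0_lt_compat. nra. }
  assert (Hkap1 : kappa <= 1) by apply Rmin_l.
  assert (Hkap2 : 2 * (2 * kappa * c) * sigma <= 1 / 8).
  { assert (Hk : kappa <= / (32 * (c + 1) * sigma)) by apply Rmin_r.
    assert (Hk2 : kappa * (32 * (c + 1) * sigma) <= 1).
    { apply Rmult_le_compat_r with (r := 32 * (c + 1) * sigma) in Hk; [|nra].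
      rewrite Rinv_l in Hk; [exact Hk|]. nra. }
    assert (0 <= kappa * sigma) by nra. nra. }
  (* [1 + al] bounds the states of a solution bounded by 1. The division by [delta] below recovers
     [u (x - 1)] from the component [a (x - 1) * u (x - 1)]. *)
  set (C0 := 4 * ((1 + sigma) * (1 + al))).
  exists N, kappa, (C0 + C0 / delta). repeat split; auto.
  { assert (0 < C0) by (unfold C0; nra). assert (0 < C0 / delta) by (apply Rdiv_lt_0_compat; lra). lra. }
  intros a b E0 Ha Hb x0.
  assert (Ha' : forall x, 0 < a x <= al).
  { intros x; specialize (Ha x); pose proof (Rle_abs alpha); unfold al; lra. }
  assert (Ha'' : forall x, delta <= a x <= al) by (intros x; specialize (Ha x); specialize (Ha' x); lra).
  assert (HK : forall x, Rabs (E0 - b x) <= Rabs K)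
    by (intros x; eapply Rle_trans; [apply Hb|apply Rle_abs]).
  set (d := fun x => E0 - b x).
  (* [f] supplies a perturbation expanding any given incoming vector. [W] is then built block by
     block, each block being chosen for the vector that reaches it. *)
  destruct (choice (fun (p : Z * (R * R)) v => (forall y, Rabs (v y) <= eps) /\
    4 ^ 2 * sqn (snd p) <= sqn (orbit a (fun y => d y - v y) (fst p) N (snd p)))) as [f Hf].
  { intros [x w]. apply (Hgrow a d Ha' HK x w). }
  set (xs := fun j => (x0 + Z.of_nat (j * N))%Z).
  set (W := fix W (j : nat) : R * R := match j with O => (1, 0) | S i =>
    orbit a (fun y => d y - f (xs i, W i) y) (xs i) N (W i) end).
  (* Sites left of [x0] are sent to block 0, which keeps [v] bounded by [eps] there as well. *)
  set (idx := fun x => Z.to_nat ((x - x0) / Z.of_nat N)).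
  set (v := fun x => f (xs (idx x), W (idx x)) x).
  assert (Hv : forall x, Rabs (v x) <= eps) by (intros x; apply Hf).
  exists v; split; [exact Hv|].
  assert (HW : forall j, W (S j) = orbit a (fun y => d y - v y) (xs j) N (W j)).
  { intros j. change (W (S j)) with (orbit a (fun y => d y - f (xs j, W j) y) (xs j) N (W j)).
    apply orbit_ext. intros y Hy. unfold v.
    replace (idx y) with j; [reflexivity|].
    unfold idx, xs in *. rewrite Nat2Z.inj_mul in Hy.
    replace ((y - x0) / Z.of_nat N)%Z with (Z.of_nat j); [lia|].
    apply Z.div_unique_pos with (y - x0 - Z.of_nat N * Z.of_nat j)%Z; lia. }
  assert (HWg : forall j, 0 < norm2 (W j) /\ 4 * norm2 (W j) <= norm2 (W (S j))).
  { assert (Hstep : forall j, 4 * norm2 (W j) <= norm2 (W (S j))).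
    { intros j. unfold norm2. rewrite <- (sqrt_pow2 4) at 1 by lra.
      rewrite <- sqrt_mult_alt by lra. apply sqrt_le_1_alt.
      apply (proj2 (Hf (xs j, W j))). }
    intros j; split; [|apply Hstep].
    induction j as [|j IH].
    - unfold norm2, sqn; simpl. apply sqrt_lt_R0; lra.
    - specialize (Hstep j); lra. }
  intros om u E g HE Hom Hu Hsol.
  set (e := fun y => E - (b y + v y + om y)).
  set (z := fun j => state a u (xs j)).
  assert (He : forall y, Rabs (e y) <= K').
  { intros y. unfold e, K'.
    replace (E - (b y + v y + om y)) with ((E0 - b y) + ((E - E0) + (- v y + - om y))) by ring.
    eapply Rle_trans; [apply Rabs_triang|].
    pose proof (Rabs_triang (E - E0) (- v y + - om y)).
    pose proof (Rabs_triang (- v y) (- om y)). rewrite !Rabs_Ropp in *.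
    specialize (HK y); specialize (Hv y); specialize (Hom y). lra. }
  assert (Hdv : forall y, Rabs (d y - v y) <= K').
  { intros y. unfold d, K', Rminus. eapply Rle_trans; [apply Rabs_triang|].
    rewrite Rabs_Ropp. specialize (HK y); specialize (Hv y). unfold Rminus in HK. lra. }
  assert (Hde : forall y, Rabs (d y - v y - e y) <= 2 * kappa).
  { intros y. unfold d, e. replace (E0 - b y - v y - (E - (b y + v y + om y)))
      with (- (E - E0) + om y) by ring.
    eapply Rle_trans; [apply Rabs_triang|]. rewrite Rabs_Ropp. specialize (Hom y). lra. }
  set (X := fun j => Rabs (dot (W j) (z j)) / norm2 (W j)).
  set (Y := fun j => Rabs (cross (W j) (z j)) / norm2 (W j)).
  assert (HX : forall j, 0 <= X j)
    by (intros j; apply div_nonneg; [apply Rabs_pos|apply HWg]).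
  assert (HY : forall j, 0 <= Y j)
    by (intros j; apply div_nonneg; [apply Rabs_pos|apply HWg]).
  assert (Hcone : forall j, (j < 2 * g)%nat ->
    4 * X j - tau * Y j - 2 * (2 * kappa * c) * (X j + Y j) <= X (S j) /\
    Y (S j) <= Y j / 4 + 2 * (2 * kappa * c) * (X j + Y j)).
  { intros j Hj. destruct (HWg j) as [HWj HWj'].
    assert (Hs : 0 < sqn (W j)) by (rewrite <- norm2_sqr; nra).
    set (Tz := orbit a (fun y => d y - v y) (xs j) N (z j)).
    apply (cone_step (W j) (W (S j)) (orbit a (fun y => d y - v y) (xs j) N (perp (W j)))
      (z j) (z (S j)) Tz); auto.
    - unfold tau; lra.
    - nra.
    - unfold Tz. rewrite (comb_dot_cross (W j) (z j) Hs) at 1.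
      rewrite orbit_comb, <- HW. reflexivity.
    - unfold Tz. rewrite HW. apply orbit_cross. intros x; apply Ha'.
    - eapply Rle_trans; [apply (orbit_norm1 delta al K'); auto|]. fold L. unfold tau.
      rewrite (Rmult_comm 2 L), Rmult_assoc. apply Rmult_le_compat_l; [exact HL|].
      unfold norm1, perp; simpl. rewrite Rabs_Ropp.
      pose proof (abs_fst_le_norm2 (W j)); pose proof (abs_snd_le_norm2 (W j)). lra.
    - replace (z (S j)) with (orbit a e (xs j) N (z j)).
      + apply (Hpert a (fun y => d y - v y) e (2 * kappa)); auto.
      + unfold z. replace (xs (S j)) with (xs j + Z.of_nat N)%Z by (unfold xs; lia).
        apply (orbit_state a (fun y => b y + v y + om y) u E N).
        * intros x; apply Ha'.
        * intros y Hy; apply Hsol. unfold xs in Hy. nia. }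
  assert (Hz : forall j, norm1 (z j) <= 1 + al).
  { intros j. unfold norm1, z, state; simpl. rewrite Rabs_mult.
    pose proof (Hu (xs j)). pose proof (Hu (xs j - 1)%Z). specialize (Ha' (xs j - 1)%Z).
    rewrite (Rabs_pos_eq (a _)) by lra. pose proof (Rabs_pos (u (xs j - 1)%Z)). nra. }
  assert (Hdec : X g + sigma * Y g <= 2 * ((1 + sigma) * (1 + al)) / 2 ^ g).
  { apply (cone_decay X (fun j => sigma * Y j)).
    - exact HX.
    - intros j; specialize (HY j); nra.
    - intros j Hj. destruct (Hcone j Hj) as [H1 _]. specialize (HX j). specialize (HY j).
      assert (tau * Y j <= sigma * Y j / 4) by (unfold sigma; lra).
      assert (Hm : 2 * (2 * kappa * c) <= 1 / 8).
      { assert (0 <= 2 * (2 * kappa * c)) by nra. nra. }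
      assert (2 * (2 * kappa * c) * (X j + Y j) <= 1 / 8 * (X j + Y j))
        by (apply Rmult_le_compat_r; lra).
      nra.
    - intros j Hj. destruct (Hcone j Hj) as [_ H2]. specialize (HX j). specialize (HY j).
      assert (sigma * Y (S j) <= sigma * (Y j / 4) + 2 * (2 * kappa * c) * sigma * (X j + Y j)) by nra.
      assert (2 * (2 * kappa * c) * sigma * (X j + Y j) <= 1 / 8 * (X j + Y j))
        by (apply Rmult_le_compat_r; lra).
      nra.
    - intros j Hj. destruct (HWg j) as [HWj _].
      assert (X j <= norm1 (z j)).
      { unfold X. apply Rmult_le_reg_r with (norm2 (W j)); [exact HWj|].
        unfold Rdiv; rewrite Rmult_assoc, Rinv_l by lra. pose proof (abs_dot_le (W j) (z j)). lra. }
      assert (Y j <= norm1 (z j)).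
      { unfold Y. apply Rmult_le_reg_r with (norm2 (W j)); [exact HWj|].
        unfold Rdiv; rewrite Rmult_assoc, Rinv_l by lra. pose proof (abs_cross_le (W j) (z j)). lra. }
      specialize (Hz j). specialize (HX j). specialize (HY j). nra. }
  assert (Hg : norm1 (z g) <= C0 / 2 ^ g).
  { eapply Rle_trans; [apply (norm1_le_dot_cross (W g)); apply HWg|]. fold (X g) (Y g).
    apply Rle_trans with (2 * (X g + sigma * Y g)).
    - specialize (HY g). nra.
    - unfold C0. replace (4 * ((1 + sigma) * (1 + al)) / 2 ^ g)
        with (2 * (2 * ((1 + sigma) * (1 + al)) / 2 ^ g)) by (unfold Rdiv; ring). lra. }
  assert (H2g : 0 < / 2 ^ g) by (apply Rinv_0_lt_compat, pow_lt; lra).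
  assert (HC0 : 0 < C0) by (unfold C0; nra).
  assert (HC0d : 0 < C0 / delta) by (apply Rdiv_lt_0_compat; lra).
  unfold norm1, z, state in Hg; simpl in Hg.
  change (xs g) with (x0 + Z.of_nat (g * N))%Z in Hg.
  set (xg := (x0 + Z.of_nat (g * N))%Z) in *.
  rewrite Rabs_mult in Hg. specialize (Ha'' (xg - 1)%Z).
  rewrite (Rabs_pos_eq (a _)) in Hg by lra.
  pose proof (Rabs_pos (u xg)). pose proof (Rabs_pos (u (xg - 1)%Z)).
  unfold Rdiv at 1 3. rewrite Rmult_plus_distr_r. unfold Rdiv at 1 in Hg.
  assert (0 < C0 / delta * / 2 ^ g) by (apply Rmult_lt_0_compat; auto).
  assert (0 < C0 * / 2 ^ g) by (apply Rmult_lt_0_compat; auto).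
  split; [nra|].
  assert (Rabs (u (xg - 1)%Z) <= C0 / delta * / 2 ^ g); [|lra].
  apply Rmult_le_reg_l with delta; [exact Hd|].
  replace (delta * (C0 / delta * / 2 ^ g)) with (C0 * / 2 ^ g) by (field; split; [|lra]; apply pow_nonzero; lra).
  nra.
Qed.

(** * Spectral averaging *)

Definition ip (l : Z) (n : nat) (f g : Z -> R) : R := zint l n (fun x => f x * g x).

(** Summation by parts: the difference telescopes to boundary terms, which vanish with [f] and [g]
    outside the interval. *)
Lemma jacobi_symmetric (a b : Z -> R) (l : Z) (n : nat) (f g : Z -> R) :
  (forall x, ~ (l <= x < l + Z.of_nat n)%Z -> f x = 0) ->
  (forall x, ~ (l <= x < l + Z.of_nat n)%Z -> g x = 0) ->
  ip l n (jacobi a b f) g = ip l n f (jacobi a b g).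
Proof.
  intros Hf Hg. apply Rminus_diag_uniq. unfold ip. rewrite <- zint_minus.
  set (W := fun x => a x * (f (x + 1)%Z * g x - f x * g (x + 1)%Z)).
  rewrite (zint_ext _ _ _ (fun x => W x - W (x - 1)%Z)).
  - rewrite zint_telescope. unfold W.
    replace (l + Z.of_nat n - 1 + 1)%Z with (l + Z.of_nat n)%Z by lia.
    rewrite (Hf (l + Z.of_nat n)%Z), (Hg (l + Z.of_nat n)%Z), (Hf (l - 1)%Z), (Hg (l - 1)%Z) by lia.
    ring.
  - intros x _. unfold W, jacobi. replace (x - 1 + 1)%Z with x by lia. ring.
Qed.

Lemma rsum_zint (n : nat) (l : Z) (k : nat) (f : nat -> Z -> R) :
  rsum n (fun j => zint l k (f j)) = zint l k (fun x => rsum n (fun j => f j x)).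
Proof. apply rsum_exchange. Qed.

Lemma spectral_expansion (a b : Z -> R) (l : Z) (n : nat) (E : nat -> R) (phi : nat -> Z -> R)
  (f : Z -> R) (x : Z) : spectral_data a b l n E phi -> (l <= x < l + Z.of_nat n)%Z ->
  rsum n (fun j => phi j x * ip l n (phi j) f) = f x.
Proof.
  intros (_ & _ & _ & Hc) Hx. unfold ip.
  rewrite (rsum_ext _ _ (fun j => zint l n (fun y => phi j x * (phi j y * f y))))
    by (intros; symmetry; apply zint_scal).
  rewrite rsum_zint.
  rewrite (zint_ext _ _ _ (fun y => if Z.eq_dec y x then f y else 0)).
  - apply zint_delta; tauto.
  - intros y Hy. rewrite (rsum_ext _ _ (fun j => f y * (phi j x * phi j y))) by (intros; ring).
    rewrite rsum_scal, Hc by auto. destruct (Z.eq_dec x y), (Z.eq_dec y x); try congruence; ring.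
Qed.

Lemma spectral_parseval (a b : Z -> R) (l : Z) (n : nat) (E : nat -> R) (phi : nat -> Z -> R)
  (f : Z -> R) : spectral_data a b l n E phi ->
  rsum n (fun j => ip l n (phi j) f ^ 2) = zint l n (fun x => f x ^ 2).
Proof.
  intros HS.
  rewrite (rsum_ext _ _ (fun j => zint l n (fun y => ip l n (phi j) f * (phi j y * f y))))
    by (intros; rewrite zint_scal; unfold ip; ring).
  rewrite rsum_zint. apply zint_ext. intros y Hy.
  rewrite (rsum_ext _ _ (fun j => f y * (phi j y * ip l n (phi j) f))) by (intros; ring).
  rewrite rsum_scal, (spectral_expansion _ _ _ _ _ _ _ _ HS) by auto. ring.
Qed.

Lemma jacobi_rsum (a b : Z -> R) (n : nat) (c : nat -> R) (f : nat -> Z -> R) (x : Z) :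
  jacobi a b (fun y => rsum n (fun j => c j * f j y)) x
  = rsum n (fun j => c j * jacobi a b (f j) x).
Proof.
  induction n as [|n IH].
  - unfold jacobi; simpl; ring.
  - simpl. rewrite <- IH. unfold jacobi; ring.
Qed.

(** The truncation [f] of [u] to the interval satisfies the equation up to errors of size
    [alpha * rho] at the end sites, and the resolvent of the interval at [e] has norm at most
    [1 / s]. *)
Lemma nonresonant_small (a b : Z -> R) (l : Z) (n : nat) (E : nat -> R) (phi : nat -> Z -> R)
  (u : Z -> R) (e s rho alpha : R) :
  spectral_data a b l n E phi -> (forall x, 0 < a x <= alpha) -> 0 < s -> 0 <= rho ->
  (forall x, (l <= x < l + Z.of_nat n)%Z -> jacobi a b u x = e * u x) ->
  Rabs (u (l - 1)%Z) <= rho -> Rabs (u (l + Z.of_nat n)%Z) <= rho ->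
  (forall j, (j < n)%nat -> s <= Rabs (e - E j)) ->
  forall x, (l <= x < l + Z.of_nat n)%Z -> Rabs (u x) <= 2 * alpha * rho / s.
Proof.
  intros HS Ha Hs Hrho Hu Hl Hr Hsep x Hx.
  assert (Halpha : 0 < alpha) by (specialize (Ha 0%Z); lra).
  set (r := (l + Z.of_nat n)%Z) in *.
  set (f := fun y => if Z_le_dec l y then if Z_lt_dec y r then u y else 0 else 0).
  assert (Hin : forall y, (l <= y < r)%Z -> f y = u y).
  { intros y Hy; unfold f. destruct (Z_le_dec l y), (Z_lt_dec y r); auto; lia. }
  assert (Hout : forall y, ~ (l <= y < r)%Z -> f y = 0).
  { intros y Hy; unfold f. destruct (Z_le_dec l y), (Z_lt_dec y r); auto; lia. }
  set (d1 := fun y => if Z.eq_dec y l then a (y - 1)%Z * u (y - 1)%Z else 0).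
  set (d2 := fun y => if Z.eq_dec y (r - 1) then a y * u (y + 1)%Z else 0).
  assert (Hres : forall y, (l <= y < r)%Z -> jacobi a b f y - e * f y = - (d1 y + d2 y)).
  { intros y Hy. rewrite Hin by auto. rewrite <- (Hu y Hy).
    unfold jacobi. rewrite (Hin y) by auto. unfold d1, d2.
    destruct (Z.eq_dec y l) as [->|H1].
    - rewrite (Hout (l - 1)%Z) by lia.
      destruct (Z.eq_dec l (r - 1)) as [H2|H2].
      + rewrite (Hout (l + 1)%Z) by lia. ring.
      + rewrite (Hin (l + 1)%Z) by lia. ring.
    - rewrite (Hin (y - 1)%Z) by lia.
      destruct (Z.eq_dec y (r - 1)) as [H2|H2].
      + rewrite (Hout (y + 1)%Z) by lia. ring.
      + rewrite (Hin (y + 1)%Z) by lia. ring. }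
  assert (Hsum : zint l n (fun y => (jacobi a b f y - e * f y) ^ 2) <= (2 * alpha * rho) ^ 2).
  (* The factors 2 are there because both errors sit at the same site if [n = 1]. *)
  { apply Rle_trans with (zint l n (fun y => 2 * d1 y ^ 2 + 2 * d2 y ^ 2)).
    - apply zint_le; intros y Hy. rewrite Hres by auto. pose proof (pow2_ge_0 (d1 y - d2 y)). lra.
    - rewrite zint_plus, !zint_scal.
      assert (Hb : forall y c, Rabs c <= rho -> (a y * c) ^ 2 <= (alpha * rho) ^ 2).
      { intros y c Hc. rewrite <- (pow2_abs (a y * c)), Rabs_mult. specialize (Ha y).
        rewrite (Rabs_pos_eq (a y)) by lra. pose proof (Rabs_pos c).
        apply pow_incr. split; [apply Rmult_le_pos; lra|apply Rmult_le_compat; lra]. }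
      assert (H1 : zint l n (fun y => d1 y ^ 2) <= (alpha * rho) ^ 2).
      { rewrite (zint_ext _ _ _
          (fun y => if Z.eq_dec y l then (a (y - 1)%Z * u (y - 1)%Z) ^ 2 else 0)).
        - rewrite (zint_delta l n l (fun y => (a (y - 1)%Z * u (y - 1)%Z) ^ 2)) by lia.
          apply Hb, Hl.
        - intros y _. unfold d1. destruct (Z.eq_dec y l); ring. }
      assert (H2 : zint l n (fun y => d2 y ^ 2) <= (alpha * rho) ^ 2).
      { rewrite (zint_ext _ _ _
          (fun y => if Z.eq_dec y (r - 1) then (a y * u (y + 1)%Z) ^ 2 else 0)).
        - rewrite (zint_delta l n (r - 1) (fun y => (a y * u (y + 1)%Z) ^ 2)) by lia.
          apply Hb. replace (r - 1 + 1)%Z with r by lia. exact Hr.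
        - intros y _. unfold d2. destruct (Z.eq_dec y (r - 1)); ring. }
      replace ((2 * alpha * rho) ^ 2) with (2 * (alpha * rho) ^ 2 + 2 * (alpha * rho) ^ 2) by ring.
      lra. }
  rewrite <- (spectral_parseval a b l n E phi _ HS) in Hsum.
  assert (Hcoef : forall j, (j < n)%nat ->
    ip l n (phi j) (fun y => jacobi a b f y - e * f y) = (E j - e) * ip l n (phi j) f).
  { intros j Hj. destruct HS as (Hpo & Hpe & _).
    transitivity (ip l n (phi j) (jacobi a b f) - e * ip l n (phi j) f).
    - unfold ip. rewrite <- zint_scal, <- zint_minus. apply zint_ext; intros; ring.
    - rewrite <- jacobi_symmetric; [|intros; apply Hpo; auto|exact Hout].
      replace (ip l n (jacobi a b (phi j)) f) with (E j * ip l n (phi j) f); [ring|].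
      unfold ip. rewrite <- zint_scal. apply zint_ext. intros y Hy.
      rewrite Hpe by auto. ring. }
  assert (Hf : s ^ 2 * zint l n (fun y => f y ^ 2) <= (2 * alpha * rho) ^ 2).
  { rewrite <- (spectral_parseval a b l n E phi _ HS), <- rsum_scal.
    eapply Rle_trans; [|exact Hsum]. apply rsum_le. intros j Hj.
    rewrite Hcoef by auto. rewrite Rpow_mult_distr.
    apply Rmult_le_compat_r; [apply pow2_ge_0|].
    rewrite <- (pow2_abs (E j - e)), Rabs_minus_sym. apply pow_incr.
    split; [lra|apply Hsep; auto]. }
  assert (Hux : s ^ 2 * u x ^ 2 <= (2 * alpha * rho) ^ 2).
  { eapply Rle_trans; [|exact Hf]. apply Rmult_le_compat_l; [nra|].
    rewrite <- Hin by auto. apply (zint_term_le l n (fun y => f y ^ 2)); auto.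
    intros; apply pow2_ge_0. }
  apply Rmult_le_reg_l with s; [exact Hs|].
  replace (s * (2 * alpha * rho / s)) with (2 * alpha * rho) by (field; lra).
  apply Rsqr_incr_0_var; [|nra]. unfold Rsqr.
  rewrite <- (pow2_abs (u x)) in Hux. simpl in Hux. lra.
Qed.

(* Real and imaginary part of the entry [(m, x)] of the resolvent at the energy [lam + i s]. *)
Definition res_re (n : nat) (E : nat -> R) (phi : nat -> Z -> R) (lam s : R) (m x : Z) : R :=
  rsum n (fun j => (phi j m * ((E j - lam) / ((E j - lam) ^ 2 + s ^ 2))) * phi j x).
Definition res_im (n : nat) (E : nat -> R) (phi : nat -> Z -> R) (lam s : R) (m x : Z) : R :=
  rsum n (fun j => (phi j m * (s / ((E j - lam) ^ 2 + s ^ 2))) * phi j x).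

(** Real and imaginary part of [(J - lam - i s) G = delta_m]. *)
Lemma resolvent_equation (a b : Z -> R) (l : Z) (n : nat) (E : nat -> R) (phi : nat -> Z -> R)
  (lam s : R) (m x : Z) :
  spectral_data a b l n E phi -> 0 < s -> (l <= m < l + Z.of_nat n)%Z ->
  (l <= x < l + Z.of_nat n)%Z ->
  jacobi a b (res_re n E phi lam s m) x - lam * res_re n E phi lam s m x
    + s * res_im n E phi lam s m x = (if Z.eq_dec x m then 1 else 0) /\
  jacobi a b (res_im n E phi lam s m) x - lam * res_im n E phi lam s m x
    - s * res_re n E phi lam s m x = 0.
Proof.
  intros (_ & He & _ & Hc) Hs Hm Hx.
  assert (Hd : forall j, (E j - lam) ^ 2 + s ^ 2 <> 0)
    by (intros j; pose proof (pow2_ge_0 (E j - lam)); nra).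
  unfold res_re, res_im. rewrite !jacobi_rsum, <- !rsum_scal. split.
  - rewrite <- rsum_minus, <- rsum_plus.
    transitivity (rsum n (fun j => phi j m * phi j x)).
    + apply rsum_ext; intros j Hj. rewrite He by auto. field; auto.
    + rewrite Hc by auto. destruct (Z.eq_dec m x), (Z.eq_dec x m); congruence.
  - rewrite <- !rsum_minus. rewrite (rsum_ext _ _ (fun _ => 0)).
    + rewrite rsum_const; ring.
    + intros j Hj. rewrite He by auto. field; auto.
Qed.

Definition bump (b : Z -> R) (m : Z) (t : R) (x : Z) : R := b x + (if Z.eq_dec x m then t else 0).

(* The resolvent identity [G_0 - G_t = t G_0 G_t] for a perturbation of size [t] at the site [m]. *)
Lemma rank_one_resolvent (a b : Z -> R) (l : Z) (n : nat) (E E' : nat -> R)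
  (phi phi' : nat -> Z -> R) (lam s t : R) (m : Z) :
  spectral_data a b l n E phi -> spectral_data a (bump b m t) l n E' phi' ->
  0 < s -> (l <= m < l + Z.of_nat n)%Z ->
  let g1 := res_re n E phi lam s m m in let g2 := res_im n E phi lam s m m in
  let x1 := res_re n E' phi' lam s m m in let x2 := res_im n E' phi' lam s m m in
  g1 - x1 = t * (g1 * x1 - g2 * x2) /\ g2 - x2 = t * (g1 * x2 + g2 * x1).
Proof.
  intros HS HS' Hs Hm g1 g2 x1 x2.
  set (al := res_re n E phi lam s m) in *. set (be := res_im n E phi lam s m) in *.
  set (al' := res_re n E' phi' lam s m) in *. set (be' := res_im n E' phi' lam s m) in *.
  assert (Hsup : forall (F : nat -> R) (psi : nat -> Z -> R) c, spectral_data a c l n F psi ->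
    forall x, ~ (l <= x < l + Z.of_nat n)%Z ->
    res_re n F psi lam s m x = 0 /\ res_im n F psi lam s m x = 0).
  { intros F psi c (H & _) x Hx. unfold res_re, res_im.
    split; rewrite (rsum_ext _ _ (fun _ => 0)); try (rewrite rsum_const; ring);
      intros; rewrite (H _ x Hx); ring. }
  assert (Heq := fun x => resolvent_equation a b l n E phi lam s m x HS Hs Hm).
  assert (Heq' := fun x => resolvent_equation a (bump b m t) l n E' phi' lam s m x HS' Hs Hm).
  fold al be in Heq. fold al' be' in Heq'.
  assert (Hal := fun x Hx => proj1 (Hsup E phi b HS x Hx)). fold al in Hal.
  assert (Hbe := fun x Hx => proj2 (Hsup E phi b HS x Hx)). fold be in Hbe.
  assert (Hal' := fun x Hx => proj1 (Hsup E' phi' _ HS' x Hx)). fold al' in Hal'.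
  assert (Hbe' := fun x Hx => proj2 (Hsup E' phi' _ HS' x Hx)). fold be' in Hbe'.
  assert (Hbump : forall f x, jacobi a (bump b m t) f x
    = jacobi a b f x + (if Z.eq_dec x m then t * f x else 0)).
  { intros f x; unfold jacobi, bump. destruct (Z.eq_dec x m); ring. }
  assert (Hdel : forall f, zint l n (fun x => if Z.eq_dec x m then f x else 0) = f m).
  { intros f; apply zint_delta; tauto. }
  (* Pair the column at [m] of one resolvent with that of the other and move [J] across: by the
     resolvent equations only terms at [m] survive. Four pairings give the real and the imaginary
     part. *)
  pose proof (jacobi_symmetric a b l n al al' Hal Hal') as S1.
  pose proof (jacobi_symmetric a b l n be be' Hbe Hbe') as S2.
  pose proof (jacobi_symmetric a b l n al be' Hal Hbe') as S3.
  pose proof (jacobi_symmetric a b l n be al' Hbe Hal') as S4.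
  unfold ip in S1, S2, S3, S4.
  split.
  - assert (H : zint l n (fun x => jacobi a b al x * al' x) - zint l n (fun x => jacobi a b be x * be' x)
      - (zint l n (fun x => al x * jacobi a b al' x) - zint l n (fun x => be x * jacobi a b be' x))
      = zint l n (fun x => if Z.eq_dec x m then al' x - al x + t * (al x * al' x - be x * be' x) else 0)).
    { rewrite <- !zint_minus. apply zint_ext. intros x Hx.
      destruct (Heq x Hx) as [H1 H2]. destruct (Heq' x Hx) as [H3 H4].
      rewrite Hbump in H3, H4.
      replace (jacobi a b al x) with ((if Z.eq_dec x m then 1 else 0) + lam * al x - s * be x) by lra.
      replace (jacobi a b be x) with (lam * be x + s * al x) by lra.
      replace (jacobi a b al' x) with ((if Z.eq_dec x m then 1 else 0) + lam * al' x - s * be' x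
        - (if Z.eq_dec x m then t * al' x else 0)) by lra.
      replace (jacobi a b be' x) with (lam * be' x + s * al' x
        - (if Z.eq_dec x m then t * be' x else 0)) by lra.
      destruct (Z.eq_dec x m); ring. }
    rewrite Hdel in H. fold g1 g2 x1 x2 in H. unfold g1, g2, x1, x2 in *. lra.
  - assert (H : zint l n (fun x => jacobi a b al x * be' x) + zint l n (fun x => jacobi a b be x * al' x)
      - (zint l n (fun x => al x * jacobi a b be' x) + zint l n (fun x => be x * jacobi a b al' x))
      = zint l n (fun x => if Z.eq_dec x m then be' x - be x + t * (al x * be' x + be x * al' x) else 0)).
    { rewrite <- !zint_plus, <- zint_minus. apply zint_ext. intros x Hx.
      destruct (Heq x Hx) as [H1 H2]. destruct (Heq' x Hx) as [H3 H4].
      rewrite Hbump in H3, H4.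
      replace (jacobi a b al x) with ((if Z.eq_dec x m then 1 else 0) + lam * al x - s * be x) by lra.
      replace (jacobi a b be x) with (lam * be x + s * al x) by lra.
      replace (jacobi a b al' x) with ((if Z.eq_dec x m then 1 else 0) + lam * al' x - s * be' x
        - (if Z.eq_dec x m then t * al' x else 0)) by lra.
      replace (jacobi a b be' x) with (lam * be' x + s * al' x
        - (if Z.eq_dec x m then t * be' x else 0)) by lra.
      destruct (Z.eq_dec x m); ring. }
    rewrite Hdel in H. unfold g1, g2, x1, x2 in *. lra.
Qed.

(** In complex terms [g - x = t g x], so [t = 1/x - 1/g], where both reciprocals are smaller than
    [tau] in modulus. *)
Lemma large_resolvents_close (g1 g2 x1 x2 t tau : R) : 0 < tau ->
  g1 - x1 = t * (g1 * x1 - g2 * x2) -> g2 - x2 = t * (g1 * x2 + g2 * x1) ->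
  / tau ^ 2 < g1 ^ 2 + g2 ^ 2 -> / tau ^ 2 < x1 ^ 2 + x2 ^ 2 -> Rabs t <= 2 * tau.
Proof.
  intros Htau H1 H2 Hg Hx. set (G := g1 ^ 2 + g2 ^ 2) in *. set (X := x1 ^ 2 + x2 ^ 2) in *.
  assert (Ht2 : 0 < tau ^ 2) by nra.
  assert (Hi : 0 < / tau ^ 2) by (apply Rinv_0_lt_compat; exact Ht2).
  assert (Hm : t ^ 2 * (G * X) <= 2 * G + 2 * X).
  { replace (t ^ 2 * (G * X)) with ((t * (g1 * x1 - g2 * x2)) ^ 2 + (t * (g1 * x2 + g2 * x1)) ^ 2)
      by (unfold G, X; ring).
    rewrite <- H1, <- H2. unfold G, X.
    pose proof (pow2_ge_0 (g1 + x1)). pose proof (pow2_ge_0 (g2 + x2)). lra. }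
  assert (HG1 : 1 < tau ^ 2 * G).
  { rewrite <- (Rinv_r (tau ^ 2)) by lra. apply Rmult_lt_compat_l; auto. }
  assert (HX1 : 1 < tau ^ 2 * X).
  { rewrite <- (Rinv_r (tau ^ 2)) by lra. apply Rmult_lt_compat_l; auto. }
  assert (Hb : t ^ 2 <= 4 * tau ^ 2).
  { apply Rmult_le_reg_r with (G * X); [apply Rmult_lt_0_compat; lra|].
    eapply Rle_trans; [exact Hm|]. nra. }
  apply Rsqr_incr_0_var; [|lra]. unfold Rsqr. rewrite <- (pow2_abs t) in Hb. simpl in Hb. lra.
Qed.

Definition ind_lt (x y : R) : R := if Rlt_dec x y then 1 else 0.

Definition resonant_mass (n : nat) (E : nat -> R) (phi : nat -> Z -> R) (m : Z) (lam s : R) : R :=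
  rsum n (fun j => phi j m ^ 2 * ind_lt (Rabs (E j - lam)) s).

(** [s * Im G] sums [phi^2] against the weight [s^2 / ((E - lam)^2 + s^2)], which is at least 1/2 at
    resonant eigenvalues and at most 1 everywhere. For [s = tau^2] the bound [|G| <= 1 / tau] makes
    [s * Im G] at most [tau]. *)
Lemma resonant_mass_bound (a b : Z -> R) (l : Z) (n : nat) (E : nat -> R) (phi : nat -> Z -> R)
  (lam tau : R) (m : Z) :
  spectral_data a b l n E phi -> 0 < tau -> (l <= m < l + Z.of_nat n)%Z ->
  0 <= resonant_mass n E phi m lam (tau ^ 2) <= 2 /\
  (res_re n E phi lam (tau ^ 2) m m ^ 2 + res_im n E phi lam (tau ^ 2) m m ^ 2 <= / tau ^ 2 ->
   resonant_mass n E phi m lam (tau ^ 2) <= 2 * tau).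
Proof.
  intros (_ & _ & _ & Hc) Htau Hm. set (s := tau ^ 2). assert (Hs : 0 < s) by (unfold s; nra).
  assert (H0 : 0 <= resonant_mass n E phi m lam s).
  { apply rsum_nonneg; intros j _. apply Rmult_le_pos; [apply pow2_ge_0|].
    unfold ind_lt; destruct (Rlt_dec _ _); lra. }
  assert (H1 : resonant_mass n E phi m lam s <= 2 * (s * res_im n E phi lam s m m)).
  { unfold resonant_mass, res_im. rewrite <- !rsum_scal. apply rsum_le. intros j _.
    set (d := (E j - lam) ^ 2 + s ^ 2).
    assert (Hd : 0 < d) by (unfold d; pose proof (pow2_ge_0 (E j - lam)); nra).
    replace (2 * (s * (phi j m * (s / d) * phi j m))) with (phi j m ^ 2 * (2 * s ^ 2 / d)) by (field; lra).
    apply Rmult_le_compat_l; [apply pow2_ge_0|]. unfold ind_lt.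
    destruct (Rlt_dec _ _) as [Hlt|_].
    - apply Rmult_le_reg_r with d; [exact Hd|].
      unfold Rdiv; rewrite (Rmult_assoc (2 * s ^ 2)), Rinv_l by lra.
      unfold d. rewrite <- (pow2_abs (E j - lam)).
      assert (Rabs (E j - lam) ^ 2 <= s ^ 2)
        by (apply pow_incr; split; [apply Rabs_pos|lra]). lra.
    - apply Rmult_le_pos; [nra|left; apply Rinv_0_lt_compat; exact Hd]. }
  split; [split; [exact H0|]|].
  - eapply Rle_trans; [exact H1|].
    assert (s * res_im n E phi lam s m m <= 1); [|lra].
    transitivity (rsum n (fun j => phi j m * phi j m)).
    + unfold res_im. rewrite <- rsum_scal. apply rsum_le. intros j _.
      set (d := (E j - lam) ^ 2 + s ^ 2).
      assert (Hd : s ^ 2 <= d) by (unfold d; pose proof (pow2_ge_0 (E j - lam)); lra).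
      assert (Hs2 : 0 < s ^ 2) by nra.
      replace (s * (phi j m * (s / d) * phi j m)) with (phi j m * phi j m * (s ^ 2 / d)) by (field; lra).
      rewrite <- (Rmult_1_r (phi j m * phi j m)) at 2.
      apply Rmult_le_compat_l; [nra|].
      apply Rmult_le_reg_r with d; [lra|].
      unfold Rdiv; rewrite Rmult_assoc, Rinv_l; lra.
    + rewrite Hc by auto. destruct (Z.eq_dec m m); [lra|congruence].
  - intros Hg. eapply Rle_trans; [exact H1|].
    assert (s * res_im n E phi lam s m m <= tau); [|lra].
    set (g1 := res_re n E phi lam s m m) in *. set (g2 := res_im n E phi lam s m m) in *.
    apply Rsqr_incr_0_var; [|lra]. unfold Rsqr.
    assert (Hg2 : g2 ^ 2 <= / s) by (pose proof (pow2_ge_0 g1); unfold s in *; lra).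
    replace (s * g2 * (s * g2)) with (s * (s * g2 ^ 2)) by ring.
    replace (tau * tau) with (s * 1) by (unfold s; ring).
    apply Rmult_le_compat_l; [lra|]. rewrite <- (Rinv_r s) by lra.
    apply Rmult_le_compat_l; lra.
Qed.

Lemma clustered_count (P : nat -> Prop) (Pdec : forall q, {P q} + {~ P q}) (L : R) (Q : nat) :
  0 <= L ->
  (forall q q', (q < Q)%nat -> (q' < Q)%nat -> P q -> P q' -> Rabs (INR q - INR q') <= L) ->
  rsum Q (fun q => if Pdec q then 1 else 0) <= L + 1.
Proof.
  intros HL HP.
  assert (K : forall k, (k <= Q)%nat -> rsum k (fun q => if Pdec q then 1 else 0) = 0 \/
    exists q1 q2, (q1 < k)%nat /\ (q2 < k)%nat /\ P q1 /\ P q2 /\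
      rsum k (fun q => if Pdec q then 1 else 0) <= INR q2 - INR q1 + 1).
  { induction k as [|k IH]; intros Hk; [left; reflexivity|]. simpl.
    destruct (IH ltac:(lia)) as [IH0|(q1 & q2 & H1 & H2 & P1 & P2 & Hle)]; destruct (Pdec k) as [Pk|Pk].
    - right; exists k, k. rewrite IH0. repeat split; auto; lra.
    - left; rewrite IH0; ring.
    - right; exists q1, k. repeat split; auto.
      assert (INR q2 + 1 <= INR k) by (rewrite <- S_INR; apply le_INR; lia). lra.
    - right; exists q1, q2. repeat split; auto; lra. }
  destruct (K Q (Nat.le_refl Q)) as [H|(q1 & q2 & H1 & H2 & P1 & P2 & Hle)]; [lra|].
  specialize (HP q2 q1 H2 H1 P2 P1). pose proof (Rle_abs (INR q2 - INR q1)). lra.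
Qed.

(* Spectral averaging over a grid of values of the potential at the site [m]. *)
Lemma grid_average (a b : Z -> R) (l : Z) (n : nat) (E : nat -> nat -> R)
  (phi : nat -> nat -> Z -> R) (m : Z) (lam tau h : R) (Q : nat) :
  (forall q, spectral_data a (bump b m (h * INR q)) l n (E q) (phi q)) ->
  0 < tau -> 0 < h -> (l <= m < l + Z.of_nat n)%Z ->
  rsum Q (fun q => resonant_mass n (E q) (phi q) m lam (tau ^ 2))
  <= INR Q * (2 * tau) + 2 * (2 * tau / h + 1).
Proof.
  intros HS Htau Hh Hm.
  set (g1 := fun q => res_re n (E q) (phi q) lam (tau ^ 2) m m).
  set (g2 := fun q => res_im n (E q) (phi q) lam (tau ^ 2) m m).
  set (dec := fun q => Rlt_dec (/ tau ^ 2) (g1 q ^ 2 + g2 q ^ 2)).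
  (* The values of the potential with a large resolvent entry lie within [2 * tau] of each other, so
     only [2 * tau / h + 1] grid points need the trivial bound 2. *)
  apply Rle_trans with (rsum Q (fun q => 2 * tau + 2 * (if dec q then 1 else 0))).
  - apply rsum_le. intros q _.
    destruct (resonant_mass_bound a _ l n (E q) (phi q) lam tau m (HS q) Htau Hm) as [[_ H2] H3].
    destruct (dec q) as [Hd|Hd]; [lra|].
    apply Rnot_lt_le in Hd. specialize (H3 Hd). lra.
  - rewrite rsum_plus, rsum_const, rsum_scal. apply Rplus_le_compat_l, Rmult_le_compat_l; [lra|].
    apply clustered_count; [apply Rmult_le_pos; [lra|left; apply Rinv_0_lt_compat; lra]|].
    intros q q' _ _ Hq Hq'.
    destruct (rank_one_resolvent a (bump b m (h * INR q)) l n (E q) (E q') (phi q) (phi q')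
      lam (tau ^ 2) (h * (INR q' - INR q)) m (HS q)) as [H1 H2]; auto; try nra.
    { replace (bump (bump b m (h * INR q)) m (h * (INR q' - INR q)))
        with (bump b m (h * INR q')); [apply HS|].
      apply functional_extensionality; intros x. unfold bump. destruct (Z.eq_dec x m); ring. }
    fold (g1 q) (g2 q) (g1 q') (g2 q') in H1, H2.
    pose proof (large_resolvents_close _ _ _ _ _ tau Htau H1 H2 Hq Hq') as Hc.
    rewrite Rabs_mult, (Rabs_pos_eq h) in Hc by lra.
    apply Rmult_le_reg_l with h; [exact Hh|]. rewrite (Rabs_minus_sym (INR q)).
    replace (h * (2 * tau / h)) with (2 * tau) by (field; lra). exact Hc.
Qed.

(** * Product averages over grids of potentials *)

Definition upd (w : Z -> nat) (m : Z) (q : nat) (x : Z) : nat := if Z.eq_dec x m then q else w x.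

(** Expectation of [F] for independent uniform digits below [Q] at the [n] sites from [l] on, with
    digit 0 elsewhere. It replaces integration over a product measure. *)
Fixpoint grid_mean (Q : nat) (l : Z) (n : nat) (F : (Z -> nat) -> R) : R :=
  match n with
  | O => F (fun _ => O)
  | S k => grid_mean Q l k (fun w => / INR Q * rsum Q (fun q => F (upd w (l + Z.of_nat k) q)))
  end.

Lemma grid_mean_le (Q : nat) (l : Z) (n : nat) : forall F G,
  (0 < Q)%nat -> (forall w, F w <= G w) -> grid_mean Q l n F <= grid_mean Q l n G.
Proof.
  induction n as [|n IH]; intros F G HQ H; simpl; [apply H|].
  apply IH; auto. intros w. apply Rmult_le_compat_l.
  - left; apply Rinv_0_lt_compat, lt_0_INR; exact HQ.
  - apply rsum_le; auto.
Qed.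

Lemma grid_mean_const (Q : nat) (l : Z) (n : nat) (c : R) :
  (0 < Q)%nat -> grid_mean Q l n (fun _ => c) = c.
Proof.
  intros HQ; induction n as [|n IH]; simpl; [reflexivity|].
  transitivity (grid_mean Q l n (fun _ => c)); [f_equal|exact IH].
  apply functional_extensionality; intros w. rewrite rsum_const.
  assert (0 < INR Q) by (apply lt_0_INR; exact HQ). field; lra.
Qed.

Lemma grid_mean_rsum (Q : nat) (l : Z) (n k : nat) : forall (c : nat -> R) (F : nat -> (Z -> nat) -> R),
  grid_mean Q l n (fun w => rsum k (fun i => c i * F i w)) = rsum k (fun i => c i * grid_mean Q l n (F i)).
Proof.
  induction n as [|n IH]; intros c F; simpl; [reflexivity|]. rewrite <- IH. f_equal.
  apply functional_extensionality; intros w.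
  rewrite rsum_exchange, <- rsum_scal. apply rsum_ext; intros i _. rewrite rsum_scal. ring.
Qed.

Lemma grid_mean_attained (Q : nat) (l : Z) (n : nat) : forall F,
  (0 < Q)%nat -> exists w, (forall x, (w x < Q)%nat) /\ F w <= grid_mean Q l n F.
Proof.
  induction n as [|n IH]; intros F HQ; simpl.
  - exists (fun _ => O); split; [auto|lra].
  - destruct (IH (fun w => / INR Q * rsum Q (fun q => F (upd w (l + Z.of_nat n) q))) HQ) as (w & Hw & Hle).
    assert (HQ' : 0 < INR Q) by (apply lt_0_INR; exact HQ).
    assert (Hex : exists q, (q < Q)%nat /\ F (upd w (l + Z.of_nat n) q)
      <= / INR Q * rsum Q (fun q => F (upd w (l + Z.of_nat n) q))).
    { apply NNPP; intros Hn. set (M := / INR Q * _) in Hn.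
      assert (Hlt : forall k, (0 < k <= Q)%nat ->
        INR k * M < rsum k (fun q => F (upd w (l + Z.of_nat n) q))).
      { induction k as [|k IHk]; intros Hk; [lia|]. rewrite S_INR; simpl rsum.
        assert (Hq : M < F (upd w (l + Z.of_nat n) k)).
        { apply Rnot_le_lt; intros Hle'. apply Hn; exists k; split; [lia|exact Hle']. }
        destruct k as [|k]; [simpl in *; lra|]. specialize (IHk ltac:(lia)). lra. }
      specialize (Hlt Q ltac:(lia)). unfold M in Hlt.
      rewrite <- Rmult_assoc, Rinv_r, Rmult_1_l in Hlt; lra. }
    destruct Hex as (q & Hq & Hqle).
    exists (upd w (l + Z.of_nat n) q); split; [|lra].
    intros x; unfold upd; destruct (Z.eq_dec x (l + Z.of_nat n)); auto.
Qed.

Lemma upd_comm (w : Z -> nat) (m m' : Z) (q q' : nat) : m <> m' ->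
  upd (upd w m q) m' q' = upd (upd w m' q') m q.
Proof.
  intros H; apply functional_extensionality; intros x; unfold upd.
  destruct (Z.eq_dec x m), (Z.eq_dec x m'); congruence.
Qed.

(** Finite Fubini: the digit at [m] may be averaged first, all others being frozen. *)
Lemma grid_mean_coordinate (Q : nat) (l : Z) (n : nat) (m : Z) (B : R) : forall F,
  (0 < Q)%nat -> (l <= m < l + Z.of_nat n)%Z ->
  (forall w, / INR Q * rsum Q (fun q => F (upd w m q)) <= B) -> grid_mean Q l n F <= B.
Proof.
  induction n as [|n IH]; intros F HQ Hm H; [lia|]; simpl.
  assert (HQ' : 0 < / INR Q) by (apply Rinv_0_lt_compat, lt_0_INR; exact HQ).
  destruct (Z.eq_dec m (l + Z.of_nat n)) as [->|Hne].
  - rewrite <- (grid_mean_const Q l n B HQ). apply grid_mean_le; auto.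
  - apply IH; auto; [lia|]. intros w.
    rewrite rsum_scal, rsum_exchange, <- rsum_scal.
    apply Rle_trans with (/ INR Q * (INR Q * B)).
    + apply Rmult_le_compat_l; [lra|]. apply rsum_le_const. intros q _.
      rewrite (rsum_ext _ _ (fun q' => F (upd (upd w (l + Z.of_nat n) q) m q'))); [apply H|].
      intros q' _. rewrite upd_comm by auto. reflexivity.
    + right. assert (0 < INR Q) by (apply lt_0_INR; exact HQ). field; lra.
Qed.

(** * Avoiding resonances *)

(** Erasing the potential outside a region makes the data that [solver] selects for the region
    literally independent of [om] elsewhere. *)
Definition restrict (b : Z -> R) (l : Z) (n : nat) (x : Z) : R :=
  if Z_le_dec l x then if Z_lt_dec x (l + Z.of_nat n) then b x else 0 else 0.

Lemma spectral_data_restrict (a b : Z -> R) (l : Z) (n : nat) (E : nat -> R) (phi : nat -> Z -> R) :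
  spectral_data a (restrict b l n) l n E phi -> spectral_data a b l n E phi.
Proof.
  intros (H1 & H2 & H3 & H4); repeat split; auto. intros j x Hj Hx.
  rewrite <- (H2 j x Hj Hx). unfold jacobi, restrict.
  destruct (Z_le_dec l x), (Z_lt_dec x (l + Z.of_nat n)); auto; lia.
Qed.

(** A fixed choice of spectral data as a function of the potential, so that averages of spectral
    quantities over potentials make sense. *)
Definition solver (a : Z -> R) (sol : (Z -> R) -> Z -> nat -> (nat -> R) * (nat -> Z -> R)) : Prop :=
  forall b l n, spectral_data a b l n (fst (sol b l n)) (snd (sol b l n)).

Lemma solver_exists (a : Z -> R) : (forall x, 0 < a x) -> exists sol, solver a sol.
Proof.
  intros Ha.
  destruct (choice (fun (p : (Z -> R) * (Z * nat)) (r : (nat -> R) * (nat -> Z -> R)) =>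
    spectral_data a (fst p) (fst (snd p)) (snd (snd p)) (fst r) (snd r))) as [sol HS].
  - intros (b & l & n). destruct (spectral_data_exists a b l n Ha) as (E & phi & H).
    exists (E, phi); exact H.
  - exists (fun b l n => sol (b, (l, n))). intros b l n. apply (HS (b, (l, n))).
Qed.

(** Mass at [m] of the box eigenfunctions resonant with the region, counted once for each region
    eigenvalue within [s]. *)
Definition region_mass (sol : (Z -> R) -> Z -> nat -> (nat -> R) * (nat -> Z -> R))
    (k : nat) (lr : Z) (nr : nat) (s : R) (m : Z) (b : Z -> R) : R :=
  let box := sol b (- Z.of_nat k)%Z (2 * k)%nat in
  rsum nr (fun j => resonant_mass (2 * k) (fst box) (snd box) m
    (fst (sol (restrict b lr nr) lr nr) j) s).

Lemma region_mass_nonneg sol k lr nr s m b : 0 <= region_mass sol k lr nr s m b.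
Proof.
  apply rsum_nonneg; intros j _. apply rsum_nonneg; intros i _.
  apply Rmult_le_pos; [apply pow2_ge_0|]. unfold ind_lt; destruct (Rlt_dec _ _); lra.
Qed.

Definition grid_pot (b : Z -> R) (h : R) (w : Z -> nat) (x : Z) : R := b x + h * INR (w x).

(** As [m] is outside the region, the region eigenvalues stay fixed while the digit at [m] varies,
    and [grid_average] applies to each of them. *)
Lemma region_average (a b : Z -> R) sol (k : nat) (lr : Z) (nr : nat) (tau kap : R) (m : Z)
  (Q : nat) (w : Z -> nat) :
  solver a sol -> 0 < tau -> 0 < kap -> (0 < Q)%nat ->
  (- Z.of_nat k <= m < Z.of_nat k)%Z -> ~ (lr <= m < lr + Z.of_nat nr)%Z ->
  / INR Q * rsum Q (fun q => region_mass sol k lr nr (tau ^ 2) m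
    (grid_pot b (kap / INR Q) (upd w m q)))
  <= INR nr * (2 * tau + 4 * tau / kap + 2 / INR Q).
Proof.
  intros HS Htau Hkap HQ Hm Hout. set (h := kap / INR Q).
  assert (HQ' : 0 < INR Q) by (apply lt_0_INR; exact HQ).
  assert (Hh : 0 < h) by (apply Rdiv_lt_0_compat; auto).
  unfold region_mass; cbv zeta. rewrite rsum_exchange, <- rsum_scal.
  apply rsum_le_const; intros j _.
  set (lam := fst (sol (restrict (grid_pot b h w) lr nr) lr nr) j).
  rewrite (rsum_ext _ _ (fun q => resonant_mass (2 * k)
    (fst (sol (grid_pot b h (upd w m q)) (- Z.of_nat k)%Z (2 * k)%nat))
    (snd (sol (grid_pot b h (upd w m q)) (- Z.of_nat k)%Z (2 * k)%nat)) m lam (tau ^ 2))).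
  - apply Rle_trans with (/ INR Q * (INR Q * (2 * tau) + 2 * (2 * tau / h + 1))).
    + apply Rmult_le_compat_l; [left; apply Rinv_0_lt_compat; exact HQ'|].
      apply (grid_average a (grid_pot b h (upd w m 0)) (- Z.of_nat k)%Z (2 * k)
        (fun q => fst (sol (grid_pot b h (upd w m q)) (- Z.of_nat k)%Z (2 * k)%nat))
        (fun q => snd (sol (grid_pot b h (upd w m q)) (- Z.of_nat k)%Z (2 * k)%nat))); auto; [|lia].
      intros q. replace (bump (grid_pot b h (upd w m 0)) m (h * INR q))
        with (grid_pot b h (upd w m q)); [apply HS|].
      apply functional_extensionality; intros x. unfold bump, grid_pot, upd.
      destruct (Z.eq_dec x m); simpl; ring.
    + right. unfold h. field; lra.
  - intros q _. unfold lam.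
    replace (restrict (grid_pot b h (upd w m q)) lr nr) with (restrict (grid_pot b h w) lr nr);
      [reflexivity|].
    apply functional_extensionality; intros x. unfold restrict, grid_pot, upd.
    destruct (Z_le_dec lr x), (Z_lt_dec x (lr + Z.of_nat nr)), (Z.eq_dec x m); auto; lia.
Qed.

(** Union bound: the masses divided by [beta p], summed over all scales and sites, have mean at most
    1. Some configuration attains at most the mean, and each nonnegative term is then at most 1. *)
Lemma exists_nonresonant (a b : Z -> R) sol (rad c T : nat -> nat) (tau beta : nat -> R) (kap : R)
  (k P0 : nat) :
  solver a sol -> 0 < kap -> (forall p, 0 < tau p) -> (forall p, 0 < beta p) ->
  (forall p, (P0 <= p < k)%nat -> (rad p <= c p)%nat /\ (rad p <= rad k)%nat) ->
  rsum k (fun p => if (P0 <=? p)%nat then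
    INR (2 * rad p) * (2 * INR (T p - c p) * (2 * tau p + 4 * tau p / kap)) / beta p else 0) <= 1 / 2 ->
  exists om : Z -> R, (forall x, 0 <= om x <= kap) /\
  forall p m, (P0 <= p < k)%nat -> (- Z.of_nat (rad p) <= m < Z.of_nat (rad p))%Z ->
    region_mass sol (rad k) (Z.of_nat (c p)) (T p - c p) (tau p ^ 2) m (fun x => b x + om x)
    + region_mass sol (rad k) (- Z.of_nat (T p)) (T p - c p) (tau p ^ 2) m (fun x => b x + om x)
    <= beta p.
Proof.
  intros HS Hkap Htau Hbeta Hgeom Hsum.
  set (cf := fun p => if (P0 <=? p)%nat then / beta p else 0).
  assert (Hcf : forall p, 0 <= cf p).
  { intros p; unfold cf; destruct (P0 <=? p)%nat; [|lra].
    left; apply Rinv_0_lt_compat, Hbeta. }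
  set (X := rsum k (fun p => cf p * (INR (2 * rad p) * (2 * INR (T p - c p))))).
  assert (HX : 0 <= X).
  { apply rsum_nonneg; intros p _. apply Rmult_le_pos; [apply Hcf|].
    apply Rmult_le_pos; [apply pos_INR|]. pose proof (pos_INR (T p - c p)); lra. }
  (* Only the granularity term [2 / INR Q] of [region_average] depends on the grid; [Q] makes its
     total contribution at most 1/2. *)
  destruct (INR_unbounded (4 * X + 1)) as [Q HQ].
  assert (HQ0 : (0 < Q)%nat) by (destruct Q; [simpl in HQ; lra|lia]).
  assert (HQ' : 0 < INR Q) by lra.
  set (h := kap / INR Q).
  set (Y := fun p m w =>
    region_mass sol (rad k) (Z.of_nat (c p)) (T p - c p) (tau p ^ 2) m (grid_pot b h w)
    + region_mass sol (rad k) (- Z.of_nat (T p)) (T p - c p) (tau p ^ 2) m (grid_pot b h w)).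
  assert (HY0 : forall p m w, 0 <= Y p m w)
    by (intros; apply Rplus_le_le_0_compat; apply region_mass_nonneg).
  set (F := fun w => rsum k (fun p => cf p * rsum (2 * rad p)
    (fun i => 1 * Y p (- Z.of_nat (rad p) + Z.of_nat i)%Z w))).
  assert (HF : grid_mean Q (- Z.of_nat (rad k)) (2 * rad k) F <= 1).
  { unfold F. rewrite grid_mean_rsum.
    apply Rle_trans with (rsum k (fun p =>
      (if (P0 <=? p)%nat then
        INR (2 * rad p) * (2 * INR (T p - c p) * (2 * tau p + 4 * tau p / kap)) / beta p else 0)
      + 2 / INR Q * (cf p * (INR (2 * rad p) * (2 * INR (T p - c p)))))).
    - apply rsum_le; intros p Hp. unfold cf at 1 2.
      destruct (P0 <=? p)%nat eqn:HP; [|lra].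
      apply Nat.leb_le in HP. destruct (Hgeom p ltac:(lia)) as (G1 & G3).
      rewrite grid_mean_rsum.
      apply Rle_trans with (/ beta p * (INR (2 * rad p) *
        (2 * INR (T p - c p) * (2 * tau p + 4 * tau p / kap + 2 / INR Q)))).
      + apply Rmult_le_compat_l; [left; apply Rinv_0_lt_compat, Hbeta|].
        apply rsum_le_const. intros i Hi. rewrite Rmult_1_l.
        apply (grid_mean_coordinate _ _ _ (- Z.of_nat (rad p) + Z.of_nat i)%Z); auto; [lia|].
        intros w. unfold Y. rewrite rsum_plus, Rmult_plus_distr_l.
        pose proof (region_average a b sol (rad k) (Z.of_nat (c p)) (T p - c p) (tau p) kap
          (- Z.of_nat (rad p) + Z.of_nat i)%Z Q w HS (Htau p) Hkap HQ0 ltac:(lia) ltac:(lia)) as A1.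
        pose proof (region_average a b sol (rad k) (- Z.of_nat (T p)) (T p - c p) (tau p) kap
          (- Z.of_nat (rad p) + Z.of_nat i)%Z Q w HS (Htau p) Hkap HQ0 ltac:(lia) ltac:(lia)) as A2.
        fold h in A1, A2. lra.
      + right. field. repeat split; try lra. specialize (Hbeta p); lra.
    - rewrite rsum_plus, rsum_scal. fold X.
      assert (2 / INR Q * X <= 1 / 2); [|lra].
      apply Rmult_le_reg_l with (INR Q); [exact HQ'|].
      replace (INR Q * (2 / INR Q * X)) with (2 * X) by (field; lra). lra. }
  destruct (grid_mean_attained Q (- Z.of_nat (rad k)) (2 * rad k) F HQ0) as (w & Hw & HwF).
  exists (fun x => h * INR (w x)). split.
  - intros x. assert (Hh : 0 < h) by (apply Rdiv_lt_0_compat; auto).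
    pose proof (pos_INR (w x)). split; [nra|].
    assert (Hlt : INR (w x) <= INR Q) by (apply le_INR; specialize (Hw x); lia).
    replace kap with (h * INR Q) by (unfold h; field; lra). apply Rmult_le_compat_l; lra.
  - intros p m Hp Hm. change (Y p m w <= beta p).
    assert (H1 : cf p * rsum (2 * rad p) (fun i => 1 * Y p (- Z.of_nat (rad p) + Z.of_nat i)%Z w) <= 1).
    { apply Rle_trans with (F w); [|lra].
      apply (rsum_term_le k (fun p => cf p * rsum (2 * rad p)
        (fun i => 1 * Y p (- Z.of_nat (rad p) + Z.of_nat i)%Z w))); [|lia].
      intros q _. apply Rmult_le_pos; [apply Hcf|]. apply rsum_nonneg; intros; rewrite Rmult_1_l; apply HY0. }
    unfold cf in H1. replace (P0 <=? p)%nat with true in H1 by (symmetry; apply Nat.leb_le; lia).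
    assert (H2 : Y p m w <= rsum (2 * rad p) (fun i => 1 * Y p (- Z.of_nat (rad p) + Z.of_nat i)%Z w)).
    { replace (Y p m w) with (1 * Y p (- Z.of_nat (rad p) + Z.of_nat (Z.to_nat (m + Z.of_nat (rad p))))%Z w).
      - apply (rsum_term_le (2 * rad p) (fun i => 1 * Y p (- Z.of_nat (rad p) + Z.of_nat i)%Z w)); [|lia].
        intros; rewrite Rmult_1_l; apply HY0.
      - rewrite Rmult_1_l; f_equal; lia. }
    apply Rmult_le_reg_l with (/ beta p); [apply Rinv_0_lt_compat, Hbeta|].
    rewrite Rinv_l by (specialize (Hbeta p); lra).
    eapply Rle_trans; [|exact H1]. apply Rmult_le_compat_l; [|exact H2].
    left; apply Rinv_0_lt_compat, Hbeta.
Qed.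

(** * Dyadic buffers *)

(** The comparison passes through [2 ^ (p * p)]. The [16 ^ p] stands for four factors [2 ^ p]:
    sites, lengths of regions, the allowed mass [2 ^ -p], and summability over the scales. *)
Lemma double_exp_dominates (D : R) : exists P0 : nat, forall p, (P0 <= p)%nat -> D * 16 ^ p <= 2 ^ (2 ^ p).
Proof.
  destruct (INR_unbounded (16 * (Rabs D + 1))) as [n Hn].
  exists (4 + n)%nat. intros p Hp.
  assert (Hsq : forall q, (4 <= q)%nat -> (q * q <= 2 ^ q)%nat).
  { intros q Hq; induction q as [|q IH]; [lia|].
    destruct (Nat.eq_dec q 3) as [->|Hq3]; [simpl; lia|].
    specialize (IH ltac:(lia)). simpl Nat.pow. nia. }
  assert (Hlin : forall q, INR q <= 2 ^ q).
  { induction q as [|q IH]; [simpl; lra|]. rewrite S_INR; simpl pow.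
    assert (1 <= 2 ^ q) by (apply pow_R1_Rle; lra). lra. }
  apply Rle_trans with (2 ^ (p * p)); [|apply Rle_pow; [lra|apply Hsq; lia]].
  rewrite pow_mult.
  assert (H1 : 16 * (Rabs D + 1) <= 2 ^ p).
  { eapply Rle_trans; [left; exact Hn|]. eapply Rle_trans; [|apply Hlin]. apply le_INR; lia. }
  apply Rle_trans with ((16 * (Rabs D + 1)) ^ p).
  - rewrite Rpow_mult_distr, Rmult_comm. apply Rmult_le_compat_l; [apply pow_le; lra|].
    destruct p as [|p]; [lia|]. pose proof (Rabs_pos D). simpl.
    assert (1 <= (Rabs D + 1) ^ p) by (apply pow_R1_Rle; lra).
    pose proof (Rle_abs D). nra.
  - apply pow_incr. pose proof (Rabs_pos D). lra.
Qed.

Lemma rsum_half_pow (k : nat) : rsum k (fun p => (1 / 2) ^ (p + 2)) <= 1 / 2.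
Proof.
  enough (H : rsum k (fun p => (1 / 2) ^ (p + 2)) = 1 / 2 - (1 / 2) ^ (k + 1)).
  { rewrite H. assert (0 < (1 / 2) ^ (k + 1)) by (apply pow_lt; lra). lra. }
  induction k as [|k IH]; simpl rsum; [simpl; lra|]. rewrite IH.
  replace (S k + 1)%nat with (k + 2)%nat by lia. rewrite !pow_add. simpl. lra.
Qed.

Lemma rsum_half_pow_from (P k : nat) :
  rsum k (fun p => if (P <=? p)%nat then (1 / 2) ^ p else 0) <= 2 * (1 / 2) ^ P.
Proof.
  enough (H : rsum k (fun p => if (P <=? p)%nat then (1 / 2) ^ p else 0)
    <= 2 * (1 / 2) ^ P - 2 * (1 / 2) ^ (Nat.max P k)).
  { assert (0 < (1 / 2) ^ (Nat.max P k)) by (apply pow_lt; lra). lra. }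
  induction k as [|k IH]; simpl rsum; [rewrite Nat.max_0_r; lra|].
  destruct (P <=? k)%nat eqn:HP.
  - apply Nat.leb_le in HP. rewrite Nat.max_r in IH by lia. rewrite Nat.max_r by lia. simpl; lra.
  - apply Nat.leb_gt in HP. rewrite Nat.max_l in IH by lia. rewrite Nat.max_l by lia. lra.
Qed.

Lemma quarter_pow_le_exp (n : nat) : (1 / 4) ^ n <= exp (- INR n).
Proof.
  induction n as [|n IH]; [simpl; rewrite Ropp_0, exp_0; lra|].
  rewrite S_INR, Ropp_plus_distr, exp_plus; simpl.
  assert (H : 1 / 4 <= exp (Ropp 1)).
  { rewrite exp_Ropp. pose proof exp_le_3. pose proof (exp_pos 1).
    unfold Rdiv; rewrite Rmult_1_l. apply Rinv_le_contravar; lra. }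
  assert (0 <= (1 / 4) ^ n) by (apply pow_le; lra).
  rewrite Rmult_comm. apply Rmult_le_compat; lra.
Qed.

Lemma windows_cover (K kappa : R) : 0 < kappa -> exists M : nat, (0 < M)%nat /\
  forall e, Rabs e <= K -> exists i, (i < M)%nat /\ Rabs (e - Rmin (- K + kappa * INR i) K) <= kappa.
Proof.
  intros Hk. destruct (INR_unbounded (2 * K / kappa)) as [n Hn].
  exists (S n). split; [lia|]. intros e He.
  assert (He' : - K <= e <= K) 
    by (pose proof (Rle_abs e); pose proof (Rle_abs (- e)); rewrite Rabs_Ropp in *; lra).
  assert (H : forall m, e < - K + kappa * INR m -> exists i, (i < m)%nat /\
    - K + kappa * INR i <= e < - K + kappa * INR (S i)).
  { induction m as [|m IH]; intros Hm; [simpl in Hm; lra|].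
    destruct (Rlt_dec e (- K + kappa * INR m)) as [Hlt|Hge].
    - destruct (IH Hlt) as (i & Hi & Hi'). exists i; split; [lia|exact Hi'].
    - exists m; split; [lia|lra]. }
  destruct (H (S n)) as (i & Hi & Hi').
  - rewrite S_INR. assert (2 * K < kappa * INR n); [|lra].
    apply Rmult_lt_compat_l with (r := kappa) in Hn; [|exact Hk].
    replace (kappa * (2 * K / kappa)) with (2 * K) in Hn by (field; lra). exact Hn.
  - exists i; split; [exact Hi|]. rewrite S_INR in Hi'.
    rewrite Rmin_left by lra. rewrite Rabs_pos_eq; lra.
Qed.

Lemma interpolate (f : nat -> Z) (x : Z) (n : nat) : (f 0%nat <= x)%Z -> (x < f n)%Z ->
  exists t, (f t <= x < f (S t))%Z.
Proof.
  intros H0; induction n as [|n IH]; intros Hn; [lia|].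
  destruct (Z_lt_dec x (f n)); [auto|]. exists n; lia.
Qed.

Lemma exists_max_index (n : nat) (f : nat -> R) : (0 < n)%nat ->
  exists i, (i < n)%nat /\ forall j, (j < n)%nat -> f j <= f i.
Proof.
  induction n as [|n IH]; intros Hn; [lia|].
  destruct (Nat.eq_dec n 0) as [->|Hn0].
  - exists 0%nat; split; [lia|]. intros j Hj; replace j with 0%nat by lia; lra.
  - destruct IH as (i & Hi & Hmax); [lia|].
    destruct (Rle_dec (f n) (f i)) as [Hle|Hgt].
    + exists i; split; [lia|]. intros j Hj.
      destruct (Nat.eq_dec j n) as [->|]; [exact Hle|apply Hmax; lia].
    + exists n; split; [lia|]. intros j Hj.
      destruct (Nat.eq_dec j n) as [->|]; [lra|]. specialize (Hmax j ltac:(lia)). lra.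
Qed.

(** Read the eigenvalue equation at a site where [|phi j|] is maximal. *)
Lemma eigenvalue_bound (a b : Z -> R) (l : Z) (n : nat) (E : nat -> R) (phi : nat -> Z -> R)
  (alpha beta : R) (j : nat) :
  spectral_data a b l n E phi -> (forall x, 0 < a x <= alpha) -> (forall x, Rabs (b x) <= beta) ->
  (j < n)%nat -> Rabs (E j) <= 2 * alpha + beta.
Proof.
  intros (Hout & Heig & Hnorm & _) Ha Hb Hj.
  destruct (exists_max_index n (fun i => Rabs (phi j (l + Z.of_nat i)%Z)) ltac:(lia)) as (i & Hi & Hmax).
  set (x := (l + Z.of_nat i)%Z) in *. set (m := Rabs (phi j x)) in *.
  assert (Hall : forall y, Rabs (phi j y) <= m).
  { intros y. destruct (classic (l <= y < l + Z.of_nat n)%Z) as [Hy|Hy].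
    - specialize (Hmax (Z.to_nat (y - l)) ltac:(lia)). cbv beta in Hmax.
      replace (l + Z.of_nat (Z.to_nat (y - l)))%Z with y in Hmax by lia. exact Hmax.
    - rewrite Hout by exact Hy. rewrite Rabs_R0. apply Rabs_pos. }
  assert (Hm : 0 < m).
  { destruct (Rle_lt_or_eq_dec 0 m (Rabs_pos _)) as [H|H]; [exact H|].
    specialize (Hnorm j Hj). unfold zint in Hnorm.
    rewrite (rsum_ext _ _ (fun _ => 0)), rsum_const in Hnorm; [lra|].
    intros q _. specialize (Hall (l + Z.of_nat q)%Z).
    assert (phi j (l + Z.of_nat q)%Z = 0); [|cbv beta; rewrite H0; ring].
    apply NNPP; intros Hne; apply Rabs_pos_lt in Hne. lra. }
  specialize (Heig j x Hj ltac:(lia)). unfold jacobi in Heig.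
  apply Rmult_le_reg_r with m; [exact Hm|].
  unfold m at 1. rewrite <- Rabs_mult, <- Heig.
  eapply Rle_trans; [apply Rabs_triang|]. rewrite Rabs_mult. fold m.
  assert (H3 : forall y c, Rabs c <= m -> Rabs (a y * c) <= alpha * m).
  { intros y c Hc. rewrite Rabs_mult. specialize (Ha y). rewrite (Rabs_pos_eq (a y)) by lra.
    apply Rmult_le_compat; try lra. apply Rabs_pos. }
  pose proof (Rabs_triang (a x * phi j (x + 1)%Z) (a (x - 1)%Z * phi j (x - 1)%Z)).
  pose proof (H3 x _ (Hall (x + 1)%Z)). pose proof (H3 (x - 1)%Z _ (Hall (x - 1)%Z)).
  specialize (Hb x). assert (Rabs (b x) * m <= beta * m) by (apply Rmult_le_compat_r; lra). lra.
Qed.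

Lemma spectral_abs_le_1 (a b : Z -> R) (l : Z) (n : nat) (E : nat -> R) (phi : nat -> Z -> R)
  (j : nat) (x : Z) : spectral_data a b l n E phi -> (j < n)%nat -> Rabs (phi j x) <= 1.
Proof.
  intros (Hout & _ & Hnorm & _) Hj.
  destruct (classic (l <= x < l + Z.of_nat n)%Z) as [Hx|Hx].
  - specialize (Hnorm j Hj).
    pose proof (zint_term_le l n (fun x => phi j x ^ 2) x ltac:(intros; apply pow2_ge_0) Hx) as H.
    cbv beta in H. rewrite Hnorm, <- (pow2_abs (phi j x)) in H.
    pose proof (Rabs_pos (phi j x)). nra.
  - rewrite Hout by exact Hx. rewrite Rabs_R0; lra.
Qed.

(** The annulus from [radius p] to [radius (p + 1)] has [8 * 2 ^ p] blocks of [N] sites on each side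
    of the origin. Its midpoint [center p] has [g = 4 * 2 ^ p] blocks on either side, so [buffer]
    yields the factor [tau p ^ 4] there. *)
Definition radius (N p : nat) : nat := (8 * N * 2 ^ p)%nat.
Definition center (N p : nat) : nat := (12 * N * 2 ^ p)%nat.
(* Outer end of the region between the buffers of scales [p] and [p + M] inside the box of scale [k]. *)
Definition outer (N M k p : nat) : nat := if (p + M <? k)%nat then center N (p + M) else radius N k.
Definition tau (p : nat) : R := (1 / 2) ^ (2 ^ p).

Lemma pow2_add (p q : nat) : (2 ^ (p + q) = 2 ^ p * 2 ^ q)%nat.
Proof. apply Nat.pow_add_r. Qed.

Lemma pow2_pos (p : nat) : (0 < 2 ^ p)%nat.
Proof. induction p; simpl; lia. Qed.

Lemma pow2_mono (p q : nat) : (p <= q)%nat -> (2 ^ p <= 2 ^ q)%nat.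
Proof. intros; apply Nat.pow_le_mono_r; lia. Qed.

Lemma radius_S (N p : nat) : radius N (S p) = (2 * radius N p)%nat.
Proof. unfold radius; rewrite Nat.pow_succ_r'; ring. Qed.

Lemma tau_pos (p : nat) : 0 < tau p.
Proof. apply pow_lt; lra. Qed.

Lemma half_pow_le (m n : nat) : (m <= n)%nat -> (1 / 2) ^ n <= (1 / 2) ^ m.
Proof.
  intros H; induction H as [|n H IH]; [lra|]. simpl.
  assert (0 <= (1 / 2) ^ n) by (apply pow_le; lra). lra.
Qed.

Lemma tau_le (p q : nat) : (p <= q)%nat -> tau q <= tau p.
Proof. intros H; apply half_pow_le, pow2_mono, H. Qed.

Lemma tau_pow4 (C : R) (p : nat) : C / 2 ^ (4 * 2 ^ p) = C * tau p ^ 4.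
Proof.
  unfold tau. rewrite <- pow_mult, (Nat.mul_comm (2 ^ p)). unfold Rdiv.
  rewrite Rmult_1_l, pow_inv. reflexivity.
Qed.

(* Every annulus [R_p <= |x| < R_{p+1}] is a buffer for the energy window [p mod M]. *)
Lemma buffered_potential (delta alpha beta eps K : R) : 0 < delta -> 0 < eps ->
  exists (N M : nat) (kappa C : R) (win : nat -> R),
    (0 < N)%nat /\ (0 < M)%nat /\ 0 < kappa /\ 0 < C /\
    (forall e, Rabs e <= K -> exists i, (i < M)%nat /\ Rabs (e - win i) <= kappa) /\
  forall a b : Z -> R, (forall x, delta <= a x <= alpha) -> (forall x, Rabs (b x) <= beta) ->
  exists v : Z -> R, (forall x, Rabs (v x) <= eps) /\
  forall (om u : Z -> R) (E : R) (p : nat),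
    Rabs (E - win (p mod M)) <= kappa -> (forall x, Rabs (om x) <= kappa) ->
    (forall x, Rabs (u x) <= 1) ->
    (forall x, (- Z.of_nat (radius N (S p)) <= x < Z.of_nat (radius N (S p)))%Z ->
       jacobi a (fun y => b y + v y + om y) u x = E * u x) ->
    Rabs (u (Z.of_nat (center N p))) <= C * tau p ^ 4 /\
    Rabs (u (Z.of_nat (center N p) - 1)%Z) <= C * tau p ^ 4 /\
    Rabs (u (- Z.of_nat (center N p))%Z) <= C * tau p ^ 4 /\
    Rabs (u (- Z.of_nat (center N p) - 1)%Z) <= C * tau p ^ 4.
Proof.
  intros Hd Heps.
  destruct (buffer delta alpha (Rabs K + beta) eps Hd Heps) as (N & kappa & C & HN & Hkap & HC & Hbuf).
  destruct (windows_cover K kappa Hkap) as (M & HM & Hcov).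
  (* Clipping to [[-|K|, |K|]] bounds [win i - b x] for every index and either sign of [K], as
     [buffer] requires. *)
  set (win := fun i : nat => Rmax (- Rabs K) (Rmin (- K + kappa * INR i) K)).
  exists N, M, kappa, C, win. repeat split; auto.
  { intros e He. destruct (Hcov e He) as (i & Hi & Hei). exists i; split; [exact Hi|].
    unfold win. rewrite Rmax_right; [exact Hei|].
    pose proof (Rabs_pos e). rewrite (Rabs_pos_eq K) by lra.
    apply Rmin_glb; [|lra]. pose proof (pos_INR i). nra. }
  intros a b Ha Hb.
  assert (Hwin : forall i x, Rabs (win i - b x) <= Rabs K + beta).
  { intros i x. unfold Rminus. eapply Rle_trans; [apply Rabs_triang|]. rewrite Rabs_Ropp.
    apply Rplus_le_compat; [|apply Hb]. apply Rabs_le. unfold win. split; [apply Rmax_l|].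
    apply Rmax_lub; [pose proof (Rabs_pos K); lra|].
    eapply Rle_trans; [apply Rmin_r|apply Rle_abs]. }
  destruct (choice (fun (q : nat * Z) v => (forall x, Rabs (v x) <= eps) /\
    forall (om u : Z -> R) (E : R) (g : nat),
    Rabs (E - win (fst q)) <= kappa -> (forall x, Rabs (om x) <= kappa) ->
    (forall x, Rabs (u x) <= 1) ->
    (forall x, (snd q <= x < snd q + Z.of_nat (2 * g * N))%Z ->
       jacobi a (fun y => b y + v y + om y) u x = E * u x) ->
    Rabs (u (snd q + Z.of_nat (g * N))%Z) <= C / 2 ^ g /\
    Rabs (u (snd q + Z.of_nat (g * N) - 1)%Z) <= C / 2 ^ g)) as [V HV].
  { intros [i x0]. apply (Hbuf a b (win i) Ha (Hwin i) x0). }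
  (* The scale of the annulus that contains [x]. A site [x] of the left half line belongs to the
     scale of [- x - 1], since the intervals are half-open. *)
  set (lev := fun x => Z.to_nat (Z.log2 (x / Z.of_nat (8 * N)))).
  assert (Hlev : forall x p, (Z.of_nat (radius N p) <= x < Z.of_nat (radius N (S p)))%Z -> lev x = p).
  { intros x p Hx. unfold lev. rewrite (Z.log2_unique _ (Z.of_nat p)); [lia|lia|].
    rewrite <- Nat2Z.inj_succ. change 2%Z with (Z.of_nat 2). rewrite <- !Nat2Z.inj_pow.
    unfold radius in Hx. rewrite !Nat2Z.inj_mul in Hx. rewrite Nat2Z.inj_mul.
    split; [apply Z.div_le_lower_bound|apply Z.div_lt_upper_bound]; lia. }
  set (v := fun x => if Z_le_dec (Z.of_nat (radius N 0)) x
    then V ((lev x mod M)%nat, Z.of_nat (radius N (lev x))) x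
    else if Z_lt_dec x (- Z.of_nat (radius N 0))
    then V ((lev (- x - 1)%Z mod M)%nat, (- Z.of_nat (radius N (S (lev (- x - 1)%Z))))%Z) x
    else 0).
  assert (Hrad : forall p, (radius N 0 <= radius N p)%nat)
    by (intros p; unfold radius; pose proof (pow2_pos p); simpl; nia).
  exists v. split.
  { intros x. unfold v. destruct (Z_le_dec _ _); [apply HV|].
    destruct (Z_lt_dec _ _); [apply HV|]. rewrite Rabs_R0; lra. }
  intros om u E p HE Hom Hu Hsol.
  assert (Hg1 : Z.of_nat (4 * 2 ^ p * N) = (Z.of_nat (center N p) - Z.of_nat (radius N p))%Z)
    by (unfold center, radius; lia).
  assert (Hg2 : Z.of_nat (2 * (4 * 2 ^ p) * N) = Z.of_nat (radius N p)) by (unfold radius; lia).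
  assert (HRS := radius_S N p).
  assert (Hc32 : (2 * center N p = 3 * radius N p)%nat) by (unfold center, radius; lia).
  rewrite <- tau_pow4.
  destruct (proj2 (HV ((p mod M)%nat, Z.of_nat (radius N p))) om u E (4 * 2 ^ p)%nat HE Hom Hu)
    as [A1 A2].
  { simpl snd. rewrite Hg2. intros x Hx. rewrite <- (Hsol x) by lia.
    unfold jacobi, v. destruct (Z_le_dec _ _) as [_|n]; [|specialize (Hrad p); lia].
    rewrite (Hlev x p) by lia. ring. }
  destruct (proj2 (HV ((p mod M)%nat, (- Z.of_nat (radius N (S p)))%Z)) om u E (4 * 2 ^ p)%nat HE Hom Hu)
    as [A3 A4].
  { simpl snd. rewrite Hg2. intros x Hx. rewrite <- (Hsol x) by lia.
    unfold jacobi, v. destruct (Z_le_dec _ _) as [n|_]; [specialize (Hrad p); lia|].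
    destruct (Z_lt_dec _ _) as [_|n]; [|specialize (Hrad p); lia].
    rewrite (Hlev (- x - 1)%Z p) by lia. ring. }
  simpl snd in *. rewrite Hg1 in *.
  replace (Z.of_nat (radius N p) + (Z.of_nat (center N p) - Z.of_nat (radius N p)))%Z
    with (Z.of_nat (center N p)) in * by lia.
  replace (- Z.of_nat (radius N (S p)) + (Z.of_nat (center N p) - Z.of_nat (radius N p)))%Z
    with (- Z.of_nat (center N p))%Z in * by lia.
  auto.
Qed.

(** * Localization in finite volume *)

Lemma center_outer (N M k p : nat) : (p < k)%nat ->
  (center N p <= outer N M k p)%nat /\ (outer N M k p <= center N (p + M))%nat /\
  (outer N M k p <= radius N k)%nat.
Proof.
  intros Hp.
  assert (H1 : (center N p <= center N (p + M))%nat).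
  { unfold center. apply Nat.mul_le_mono_l, pow2_mono; lia. }
  assert (H2 : (center N p <= radius N k)%nat).
  { unfold center, radius. replace k with (1 + (p + (k - S p)))%nat by lia.
    rewrite !pow2_add. pose proof (pow2_pos (k - S p)). simpl (2 ^ 1)%nat. nia. }
  unfold outer. destruct (p + M <? k)%nat eqn:HM.
  - apply Nat.ltb_lt in HM. repeat split; auto.
    unfold center, radius. replace k with (1 + (p + M + (k - S (p + M))))%nat by lia.
    rewrite (pow2_add 1), (pow2_add (p + M)). pose proof (pow2_pos (k - S (p + M))).
    simpl (2 ^ 1)%nat. nia.
  - apply Nat.ltb_ge in HM. repeat split; auto.
    unfold center, radius. pose proof (pow2_mono k (p + M) HM). nia.
Qed.

Lemma ind_lt_nonneg (x y : R) : 0 <= ind_lt x y.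
Proof. unfold ind_lt; destruct (Rlt_dec x y); lra. Qed.

Lemma rsum_ind_lt_small (n : nat) (f : nat -> R) (s : R) :
  rsum n (fun i => ind_lt (f i) s) < 1 -> forall i, (i < n)%nat -> s <= f i.
Proof.
  intros H i Hi. apply Rnot_lt_le; intros Hlt.
  pose proof (rsum_term_le n (fun i => ind_lt (f i) s) i
    ltac:(intros; apply ind_lt_nonneg) Hi) as Ht.
  cbv beta in Ht. unfold ind_lt at 1 in Ht. destruct (Rlt_dec (f i) s); lra.
Qed.

(** A count, so that a value below 1 means no resonance at all. Every scale from [P] on is counted,
    whichever window contains [e], so the weight does not depend on the window. *)
Definition resonances (sol : (Z -> R) -> Z -> nat -> (nat -> R) * (nat -> Z -> R))
    (N M k P : nat) (b : Z -> R) (e : R) : R :=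
  rsum k (fun p => if (P <=? p)%nat then
    let len := (outer N M k p - center N p)%nat in
    let side := fun l => rsum len (fun j =>
      ind_lt (Rabs (e - fst (sol (restrict b l len) l len) j)) (tau p ^ 2)) in
    side (Z.of_nat (center N p)) + side (- Z.of_nat (outer N M k p))%Z else 0).

Lemma resonances_nonneg sol N M k P b e : 0 <= resonances sol N M k P b e.
Proof.
  apply rsum_nonneg; intros p _. destruct (P <=? p)%nat; [|lra].
  apply Rplus_le_le_0_compat; apply rsum_nonneg; intros; apply ind_lt_nonneg.
Qed.

(** Exchanging sums turns the weighted mass at [m] into the region masses that [exists_nonresonant]
    controls. *)
Lemma sum_resonances sol (N M k P : nat) (b : Z -> R) (m : Z) :
  let box := sol b (- Z.of_nat (radius N k))%Z (2 * radius N k)%nat in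
  rsum (2 * radius N k) (fun j => snd box j m ^ 2 * resonances sol N M k P b (fst box j))
  = rsum k (fun p => if (P <=? p)%nat then
      region_mass sol (radius N k) (Z.of_nat (center N p)) (outer N M k p - center N p) (tau p ^ 2) m b
      + region_mass sol (radius N k) (- Z.of_nat (outer N M k p)) (outer N M k p - center N p) (tau p ^ 2) m b
      else 0).
Proof.
  cbv zeta. unfold resonances.
  rewrite (rsum_ext (2 * radius N k) _ (fun j => rsum k (fun p =>
    snd (sol b (- Z.of_nat (radius N k))%Z (2 * radius N k)%nat) j m ^ 2 *
    (if (P <=? p)%nat then
    let len := (outer N M k p - center N p)%nat in
    let side := fun l => rsum len (fun i =>
      ind_lt (Rabs (fst (sol b (- Z.of_nat (radius N k))%Z (2 * radius N k)%nat) j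
        - fst (sol (restrict b l len) l len) i)) (tau p ^ 2)) in
    side (Z.of_nat (center N p)) + side (- Z.of_nat (outer N M k p))%Z else 0))))
    by (intros; symmetry; apply rsum_scal).
  rewrite rsum_exchange. apply rsum_ext; intros p _.
  destruct (P <=? p)%nat; cbv zeta.
  - rewrite (rsum_ext _ _ (fun j => _ + _)) by (intros; apply Rmult_plus_distr_l).
    rewrite rsum_plus. unfold region_mass; cbv zeta.
    f_equal; unfold resonant_mass; rewrite rsum_exchange; apply rsum_ext; intros; symmetry; apply rsum_scal.
  - rewrite (rsum_ext _ _ (fun _ => 0)) by (intros; ring). rewrite rsum_const; ring.
Qed.

Lemma tau_sqr (p : nat) : tau p ^ 2 = (1 / 4) ^ (2 ^ p).
Proof.
  unfold tau. rewrite <- pow_mult, Nat.mul_comm, pow_mult. f_equal. field.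
Qed.

Lemma center_lower (N p : nat) : (0 < N)%nat -> (p < center N p)%nat.
Proof.
  intros HN. assert (H : (p < 2 ^ p)%nat) by (apply Nat.pow_gt_lin_r; lia).
  unfold center. nia.
Qed.

(* A resonance-free eigenfunction is small outside: in its energy window, it is tiny at the
   centres of the buffers, and it cannot live on the regions between consecutive centres. *)
Lemma resonance_free_decay (a b : Z -> R) sol (N M k P i : nat) (E : nat -> R) (phi : nat -> Z -> R)
  (alpha C : R) (j : nat) :
  solver a sol -> (forall x, 0 < a x <= alpha) -> 0 < C -> (0 < N)%nat -> (i < M)%nat ->
  spectral_data a b (- Z.of_nat (radius N k)) (2 * radius N k) E phi ->
  (j < 2 * radius N k)%nat ->
  (forall p, (p < k)%nat -> (p mod M = i)%nat ->
    Rabs (phi j (Z.of_nat (center N p))) <= C * tau p ^ 4 /\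
    Rabs (phi j (Z.of_nat (center N p) - 1)%Z) <= C * tau p ^ 4 /\
    Rabs (phi j (- Z.of_nat (center N p))%Z) <= C * tau p ^ 4 /\
    Rabs (phi j (- Z.of_nat (center N p) - 1)%Z) <= C * tau p ^ 4) ->
  resonances sol N M k P b (E j) < 1 ->
  let eta := / INR (center N M) in
  forall x, Rabs (phi j x) <=
    (2 * alpha * C + exp (eta * (INR (center N (M * P + M)) + 1))) * exp (- eta * Rabs (IZR x)).
Proof.
  intros HS Ha HC HN Hi Hsp Hj Hbuf Hres eta x.
  assert (Halpha : 0 < alpha) by (specialize (Ha 0%Z); lra).
  assert (HcM : 0 < INR (center N M)).
  { apply lt_0_INR. unfold center. pose proof (pow2_pos M). nia. }
  assert (Heta : 0 < eta) by (apply Rinv_0_lt_compat; exact HcM).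
  (* Boundary values of order [tau ^ 4] divided by an energy distance [tau ^ 2] leave [tau ^ 2]. *)
  assert (Hscale : forall p, (P <= p < k)%nat -> (p mod M = i)%nat ->
    forall y, ((Z.of_nat (center N p) <= y < Z.of_nat (outer N M k p))%Z \/
               (- Z.of_nat (outer N M k p) <= y < - Z.of_nat (center N p))%Z) ->
    Rabs (phi j y) <= 2 * alpha * C * tau p ^ 2).
  { intros p Hp Hpi y Hy.
    destruct (center_outer N M k p ltac:(lia)) as (G1 & G2 & G3).
    set (len := (outer N M k p - center N p)%nat).
    assert (Hr : forall q, (q < k)%nat -> 0 <= (if (P <=? q)%nat then
      let len := (outer N M k q - center N q)%nat in
      let side := fun l => rsum len (fun i =>
        ind_lt (Rabs (E j - fst (sol (restrict b l len) l len) i)) (tau q ^ 2)) in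
      side (Z.of_nat (center N q)) + side (- Z.of_nat (outer N M k q))%Z else 0)).
    { intros q _. destruct (P <=? q)%nat; [|lra].
      apply Rplus_le_le_0_compat; apply rsum_nonneg; intros; apply ind_lt_nonneg. }
    pose proof (rsum_term_le k _ p Hr ltac:(lia)) as Ht. cbv beta in Ht.
    replace (P <=? p)%nat with true in Ht by (symmetry; apply Nat.leb_le; lia).
    cbv zeta in Ht. fold len in Ht.
    assert (Ht' := Rle_lt_trans _ _ _ Ht Hres).
    assert (Hn1 := rsum_nonneg len (fun i => ind_lt (Rabs (E j
      - fst (sol (restrict b (Z.of_nat (center N p)) len) (Z.of_nat (center N p)) len) i)) (tau p ^ 2))
      ltac:(intros; apply ind_lt_nonneg)).
    assert (Hn2 := rsum_nonneg len (fun i => ind_lt (Rabs (E j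
      - fst (sol (restrict b (- Z.of_nat (outer N M k p)) len) (- Z.of_nat (outer N M k p))%Z len) i)) (tau p ^ 2))
      ltac:(intros; apply ind_lt_nonneg)).
    assert (Htau := tau_pos p).
    assert (Hs : 0 < tau p ^ 2) by nra.
    assert (Hrho : 0 <= C * tau p ^ 4) by (apply Rmult_le_pos; [lra|apply pow_le; lra]).
    assert (Hfin : 2 * alpha * (C * tau p ^ 4) / tau p ^ 2 = 2 * alpha * C * tau p ^ 2)
      by (field; lra).
    rewrite <- Hfin.
    destruct Hsp as (Hout & Heig & _).
    assert (Hcent := Hbuf p ltac:(lia) Hpi). destruct Hcent as (B1 & B2 & B3 & B4).
    (* The outer end is the next centre of the same window, or the edge of the box, where [phi j]
       vanishes. *)
    assert (Hend : Rabs (phi j (Z.of_nat (outer N M k p))) <= C * tau p ^ 4 /\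
                   Rabs (phi j (- Z.of_nat (outer N M k p) - 1)%Z) <= C * tau p ^ 4).
    { unfold outer. destruct (p + M <? k)%nat eqn:HM.
      - apply Nat.ltb_lt in HM.
        assert (HpM : ((p + M) mod M = i)%nat).
        { rewrite <- Hpi. rewrite <- (Nat.mul_1_l M) at 1. apply Nat.Div0.mod_add. }
        destruct (Hbuf (p + M)%nat HM HpM) as (B1' & _ & _ & B4').
        assert (Hm : C * tau (p + M) ^ 4 <= C * tau p ^ 4).
        { apply Rmult_le_compat_l; [lra|]. apply pow_incr. split; [left; apply tau_pos|].
          apply tau_le; lia. }
        split; lra.
      - rewrite !Hout by lia. rewrite Rabs_R0. split; exact Hrho. }
    destruct Hend as [B5 B6].
    destruct Hy as [Hy|Hy].
    - apply (nonresonant_small a b (Z.of_nat (center N p)) len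
        (fst (sol (restrict b (Z.of_nat (center N p)) len) (Z.of_nat (center N p)) len))
        (snd (sol (restrict b (Z.of_nat (center N p)) len) (Z.of_nat (center N p)) len))
        (phi j) (E j)); auto; try (unfold len; lia).
      + apply spectral_data_restrict, HS.
      + intros z Hz. apply Heig; [exact Hj|]. unfold len in Hz; lia.
      + replace (Z.of_nat (center N p) + Z.of_nat len)%Z with (Z.of_nat (outer N M k p))
          by (unfold len; lia). exact B5.
      + apply rsum_ind_lt_small. lra.
    - apply (nonresonant_small a b (- Z.of_nat (outer N M k p)) len
        (fst (sol (restrict b (- Z.of_nat (outer N M k p)) len) (- Z.of_nat (outer N M k p))%Z len))
        (snd (sol (restrict b (- Z.of_nat (outer N M k p)) len) (- Z.of_nat (outer N M k p))%Z len))
        (phi j) (E j)); auto; try (unfold len; lia).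
      + apply spectral_data_restrict, HS.
      + intros z Hz. apply Heig; [exact Hj|]. unfold len in Hz; lia.
      + replace (- Z.of_nat (outer N M k p) + Z.of_nat len)%Z with (- Z.of_nat (center N p))%Z
          by (unfold len; lia). exact B3.
      + apply rsum_ind_lt_small. lra. }
  assert (He1 : 0 < exp (- eta * Rabs (IZR x))) by apply exp_pos.
  assert (He2 : 0 < exp (eta * (INR (center N (M * P + M)) + 1))) by apply exp_pos.
  rewrite Rmult_plus_distr_r, <- exp_plus.
  set (c0 := center N (M * P + M)) in *.
  (* Up to the first usable centre the trivial bound 1 suffices, at the price of the exponential in
     the constant. *)
  destruct (Rle_dec (Rabs (IZR x)) (INR c0 + 1)) as [Hsm|Hlg].
  - assert (H1 : 1 <= exp (eta * (INR c0 + 1) + - eta * Rabs (IZR x))).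
    { apply Rle_trans with (exp 0); [rewrite exp_0; lra|].
      destruct (Req_dec (eta * (INR c0 + 1) + - eta * Rabs (IZR x)) 0) as [->|Hne]; [lra|].
      left. apply exp_increasing. nra. }
    pose proof (spectral_abs_le_1 _ _ _ _ _ _ j x Hsp Hj).
    assert (0 <= 2 * alpha * C * exp (- eta * Rabs (IZR x))) by (apply Rmult_le_pos; nra). lra.
  - assert (Hpos : 0 <= exp (eta * (INR c0 + 1) + - eta * Rabs (IZR x))) by (left; apply exp_pos).
    enough (Hmain : Rabs (phi j x) <= 2 * alpha * C * exp (- eta * Rabs (IZR x))) by lra.
    destruct (classic (- Z.of_nat (radius N k) <= x < Z.of_nat (radius N k))%Z) as [Hin|Hnin].
    2: { destruct Hsp as (Hout & _). rewrite Hout by lia. rewrite Rabs_R0. apply Rmult_le_pos; nra. }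
    (* The reflection [x -> - x - 1] maps the half-open regions on the left onto those on the
       right. *)
    set (y := if Z_le_dec 0 x then x else (- x - 1)%Z).
    assert (Hy : (Z.of_nat c0 <= y)%Z /\ Rabs (IZR x) <= IZR y + 1 /\
      ((0 <= x)%Z /\ y = x \/ (x < 0)%Z /\ y = (- x - 1)%Z)).
    { assert (Hlg' : INR c0 + 1 < Rabs (IZR x)) by lra.
      rewrite INR_IZR_INZ, <- plus_IZR in Hlg'. unfold y.
      destruct (Z_le_dec 0 x) as [H0|H0].
      - rewrite Rabs_pos_eq in * by (apply IZR_le; lia). apply lt_IZR in Hlg'.
        split; [lia|]. split; [lra|left; lia].
      - rewrite Rabs_left in * by (apply IZR_lt; lia). rewrite <- opp_IZR in Hlg'. apply lt_IZR in Hlg'.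
        split; [lia|]. split; [|right; lia]. rewrite minus_IZR, opp_IZR. lra. }
    destruct Hy as (Hyc & Hyx & Hcase).
    assert (HMi : (M * P + i <= M * P + M)%nat) by lia.
    assert (Hcmono : forall p q, (p <= q)%nat -> (center N p <= center N q)%nat).
    { intros p q Hpq. unfold center. apply Nat.mul_le_mono_l, pow2_mono, Hpq. }
    destruct (interpolate (fun t => Z.of_nat (center N (M * (P + t) + i))) y (Z.to_nat (y + 1)))
      as [t Ht].
    { pose proof (Hcmono (M * (P + 0) + i)%nat (M * P + M)%nat ltac:(lia)). unfold c0 in Hyc. lia. }
    { pose proof (center_lower N (M * (P + Z.to_nat (y + 1)) + i) HN). nia. }
    set (p := (M * (P + t) + i)%nat) in Ht.
    replace (M * (P + S t) + i)%nat with (p + M)%nat in Ht by (unfold p; lia).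
    assert (Hpk : (p < k)%nat).
    { apply Nat.nle_gt; intros Hkp. pose proof (Hcmono k p Hkp).
      assert (radius N k <= center N k)%nat by (unfold radius, center; nia). lia. }
    assert (HPp : (P <= p)%nat) by (unfold p; nia).
    assert (Hpi : (p mod M = i)%nat).
    { unfold p. rewrite Nat.add_comm, Nat.mul_comm, Nat.Div0.mod_add. apply Nat.mod_small, Hi. }
    destruct (center_outer N M k p Hpk) as (G1 & G2 & G3).
    assert (Hyo : (y < Z.of_nat (outer N M k p))%Z).
    { unfold outer in *. destruct (p + M <? k)%nat; lia. }
    eapply Rle_trans; [apply (Hscale p ltac:(lia) Hpi x); destruct Hcase as [[? ->]|[? ->]]; lia|].
    apply Rmult_le_compat_l; [nra|].
    rewrite tau_sqr. eapply Rle_trans; [apply quarter_pow_le_exp|].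
    (* The origin of [eta]: [x] lies below the next centre, which is [2 ^ p * center N M], while
       [tau p ^ 2 = 4 ^ - (2 ^ p)] is at most [exp (- 2 ^ p)]. *)
    assert (Hle : eta * Rabs (IZR x) <= INR (2 ^ p)).
    { apply Rle_trans with (eta * INR (center N (p + M))).
      - apply Rmult_le_compat_l; [lra|]. eapply Rle_trans; [exact Hyx|].
        rewrite INR_IZR_INZ, <- plus_IZR. apply IZR_le. lia.
      - right. unfold eta. replace (center N (p + M)) with (2 ^ p * center N M)%nat
          by (unfold center; rewrite pow2_add; ring).
        rewrite mult_INR. field; lra. }
    destruct (Rle_lt_or_eq_dec _ _ Hle) as [Hlt|Heq].
    + left. apply exp_increasing. lra.
    + right. f_equal. lra.
Qed.

(** Up to a constant the summand is at most [tau p * 8 ^ p]. [P0] does not depend on [k], since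
    regions of scale [p] end at [center N (p + M)] at the latest. *)
Lemma resonant_scales_summable (N M : nat) (kap : R) : 0 < kap ->
  exists P0 : nat, forall k,
  rsum k (fun p => if (P0 <=? p)%nat then
    INR (2 * radius N p) * (2 * INR (outer N M k p - center N p) * (2 * tau p + 4 * tau p / kap))
      / (1 / 2) ^ p else 0) <= 1 / 2.
Proof.
  intros Hkap.
  set (D := INR (16 * N) * (2 * INR (12 * N * 2 ^ M)) * (2 + 4 / kap)).
  destruct (double_exp_dominates (4 * D)) as [P0 HP0].
  exists P0. intros k. eapply Rle_trans; [|apply (rsum_half_pow k)].
  apply rsum_le; intros p Hp. assert (Hhp : forall q, 0 < (1 / 2) ^ q) by (intros; apply pow_lt; lra).
  destruct (P0 <=? p)%nat eqn:HP; [|left; apply Hhp]. apply Nat.leb_le in HP.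
  specialize (HP0 p HP). destruct (center_outer N M k p Hp) as (G1 & G2 & G3).
  assert (Hlen : INR (outer N M k p - center N p) <= INR (12 * N * 2 ^ M) * 2 ^ p).
  { replace (2 ^ p) with (INR (2 ^ p)) by (rewrite pow_INR; reflexivity). rewrite <- mult_INR. apply le_INR.
    unfold center in G2. rewrite pow2_add in G2. lia. }
  assert (Hrad : INR (2 * radius N p) = INR (16 * N) * 2 ^ p).
  { replace (2 ^ p) with (INR (2 ^ p)) by (rewrite pow_INR; reflexivity). rewrite <- mult_INR. f_equal.
    unfold radius; lia. }
  assert (Htau := tau_pos p).
  assert (H4k : 0 < 4 / kap) by (apply Rdiv_lt_0_compat; lra).
  assert (H2p : 0 < 2 ^ p) by (apply pow_lt; lra).
  rewrite Hrad.
  apply Rle_trans with (D * tau p * 2 ^ p * 2 ^ p / (1 / 2) ^ p).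
  - apply Rmult_le_compat_r; [left; apply Rinv_0_lt_compat, Hhp|]. unfold D.
    replace (INR (16 * N) * (2 * INR (12 * N * 2 ^ M)) * (2 + 4 / kap) * tau p * 2 ^ p * 2 ^ p)
      with (INR (16 * N) * 2 ^ p * (2 * (INR (12 * N * 2 ^ M) * 2 ^ p) * (2 * tau p + 4 * tau p / kap)))
      by (field; lra).
    apply Rmult_le_compat_l; [apply Rmult_le_pos; [apply pos_INR|lra]|].
    apply Rmult_le_compat_r; [|lra].
    replace (2 * tau p + 4 * tau p / kap) with (tau p * (2 + 4 / kap)) by (field; lra). nra.
  - unfold tau. set (T := (2 ^ p)%nat) in *.
    replace ((1 / 2) ^ T) with (/ 2 ^ T) by (unfold Rdiv; rewrite Rmult_1_l, pow_inv; reflexivity).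
    replace ((1 / 2) ^ p) with (/ 2 ^ p) by (unfold Rdiv; rewrite Rmult_1_l, pow_inv; reflexivity).
    rewrite pow_add. replace ((1 / 2) ^ p) with (/ 2 ^ p)
      by (unfold Rdiv; rewrite Rmult_1_l, pow_inv; reflexivity).
    assert (H2T : 0 < 2 ^ T) by (apply pow_lt; lra).
    replace 16 with (2 * 2 * 2 * 2) in HP0 by ring. rewrite !Rpow_mult_distr in HP0.
    apply Rmult_le_reg_l with (4 * 2 ^ T * 2 ^ p); [nra|].
    replace (4 * 2 ^ T * 2 ^ p * (D * / 2 ^ T * 2 ^ p * 2 ^ p / / 2 ^ p))
      with (4 * D * (2 ^ p * 2 ^ p * 2 ^ p * 2 ^ p)) by (field; lra).
    replace (4 * 2 ^ T * 2 ^ p * (/ 2 ^ p * (1 / 2) ^ 2)) with (2 ^ T) by (field; lra).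
    exact HP0.
Qed.

(* The weight [B k P j] is at least 1 unless the j-th eigenfunction of the box decays from scale [P] on. *)
Lemma finite_volume_localization (delta alpha beta eps : R) (a b : Z -> R) :
  0 < delta -> 0 < eps -> (forall x, delta <= a x <= alpha) -> (forall x, Rabs (b x) <= beta) ->
  exists (v : Z -> R) (om : nat -> Z -> R) (rad : nat -> nat) (E : nat -> nat -> R)
    (phi : nat -> nat -> Z -> R) (B : nat -> nat -> nat -> R) (eta : R) (D : nat -> R) (P0 : nat),
    (forall x, Rabs (v x) <= eps) /\ (forall k x, 0 <= om k x <= eps) /\
    (forall k, (k < rad k)%nat) /\ 0 < eta /\ (forall P, 0 < D P) /\
    (forall k, spectral_data a (fun x => b x + v x + om k x)
       (- Z.of_nat (rad k)) (2 * rad k) (E k) (phi k)) /\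
    (forall k j, (j < 2 * rad k)%nat -> Rabs (E k j) <= 2 * alpha + (beta + eps + eps)) /\
    (forall k P j, 0 <= B k P j) /\
    (forall k P m, (P0 <= P)%nat -> (- Z.of_nat (rad P) <= m < Z.of_nat (rad P))%Z ->
       rsum (2 * rad k) (fun j => phi k j m ^ 2 * B k P j) <= 2 * (1 / 2) ^ P) /\
    (forall k P j, (j < 2 * rad k)%nat -> B k P j < 1 ->
       forall x, Rabs (phi k j x) <= D P * exp (- eta * Rabs (IZR x))).
Proof.
  intros Hd Heps Ha Hb.
  assert (Ha' : forall x, 0 < a x <= alpha) by (intros x; specialize (Ha x); lra).
  set (K := 2 * alpha + (beta + eps + eps)).
  destruct (buffered_potential delta alpha beta eps K Hd Heps)
    as (N & M & kappa & C & win & HN & HM & Hkap & HC & Hcov & Hbuf).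
  destruct (Hbuf a b Ha Hb) as (v & Hv & Hbuf').
  (* [kappa] is the tolerance of the buffers, [eps] the permitted size of the perturbation. *)
  set (kap := Rmin kappa eps).
  assert (Hkap' : 0 < kap) by (apply Rmin_glb_lt; auto).
  destruct (solver_exists a (fun x => proj1 (Ha' x))) as [sol HS].
  destruct (resonant_scales_summable N M kap Hkap') as [P0 HP0].
  destruct (choice (fun k om => (forall x, 0 <= om x <= kap) /\
    forall p m, (P0 <= p < k)%nat -> (- Z.of_nat (radius N p) <= m < Z.of_nat (radius N p))%Z ->
    region_mass sol (radius N k) (Z.of_nat (center N p)) (outer N M k p - center N p) (tau p ^ 2) m
      (fun x => b x + v x + om x)
    + region_mass sol (radius N k) (- Z.of_nat (outer N M k p)) (outer N M k p - center N p) (tau p ^ 2) m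
      (fun x => b x + v x + om x)
    <= (1 / 2) ^ p)) as [om Hom].
  { intros k.
    apply (exists_nonresonant a (fun x => b x + v x) sol (radius N) (center N) (outer N M k) tau
      (fun p => (1 / 2) ^ p) kap k P0 HS Hkap' tau_pos ltac:(intros; apply pow_lt; lra)); [|apply HP0].
    intros p Hp. unfold radius, center. pose proof (pow2_mono p k ltac:(lia)). split; nia. }
  set (W := fun k x => b x + v x + om k x).
  set (E := fun k => fst (sol (W k) (- Z.of_nat (radius N k))%Z (2 * radius N k)%nat)).
  set (phi := fun k => snd (sol (W k) (- Z.of_nat (radius N k))%Z (2 * radius N k)%nat)).
  assert (Hsp : forall k, spectral_data a (W k) (- Z.of_nat (radius N k)) (2 * radius N k) (E k) (phi k))
    by (intros; apply HS).
  assert (Hom' : forall k x, 0 <= om k x <= kappa /\ om k x <= eps).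
  { intros k x. destruct (proj1 (Hom k) x) as [H0 H1]. unfold kap in H1.
    pose proof (Rmin_l kappa eps); pose proof (Rmin_r kappa eps). lra. }
  assert (HE : forall k j, (j < 2 * radius N k)%nat -> Rabs (E k j) <= K).
  { intros k j Hj. apply (eigenvalue_bound a (W k) _ _ (E k) (phi k) alpha (beta + eps + eps) j (Hsp k) Ha'); auto.
    intros x. unfold W. eapply Rle_trans; [apply Rabs_triang|].
    pose proof (Rabs_triang (b x) (v x)). specialize (Hb x); specialize (Hv x).
    destruct (Hom' k x). rewrite (Rabs_pos_eq (om k x)); lra. }
  exists v, om, (radius N), E, phi, (fun k P j => resonances sol N M k P (W k) (E k j)),
    (/ INR (center N M)),
    (fun P => 2 * alpha * C + exp (/ INR (center N M) * (INR (center N (M * P + M)) + 1))), P0.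
  assert (HcM : 0 < INR (center N M)).
  { apply lt_0_INR. unfold center. pose proof (pow2_pos M). nia. }
  repeat split; auto.
  - apply Hom'.
  - apply Hom'.
  - intros k. assert (k < 2 ^ k)%nat by (apply Nat.pow_gt_lin_r; lia). unfold radius. nia.
  - apply Rinv_0_lt_compat; exact HcM.
  - intros P. pose proof (exp_pos (/ INR (center N M) * (INR (center N (M * P + M)) + 1))).
    specialize (Ha' 0%Z). assert (0 < 2 * alpha * C) by nra. lra.
  - apply Hsp.
  - apply Hsp.
  - apply Hsp.
  - apply Hsp.
  - intros; apply resonances_nonneg.
  - intros k P m HP Hm. unfold phi, E. rewrite sum_resonances.
    eapply Rle_trans; [|apply (rsum_half_pow_from P k)].
    apply rsum_le; intros p Hp. destruct (P <=? p)%nat eqn:HPp; [|lra].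
    apply Nat.leb_le in HPp. apply (proj2 (Hom k)); [lia|].
    assert (radius N P <= radius N p)%nat by (unfold radius; pose proof (pow2_mono P p HPp); nia). lia.
  (* The eigenvalue lies in some window, and the buffers of that window give the decay. *)
  - intros k P j Hj Hres. destruct (Hcov (E k j) (HE k j Hj)) as (i & Hi & Hei).
    apply (resonance_free_decay a (W k) sol N M k P i (E k) (phi k) alpha C j); auto.
    intros p Hp Hpi. apply (Hbuf' (om k) (phi k j) (E k j) p).
    + rewrite Hpi; exact Hei.
    + intros x. destruct (Hom' k x). rewrite Rabs_pos_eq; lra.
    + intros x. apply (spectral_abs_le_1 _ _ _ _ _ _ j x (Hsp k) Hj).
    + intros x Hx. apply (Hsp k); [exact Hj|].
      assert (radius N (S p) <= radius N k)%nat
        by (unfold radius; pose proof (pow2_mono (S p) k Hp); nia). lia.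
Qed.

(** * The infinite volume limit *)

Lemma Un_cv_subseq (y : nat -> R) (l : R) (r : nat -> nat) :
  Un_cv y l -> (forall n, (n <= r n)%nat) -> Un_cv (fun n => y (r n)) l.
Proof.
  intros H Hr e He. destruct (H e He) as [n0 Hn0]. exists n0. intros n Hn.
  apply Hn0. specialize (Hr n). lia.
Qed.

Lemma Un_cv_const (c : R) : Un_cv (fun _ => c) c.
Proof. intros e He; exists 0%nat; intros; unfold Rdist; rewrite Rminus_diag, Rabs_R0; exact He. Qed.

Lemma Un_cv_abs_le (y : nat -> R) (l c : R) (n0 : nat) :
  Un_cv y l -> (forall n, (n0 <= n)%nat -> Rabs (y n) <= c) -> Rabs l <= c.
Proof.
  intros H Hc. apply Rnot_lt_le; intros Hlt.
  destruct (H (Rabs l - c)) as [n1 Hn1]; [lra|].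
  specialize (Hn1 (Nat.max n0 n1) ltac:(lia)). specialize (Hc (Nat.max n0 n1) ltac:(lia)).
  unfold Rdist in Hn1. pose proof (Rabs_triang_inv l (y (Nat.max n0 n1))).
  rewrite Rabs_minus_sym in Hn1. lra.
Qed.

Lemma Un_cv_abs_ge (y : nat -> R) (l c : R) (n0 : nat) :
  Un_cv y l -> (forall n, (n0 <= n)%nat -> c <= Rabs (y n)) -> c <= Rabs l.
Proof.
  intros H Hc. apply Rnot_lt_le; intros Hlt.
  destruct (H (c - Rabs l)) as [n1 Hn1]; [lra|].
  specialize (Hn1 (Nat.max n0 n1) ltac:(lia)). specialize (Hc (Nat.max n0 n1) ltac:(lia)).
  unfold Rdist in Hn1. pose proof (Rabs_triang_inv (y (Nat.max n0 n1)) l). lra.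
Qed.

Lemma Un_cv_rsum (n : nat) (f : nat -> nat -> R) (g : nat -> R) :
  (forall i, Un_cv (fun m => f m i) (g i)) -> Un_cv (fun m => rsum n (f m)) (rsum n g).
Proof.
  intros H; induction n as [|n IH]; simpl; [apply Un_cv_const|].
  apply (CV_plus (fun m => rsum n (f m)) (fun m => f m n)); auto.
Qed.

Lemma Un_cv_zbox (n : nat) (f : nat -> Z -> R) (g : Z -> R) :
  (forall x, Un_cv (fun m => f m x) (g x)) -> Un_cv (fun m => zbox n (f m)) (zbox n g).
Proof. intros H. unfold zbox, zint. apply Un_cv_rsum. intros; apply H. Qed.

(** The condition [m <= s m] stands in for strict monotonicity: it is preserved by composition and
    suffices for limits. *)
Lemma bounded_subsequence (y : nat -> R) (B : R) : (forall n, Rabs (y n) <= B) ->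
  exists (s : nat -> nat) (l : R), (forall m, (m <= s m)%nat) /\ Un_cv (fun m => y (s m)) l.
Proof.
  intros HB.
  destruct (Bolzano_Weierstrass y (fun c => - B <= c <= B) (compact_P3 (- B) B)) as [l Hl].
  { intros n. specialize (HB n). pose proof (Rle_abs (y n)). pose proof (Rle_abs (- y n)).
    rewrite Rabs_Ropp in *. lra. }
  destruct (choice (fun m p => (m <= p)%nat /\ Rabs (y p - l) < / INR (S m))) as [s Hs].
  { intros m. assert (Hpos : 0 < / INR (S m)) by (apply Rinv_0_lt_compat, lt_0_INR; lia).
    destruct (Hl (disc l (mkposreal _ Hpos)) m) as (p & Hp & Hd).
    - exists (mkposreal _ Hpos). intros z Hz; exact Hz.
    - exists p; split; [exact Hp|exact Hd]. }
  exists s, l; split; [apply Hs|]. intros e He.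
  destruct (archimed_cor1 e He) as (N & HN & HN0). exists N. intros n Hn.
  destruct (Hs n) as [_ Hd]. unfold Rdist. eapply Rlt_trans; [exact Hd|].
  eapply Rle_lt_trans; [|exact HN]. apply Rinv_le_contravar; [apply lt_0_INR; lia|apply le_INR; lia].
Qed.

Lemma diagonal_subsequence (x : nat -> Z -> R) (B : R) : (forall k z, Rabs (x k z) <= B) ->
  exists (s : nat -> nat) (l : Z -> R), (forall m, (m <= s m)%nat) /\
    forall z, Un_cv (fun m => x (s m) z) (l z).
Proof.
  intros HB.
  set (dec := fun i : nat => if Nat.even i then Z.of_nat (Nat.div2 i) else (- Z.of_nat (S (Nat.div2 i)))%Z).
  assert (Hdec : forall z, exists i, dec i = z).
  { intros z. destruct (Z_le_dec 0 z).
    - exists (2 * Z.to_nat z)%nat. unfold dec. rewrite Nat.even_even, Nat.div2_even. lia.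
    - exists (2 * Z.to_nat (- z - 1) + 1)%nat. unfold dec.
      rewrite Nat.even_odd, Nat.add_1_r, Nat.div2_succ_double. lia. }
  destruct (choice (fun (q : (nat -> nat) * nat) s => (forall m, (m <= s m)%nat) /\
    exists l, Un_cv (fun m => x (fst q (s m)) (dec (snd q))) l)) as [sel Hsel].
  { intros [g i]. destruct (bounded_subsequence (fun n => x (g n) (dec i)) B) as (s & l & Hs & Hl).
    - intros; apply HB.
    - exists s; split; [exact Hs|exists l; exact Hl]. }
  set (g := fix g (i : nat) : nat -> nat := match i with
    | O => fun n => n | S j => fun n => g j (sel (g j, j) n) end).
  (* Later extractions evaluate earlier ones at indices at least as large, so the diagonal inherits
     each limit. *)
  assert (Hgt : forall i d t, exists t', (t <= t')%nat /\ g (d + i)%nat t = g i t').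
  { intros i; induction d as [|d IH]; intros t; [exists t; auto|].
    destruct (IH (sel (g (d + i)%nat, (d + i)%nat) t)) as (t' & Ht' & He).
    exists t'. split; [|exact He].
    pose proof (proj1 (Hsel (g (d + i)%nat, (d + i)%nat)) t). lia. }
  assert (Hcv : forall z, exists l, Un_cv (fun m => x (g m m) z) l).
  { intros z. destruct (Hdec z) as [i <-].
    destruct (proj2 (Hsel (g i, i))) as [l Hl]. simpl in Hl. exists l. intros e He.
    destruct (Hl e He) as [n0 Hn0]. exists (Nat.max n0 (S i)). intros m Hm.
    destruct (Hgt (S i) (m - S i)%nat m) as (t' & Ht' & Hgm).
    replace (m - S i + S i)%nat with m in Hgm by lia. rewrite Hgm. apply (Hn0 t'); lia. }
  destruct (choice _ Hcv) as [l Hl].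
  exists (fun m => g m m), l; split; [|exact Hl].
  intros m. destruct (Hgt 0%nat m m) as (t' & Ht' & Hgm). rewrite Nat.add_0_r in Hgm.
  rewrite Hgm. exact Ht'.
Qed.

Definition expo (eta : R) (x : Z) : R := exp (- eta * Rabs (IZR x)).

Lemma expo_pos (eta : R) (x : Z) : 0 < expo eta x.
Proof. apply exp_pos. Qed.

Lemma expo_le_1 (eta : R) (x : Z) : 0 < eta -> expo eta x <= 1.
Proof.
  intros H. unfold expo. pose proof (Rabs_pos (IZR x)). rewrite <- exp_0.
  destruct (Req_dec (- eta * Rabs (IZR x)) 0) as [->|Hn]; [lra|].
  left; apply exp_increasing; nra.
Qed.

Lemma zbox_diff_le (f g : Z -> R) (T n : nat) : (forall x, Rabs (f x) <= g x) -> (T <= n)%nat ->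
  Rabs (zbox n f - zbox T f) <= zbox n g - zbox T g.
Proof.
  intros H Hn; induction Hn as [|n Hn IH]; [rewrite !Rminus_diag, Rabs_R0; lra|].
  rewrite !zbox_S.
  replace (zbox n f + (f (Z.of_nat n) + f (- Z.of_nat (S n))%Z) - zbox T f)
    with (zbox n f - zbox T f + (f (Z.of_nat n) + f (- Z.of_nat (S n))%Z)) by ring.
  eapply Rle_trans; [apply Rabs_triang|].
  pose proof (Rabs_triang (f (Z.of_nat n)) (f (- Z.of_nat (S n))%Z)).
  pose proof (H (Z.of_nat n)). pose proof (H (- Z.of_nat (S n))%Z). lra.
Qed.

Lemma expo_tail (eta e : R) : 0 < eta -> 0 < e ->
  exists T : nat, forall n, (T <= n)%nat -> zbox n (expo eta) - zbox T (expo eta) <= e.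
Proof.
  intros Heta He. set (q := exp (- eta)).
  assert (Hq0 : 0 < q) by apply exp_pos.
  assert (Hq1 : q < 1) by (unfold q; rewrite <- exp_0; apply exp_increasing; lra).
  assert (Hpow : forall n, expo eta (Z.of_nat n) = q ^ n).
  { intros n. unfold expo. rewrite <- INR_IZR_INZ, Rabs_pos_eq by apply pos_INR.
    induction n as [|n IH]; [simpl; rewrite Rmult_0_r, exp_0; reflexivity|].
    rewrite S_INR. simpl. rewrite <- IH. unfold q. rewrite <- exp_plus. f_equal; ring. }
  assert (Hpow' : forall n, expo eta (- Z.of_nat (S n))%Z <= q ^ n).
  { intros n. replace (expo eta (- Z.of_nat (S n))%Z) with (expo eta (Z.of_nat (S n))).
    - rewrite Hpow. simpl. assert (0 < q ^ n) by (apply pow_lt; exact Hq0). nra.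
    - unfold expo. rewrite opp_IZR, Rabs_Ropp. reflexivity. }
  (* Enlarging the box adds at most [2 * q ^ n], exactly the amount by which [D * q ^ n] drops, so
     the sum of the two never increases. *)
  set (D := 2 / (1 - q)).
  assert (HD : 0 < D) by (apply Rdiv_lt_0_compat; lra).
  assert (Hmono : forall T n, (T <= n)%nat ->
    zbox n (expo eta) + D * q ^ n <= zbox T (expo eta) + D * q ^ T).
  { intros T n Hn; induction Hn as [|n Hn IH]; [lra|]. rewrite zbox_S, Hpow. specialize (Hpow' n).
    simpl pow. assert (D * (q * q ^ n) = D * q ^ n - 2 * q ^ n) by (unfold D; field; lra). lra. }
  destruct (pow_lt_1_zero q ltac:(rewrite Rabs_pos_eq; lra) (e / D) ltac:(apply Rdiv_lt_0_compat; lra))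
    as [T HT].
  exists T. intros n Hn. specialize (Hmono T n Hn). specialize (HT T (Nat.le_refl T)).
  rewrite Rabs_pos_eq in HT by (apply pow_le; lra).
  assert (0 < q ^ n) by (apply pow_lt; exact Hq0).
  apply Rmult_lt_compat_l with (r := D) in HT; [|exact HD].
  replace (D * (e / D)) with e in HT by (field; lra). nra.
Qed.

Lemma zbox_scal (n : nat) (c : R) (f : Z -> R) : zbox n (fun x => c * f x) = c * zbox n f.
Proof. apply rsum_scal. Qed.

(** [T] serves all dominated [f] at once; this uniformity allows norms and overlaps to pass to the
    limit. *)
Lemma expo_dominated_tail (eta c e : R) : 0 < eta -> 0 < e ->
  exists T : nat, forall f n, (forall x, Rabs (f x) <= c * expo eta x) -> (T <= n)%nat ->
    Rabs (zbox n f - zbox T f) <= e.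
Proof.
  intros Heta He. destruct (expo_tail eta (e / (Rabs c + 1)) Heta) as [T HT].
  { apply Rdiv_lt_0_compat; [exact He|]. pose proof (Rabs_pos c); lra. }
  exists T. intros f n Hf Hn.
  eapply Rle_trans; [apply (zbox_diff_le f (fun x => c * expo eta x)); auto|].
  rewrite !zbox_scal, <- Rmult_minus_distr_l.
  pose proof (zbox_diff_le (expo eta) (expo eta) T n
    ltac:(intros; rewrite Rabs_pos_eq; [lra|left; apply expo_pos]) Hn) as Hpos.
  pose proof (Rabs_pos (zbox n (expo eta) - zbox T (expo eta))).
  specialize (HT n Hn). pose proof (Rle_abs c). pose proof (Rabs_pos c).
  apply Rle_trans with ((Rabs c + 1) * (e / (Rabs c + 1))); [nra|].
  right; field; lra.
Qed.

Lemma zbox_bounded_by_limit (f : Z -> R) (l : R) : (forall x, 0 <= f x) ->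
  Un_cv (fun n => zbox n f) l -> forall n, zbox n f <= l.
Proof.
  intros Hf Hl n. apply (growing_ineq (fun n => zbox n f)); [|exact Hl].
  intros k. rewrite zbox_S. pose proof (Hf (Z.of_nat k)). pose proof (Hf (- Z.of_nat (S k))%Z). lra.
Qed.

Lemma zbox_nonneg (n : nat) (f : Z -> R) : (forall x, 0 <= f x) -> 0 <= zbox n f.
Proof. intros H; apply zint_nonneg; auto. Qed.

Lemma zbox_term_le (n : nat) (f : Z -> R) (x : Z) : (forall x, 0 <= f x) ->
  (- Z.of_nat n <= x < Z.of_nat n)%Z -> f x <= zbox n f.
Proof. intros H Hx; apply zint_term_le; auto; lia. Qed.

(* Completeness in finite volume: a vector with [psi m <> 0] overlaps some decaying eigenfunction
   of every large box, by an amount independent of the box. *)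
Lemma exists_overlap (a b : Z -> R) (N : nat) (E : nat -> R) (phi : nat -> Z -> R) (B : nat -> R)
  (psi : Z -> R) (m : Z) (T : nat) (L r D eta : R) :
  spectral_data a b (- Z.of_nat N) (2 * N) E phi ->
  (T <= N)%nat -> (- Z.of_nat N <= m < Z.of_nat N)%Z -> 0 < L -> zbox N (fun x => psi x ^ 2) <= L ->
  (forall j, 0 <= B j) ->
  (forall j, (j < 2 * N)%nat -> B j < 1 -> forall x, Rabs (phi j x) <= D * expo eta x) ->
  (forall f n, (forall x, Rabs (f x) <= D ^ 2 * expo eta x) -> (T <= n)%nat ->
     Rabs (zbox n f - zbox T f) <= 1 / 2) ->
  0 < eta -> psi m <> 0 -> rsum (2 * N) (fun j => phi j m ^ 2 * B j) <= 2 * r ->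
  r <= psi m ^ 2 / (8 * L) ->
  exists j, (j < 2 * N)%nat /\ B j < 1 /\
    Rabs (psi m) / (16 * (INR T + 1)) <= Rabs (zbox N (fun x => phi j x * psi x)).
Proof.
  intros HS HT Hm HL Hpsi HB Hdec Htail Heta Hne Hbad Hr. apply NNPP; intros Hno.
  set (th := Rabs (psi m) / (16 * (INR T + 1))) in *.
  assert (HT0 : 0 <= INR T) by apply pos_INR.
  assert (Hp : 0 < Rabs (psi m)) by (apply Rabs_pos_lt; exact Hne).
  assert (Hth : 0 < th) by (apply Rdiv_lt_0_compat; lra).
  set (c := fun j => ip (- Z.of_nat N) (2 * N) (phi j) psi).
  (* A decaying eigenfunction has half of its mass in the box of radius [T], so [w j >= 1], while
     all [w j] add up to [4 * INR T]. This bounds the number of decaying eigenfunctions, and hence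
     their joint contribution if all overlaps were below [th]. *)
  set (w := fun j => 2 * zbox T (fun x => phi j x ^ 2)).
  (* Balances, in the AM-GM inequality, the mass at [m] of the other eigenfunctions against the
     squared coefficients of [psi], whose sum is at most [L]. *)
  set (lam := 2 * L / Rabs (psi m)).
  assert (Hlam : 0 < lam) by (apply Rdiv_lt_0_compat; lra).
  assert (Hw0 : forall j, 0 <= w j).
  { intros j; unfold w. assert (0 <= zbox T (fun x => phi j x ^ 2))
      by (apply zbox_nonneg; intros; apply pow2_ge_0). lra. }
  assert (Hterm : forall j, (j < 2 * N)%nat -> Rabs (phi j m * c j)
    <= th * w j + (lam / 2 * (phi j m ^ 2 * B j) + / (2 * lam) * c j ^ 2)).
  { intros j Hj.
    assert (Hq1 : 0 <= lam / 2 * (phi j m ^ 2 * B j)).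
    { apply Rmult_le_pos; [lra|]. apply Rmult_le_pos; [apply pow2_ge_0|apply HB]. }
    assert (Hil : 0 < / (2 * lam)) by (apply Rinv_0_lt_compat; lra).
    assert (Hq2 : 0 <= / (2 * lam) * c j ^ 2)
      by (apply Rmult_le_pos; [lra|apply pow2_ge_0]).
    destruct (Rlt_dec (B j) 1) as [Hg|Hg].
    - assert (Hc : Rabs (c j) < th).
      { apply Rnot_le_lt; intros Hle. apply Hno; exists j; auto. }
      assert (Hw : 1 <= w j).
      { destruct HS as (_ & _ & Hn & _). specialize (Hn j Hj).
        change (zbox N (fun x => phi j x ^ 2) = 1) in Hn.
        pose proof (Htail (fun x => phi j x ^ 2) N) as Ht. cbv beta in Ht.
        rewrite Hn in Ht. unfold w.
        assert (Rabs (1 - zbox T (fun x => phi j x ^ 2)) <= 1 / 2).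
        { apply Ht; [|exact HT]. intros x. rewrite <- RPow_abs.
          apply Rle_trans with ((D * expo eta x) ^ 2).
          - apply pow_incr; split; [apply Rabs_pos|apply Hdec; auto].
          - pose proof (expo_le_1 eta x Heta). pose proof (expo_pos eta x).
            rewrite Rpow_mult_distr. apply Rmult_le_compat_l; [apply pow2_ge_0|]. nra. }
        pose proof (Rle_abs (1 - zbox T (fun x => phi j x ^ 2))). lra. }
      pose proof (spectral_abs_le_1 _ _ _ _ _ _ j m HS Hj).
      rewrite Rabs_mult. pose proof (Rabs_pos (c j)). pose proof (Rabs_pos (phi j m)). nra.
    - apply Rnot_lt_le in Hg. specialize (Hw0 j).
      (* AM-GM: [2 |phi c| <= lam phi^2 + c^2 / lam] *)
      assert (Ham : Rabs (phi j m * c j) <= lam / 2 * phi j m ^ 2 + / (2 * lam) * c j ^ 2).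
      { rewrite Rabs_mult, <- (pow2_abs (phi j m)), <- (pow2_abs (c j)).
        set (X := Rabs (phi j m)). set (Y := Rabs (c j)).
        assert (0 <= / (2 * lam) * (lam * X - Y) ^ 2)
          by (apply Rmult_le_pos; [lra|apply pow2_ge_0]).
        replace (lam / 2 * X ^ 2 + / (2 * lam) * Y ^ 2)
          with (X * Y + / (2 * lam) * (lam * X - Y) ^ 2) by (field; lra). lra. }
      assert (lam / 2 * phi j m ^ 2 <= lam / 2 * (phi j m ^ 2 * B j)).
      { apply Rmult_le_compat_l; [lra|]. pose proof (pow2_ge_0 (phi j m)). nra. }
      nra. }
  assert (Hexp : psi m = rsum (2 * N) (fun j => phi j m * c j)).
  { symmetry. apply (spectral_expansion _ _ _ _ _ _ psi m HS). lia. }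
  assert (Hsum : Rabs (psi m) <= th * rsum (2 * N) w
    + (lam / 2 * rsum (2 * N) (fun j => phi j m ^ 2 * B j) + / (2 * lam) * rsum (2 * N) (fun j => c j ^ 2))).
  { rewrite Hexp at 1. eapply Rle_trans; [apply Rabs_rsum|].
    rewrite <- !rsum_scal, <- !rsum_plus. apply rsum_le; exact Hterm. }
  assert (Hw : rsum (2 * N) w <= 4 * INR T).
  { unfold w. rewrite rsum_scal. unfold zbox. rewrite rsum_zint.
    rewrite (zint_ext _ _ _ (fun _ => 1)).
    - unfold zint. rewrite rsum_const, mult_INR. simpl. lra.
    - intros x Hx. destruct HS as (_ & _ & _ & Hc).
      specialize (Hc x x ltac:(lia) ltac:(lia)). destruct (Z.eq_dec x x); [|congruence].
      rewrite <- Hc. apply rsum_ext; intros; ring. }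
  assert (Hc : rsum (2 * N) (fun j => c j ^ 2) <= L).
  { unfold c. rewrite (spectral_parseval _ _ _ _ _ _ psi HS). exact Hpsi. }
  (* Three contributions of at most a quarter each cannot add up to [|psi m|]. *)
  assert (H1 : th * rsum (2 * N) w <= Rabs (psi m) / 4).
  { apply Rle_trans with (th * (4 * (INR T + 1))); [apply Rmult_le_compat_l; lra|].
    right; unfold th; field; lra. }
  assert (H2 : lam / 2 * rsum (2 * N) (fun j => phi j m ^ 2 * B j) <= Rabs (psi m) / 4).
  { apply Rle_trans with (lam / 2 * (2 * (psi m ^ 2 / (8 * L)))).
    - apply Rmult_le_compat_l; lra.
    - right. unfold lam. rewrite <- (pow2_abs (psi m)). field. lra. }
  assert (H3 : / (2 * lam) * rsum (2 * N) (fun j => c j ^ 2) <= Rabs (psi m) / 4).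
  { apply Rle_trans with (/ (2 * lam) * L).
    - apply Rmult_le_compat_l; [left; apply Rinv_0_lt_compat; lra|exact Hc].
    - right. unfold lam. field. lra. }
  lra.
Qed.

Lemma localized_limit (delta alpha beta eps : R) (a b : Z -> R) :
  0 < delta -> 0 < eps -> (forall x, delta <= a x <= alpha) -> (forall x, Rabs (b x) <= beta) ->
  exists b' : Z -> R, (forall x, Rabs (b' x - b x) <= 2 * eps) /\
  forall psi : Z -> R, in_l2 psi ->
    (forall u lam, exp_decaying u -> (forall x, jacobi a b' u x = lam * u x) ->
       (exists x, u x <> 0) -> inner_is psi u 0) ->
    forall m, psi m = 0.
Proof.
  intros Hd Heps Ha Hb.
  destruct (finite_volume_localization delta alpha beta eps a b Hd Heps Ha Hb)
    as (v & om & rad & E & phi & B & eta & D & P0 & Hv & Hom & Hrad & Heta & HD & Hsp & HE & HB & Hbad & Hdec).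
  (* Extracted before [psi] is introduced, as the potential must not depend on it. *)
  destruct (diagonal_subsequence om eps) as (s & oml & Hs & Homl).
  { intros k z. specialize (Hom k z). rewrite Rabs_pos_eq; lra. }
  exists (fun x => b x + v x + oml x). split.
  { intros x. replace (b x + v x + oml x - b x) with (v x + oml x) by ring.
    eapply Rle_trans; [apply Rabs_triang|]. specialize (Hv x).
    assert (Rabs (oml x) <= eps); [|lra].
    apply (Un_cv_abs_le _ _ _ 0%nat (Homl x)). intros n _. destruct (Hom (s n) x).
    rewrite Rabs_pos_eq; lra. }
  intros psi [L0 HL0] Horth m. apply NNPP; intros Hne.
  apply zsum_to_zbox in HL0.
  assert (HL0' := zbox_bounded_by_limit _ _ (fun x => pow2_ge_0 (psi x)) HL0).
  set (L := L0 + 1).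
  assert (HL : 0 < L) by (specialize (HL0' 0%nat); unfold zbox, zint in HL0'; simpl in HL0'; unfold L; lra).
  assert (Hpsi2 : forall n, zbox n (fun x => psi x ^ 2) <= L)
    by (intros n; specialize (HL0' n); unfold L; lra).
  assert (Hpsi : forall x, Rabs (psi x) <= L + 1).
  { intros x. assert (H : psi x ^ 2 <= L).
    { eapply Rle_trans; [|apply (Hpsi2 (Z.to_nat (Z.abs x) + 1)%nat)].
      apply (zbox_term_le _ (fun x => psi x ^ 2)); [intros; apply pow2_ge_0|lia]. }
    rewrite <- (pow2_abs (psi x)) in H. pose proof (Rabs_pos (psi x)). nra. }
  assert (Hpm : 0 < psi m ^ 2 / (8 * L)) by (apply Rdiv_lt_0_compat; [|lra]; nra).
  destruct (pow_lt_1_zero (1 / 2) ltac:(rewrite Rabs_pos_eq; lra) _ Hpm) as [P1 HP1].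
  (* Large enough for the mass bound to hold, for that bound to be small against [psi m ^ 2], and
     for [m] to lie in the box of radius [rad P]. *)
  set (P := (P0 + P1 + Z.to_nat (Z.abs m))%nat).
  assert (HP : (1 / 2) ^ P <= psi m ^ 2 / (8 * L)).
  { specialize (HP1 P ltac:(unfold P; lia)). rewrite Rabs_pos_eq in HP1 by (apply pow_le; lra). lra. }
  destruct (expo_dominated_tail eta (D P ^ 2) (1 / 2) Heta ltac:(lra)) as [T HT].
  set (th := Rabs (psi m) / (16 * (INR T + 1))).
  assert (Hth : 0 < th).
  { apply Rdiv_lt_0_compat; [apply Rabs_pos_lt; exact Hne|]. pose proof (pos_INR T); lra. }
  set (k0 := (T + P)%nat).
  destruct (choice (fun k j => (k0 <= k)%nat -> (j < 2 * rad k)%nat /\ B k P j < 1 /\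
    th <= Rabs (zbox (rad k) (fun x => phi k j x * psi x)))) as [J HJ].
  { intros k. destruct (le_lt_dec k0 k) as [Hk|Hk]; [|exists 0%nat; intros; lia].
    destruct (exists_overlap a (fun x => b x + v x + om k x) (rad k) (E k) (phi k) (B k P) psi m T L
      ((1 / 2) ^ P) (D P) eta) as (j & Hj); auto.
    - specialize (Hrad k). unfold k0 in Hk. lia.
    - specialize (Hrad k). unfold k0, P in Hk. lia.
    - apply Hbad; [unfold P; lia|]. specialize (Hrad P). unfold P in *. lia.
    - exists j; auto. }
  destruct (expo_dominated_tail eta (D P * (L + 1)) (th / 4) Heta ltac:(lra)) as [T2 HT2].
  (* The potential converges along [s]; within it, subsequences are chosen for the energy and then
     for the eigenfunction. *)
  set (kk := fun n => s (n + k0 + T2)%nat).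
  assert (Hkk : forall n, (n + k0 + T2 <= kk n)%nat) by (intros; apply Hs).
  destruct (bounded_subsequence (fun n => E (kk n) (J (kk n))) (2 * alpha + (beta + eps + eps)))
    as (t1 & lam & Ht1 & Hlam).
  { intros n. apply HE. apply HJ. specialize (Hkk n); lia. }
  destruct (diagonal_subsequence (fun n x => phi (kk (t1 n)) (J (kk (t1 n))) x) 1)
    as (t2 & u & Ht2 & Hu).
  { intros n x. apply (spectral_abs_le_1 _ _ _ _ _ _ _ _ (Hsp (kk (t1 n)))).
    apply HJ. specialize (Hkk (t1 n)); lia. }
  set (r := fun n => kk (t1 (t2 n))).
  assert (Hr : forall n, (n + k0 + T2 <= r n)%nat).
  { intros n. pose proof (Hkk (t1 (t2 n))). pose proof (Ht1 (t2 n)). pose proof (Ht2 n). unfold r; lia. }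
  assert (HJr : forall n, (J (r n) < 2 * rad (r n))%nat /\ B (r n) P (J (r n)) < 1 /\
    th <= Rabs (zbox (rad (r n)) (fun x => phi (r n) (J (r n)) x * psi x))).
  { intros n. apply HJ. specialize (Hr n). lia. }
  assert (Hu' : forall x, Un_cv (fun n => phi (r n) (J (r n)) x) (u x)) by exact Hu.
  assert (Hdecr : forall n x, Rabs (phi (r n) (J (r n)) x) <= D P * expo eta x).
  { intros n x. apply (Hdec (r n) P); apply HJr. }
  assert (Hudec : forall x, Rabs (u x) <= D P * expo eta x).
  { intros x. apply (Un_cv_abs_le _ _ _ 0%nat (Hu' x)). intros; apply Hdecr. }
  assert (Hlam' : Un_cv (fun n => E (r n) (J (r n))) lam).
  { apply (Un_cv_subseq (fun n => E (kk (t1 n)) (J (kk (t1 n)))) lam t2 Hlam Ht2). }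
  assert (Homr : forall x, Un_cv (fun n => om (r n) x) (oml x)).
  { intros x. unfold r, kk.
    apply (Un_cv_subseq (fun n => om (s n) x) (oml x) (fun n => t1 (t2 n) + k0 + T2)%nat (Homl x)).
    intros n. pose proof (Ht1 (t2 n)). pose proof (Ht2 n). lia. }
  assert (Heig : forall x, jacobi a (fun x => b x + v x + oml x) u x = lam * u x).
  { intros x. apply Rminus_diag_uniq.
    set (y := fun n => jacobi a (fun x => b x + v x + om (r n) x) (phi (r n) (J (r n))) x
      - E (r n) (J (r n)) * phi (r n) (J (r n)) x).
    assert (Hy : Un_cv y (jacobi a (fun x => b x + v x + oml x) u x - lam * u x)).
    { unfold y, jacobi. apply CV_minus.
      - apply CV_plus; [apply CV_plus|].
        + apply (CV_mult (fun _ => a x)); [apply Un_cv_const|apply Hu'].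
        + apply (CV_mult (fun _ => a (x - 1)%Z)); [apply Un_cv_const|apply Hu'].
        + apply (CV_mult (fun n => b x + v x + om (r n) x)); [|apply Hu'].
          apply (CV_plus (fun _ => b x + v x)); [apply Un_cv_const|apply Homr].
      - apply (CV_mult (fun n => E (r n) (J (r n)))); [apply Hlam'|apply Hu']. }
    assert (H0 : Rabs (jacobi a (fun x => b x + v x + oml x) u x - lam * u x) <= 0).
    { apply (Un_cv_abs_le _ _ _ (Z.to_nat (Z.abs x)) Hy). intros n Hn. unfold y.
      destruct (Hsp (r n)) as (_ & Hev & _). rewrite Hev.
      - rewrite Rminus_diag, Rabs_R0; lra.
      - apply HJr.
      - specialize (Hr n). specialize (Hrad (r n)). lia. }
    apply NNPP; intros Hn. apply Rabs_pos_lt in Hn. lra. }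
  assert (Hprod : forall f : Z -> R, (forall x, Rabs (f x) <= D P * expo eta x) ->
    forall x, Rabs (f x * psi x) <= D P * (L + 1) * expo eta x).
  { intros f Hf x. rewrite Rabs_mult. specialize (Hf x). specialize (Hpsi x).
    pose proof (Rabs_pos (f x)). pose proof (Rabs_pos (psi x)).
    apply Rle_trans with (D P * expo eta x * (L + 1)); [apply Rmult_le_compat; lra|right; ring]. }
  (* Cutting to the fixed box costs [th / 4] before the limit, and restoring the full line costs as
     much after it, so the overlap stays at least [th / 2]. *)
  assert (Hov : 3 * th / 4 <= Rabs (zbox T2 (fun x => u x * psi x))).
  { apply (Un_cv_abs_ge (fun n => zbox T2 (fun x => phi (r n) (J (r n)) x * psi x)) _ _ 0%nat).
    - apply Un_cv_zbox. intros x.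
      apply (CV_mult (fun n => phi (r n) (J (r n)) x) (fun _ => psi x)); [apply Hu'|apply Un_cv_const].
    - intros n _. destruct (HJr n) as (_ & _ & Hn).
      pose proof (HT2 _ (rad (r n)) (Hprod _ (Hdecr n)) ltac:(specialize (Hr n); specialize (Hrad (r n)); lia)) as Ht.
      pose proof (Rabs_triang_inv (zbox (rad (r n)) (fun x => phi (r n) (J (r n)) x * psi x))
        (zbox T2 (fun x => phi (r n) (J (r n)) x * psi x))). lra. }
  assert (H0 : inner_is psi u 0).
  { apply (Horth u lam); auto.
    - exists (D P), eta. repeat split; auto.
    - apply NNPP; intros Hz.
      rewrite (zbox_ext _ _ (fun _ => 0)) in Hov.
      + unfold zbox, zint in Hov. rewrite rsum_const, Rmult_0_r, Rabs_R0 in Hov. lra.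
      + intros x _. replace (u x) with 0; [ring|].
        apply NNPP; intros Hx. apply Hz; exists x; auto. }
  unfold inner_is in H0. apply zsum_to_zbox in H0.
  assert (Hge : th / 2 <= Rabs 0).
  { apply (Un_cv_abs_ge _ _ _ T2 H0). intros n Hn.
    rewrite (zbox_ext n _ (fun x => u x * psi x)) by (intros; ring).
    pose proof (HT2 _ n (Hprod _ Hudec) Hn) as Ht. rewrite Rabs_minus_sym in Ht.
    pose proof (Rabs_triang_inv (zbox T2 (fun x => u x * psi x)) (zbox n (fun x => u x * psi x))). lra. }
  rewrite Rabs_R0 in Hge. lra.
Qed.

(** * The eigenbasis *)

Lemma jacobi_zero (a b h : Z -> R) (E : R) : (forall x, 0 < a x) ->
  (forall x, jacobi a b h x = E * h x) -> h 0%Z = 0 -> h 1%Z = 0 -> forall x, h x = 0.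
Proof.
  intros Ha H H0 H1 x. destruct (Z_lt_dec 0 x) as [Hx|Hx].
  - apply (jacobi_zero_right a b E h 1 (Z.to_nat x)); auto. lia.
  (* Reflection moves the weight of the bond between [y] and [y + 1] to [a (- y - 1)]. *)
  - pose (h' := fun y : Z => h (- y)%Z).
    replace (h x) with (h' (- x)%Z) by (unfold h'; f_equal; lia).
    apply (jacobi_zero_right (fun y => a (- y - 1)%Z) (fun y => b (- y)%Z) E h' 0 (Z.to_nat (- x)));
      auto; [|lia].
    intros y _. unfold h'. rewrite <- H. unfold jacobi.
    replace (- (y + 1))%Z with (- y - 1)%Z by lia.
    replace (- (y - 1))%Z with (- y + 1)%Z by lia.
    replace (- y + 1 - 1)%Z with (- y)%Z by lia. ring.
Qed.

Lemma exp_decaying_vanishes (u : Z -> R) (e : R) : exp_decaying u -> 0 < e ->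
  exists n0 : nat, forall x, (Z.of_nat n0 <= Z.abs x)%Z -> Rabs (u x) <= e.
Proof.
  intros (C & eta & HC & Heta & Hu) He.
  destruct (INR_unbounded (C / (e * eta))) as [n0 Hn0]. exists n0. intros x Hx.
  eapply Rle_trans; [apply Hu|].
  assert (Hx' : INR n0 <= Rabs (IZR x)).
  { rewrite INR_IZR_INZ, <- abs_IZR. apply IZR_le, Hx. }
  replace (- eta * Rabs (IZR x)) with (- (eta * Rabs (IZR x))) by ring.
  set (t := eta * Rabs (IZR x)).
  assert (Ht : C / e <= t).
  { unfold t. apply Rle_trans with (eta * INR n0); [|apply Rmult_le_compat_l; lra].
    apply Rmult_lt_compat_l with (r := eta) in Hn0; [|exact Heta].
    replace (eta * (C / (e * eta))) with (C / e) in Hn0 by (field; lra). lra. }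
  assert (Hce : 0 < C / e) by (apply Rdiv_lt_0_compat; lra).
  assert (Hexp : t < exp t) by (pose proof (exp_ineq1 t ltac:(lra)); lra).
  rewrite exp_Ropp. apply Rmult_le_reg_r with (exp t); [apply exp_pos|].
  rewrite Rmult_assoc, Rinv_l by (pose proof (exp_pos t); lra).
  apply Rle_trans with (e * (C / e)); [right; field; lra|]. apply Rmult_le_compat_l; lra.
Qed.

Lemma exp_decaying_square_summable (u : Z -> R) : exp_decaying u ->
  exists l, Un_cv (fun n => zbox n (fun x => u x ^ 2)) l.
Proof.
  intros (C & eta & HC & Heta & Hu).
  destruct (expo_dominated_tail eta (C ^ 2) 1 Heta ltac:(lra)) as [T HT].
  assert (Hgrow : Un_growing (fun n => zbox n (fun x => u x ^ 2))).
  { intros n. rewrite zbox_S. pose proof (pow2_ge_0 (u (Z.of_nat n))).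
    pose proof (pow2_ge_0 (u (- Z.of_nat (S n))%Z)). lra. }
  assert (Hb : forall n, zbox n (fun x => u x ^ 2) <= zbox T (fun x => u x ^ 2) + 1).
  { intros n. apply Rle_trans with (zbox (T + n) (fun x => u x ^ 2)).
    - apply Rge_le. apply (growing_prop (fun n => zbox n (fun x => u x ^ 2)) (T + n)%nat n Hgrow). lia.
    - assert (Ht : Rabs (zbox (T + n) (fun x => u x ^ 2) - zbox T (fun x => u x ^ 2)) <= 1).
      { apply HT; [|lia]. intros x. rewrite <- RPow_abs.
        apply Rle_trans with ((C * expo eta x) ^ 2).
        - apply pow_incr; split; [apply Rabs_pos|apply Hu].
        - pose proof (expo_le_1 eta x Heta). pose proof (expo_pos eta x).
          rewrite Rpow_mult_distr. apply Rmult_le_compat_l; [apply pow2_ge_0|]. nra. }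
      pose proof (Rle_abs (zbox (T + n) (fun x => u x ^ 2) - zbox T (fun x => u x ^ 2))). lra. }
  destruct (growing_cv _ Hgrow) as [l Hl]; [|exists l; exact Hl].
  exists (zbox T (fun x => u x ^ 2) + 1). intros y [n ->]. apply Hb.
Qed.

Definition wronskian (a u v : Z -> R) (x : Z) : R := a x * (u (x + 1)%Z * v x - u x * v (x + 1)%Z).

Lemma wronskian_step (a b u v : Z -> R) (lam mu : R) (x : Z) :
  jacobi a b u x = lam * u x -> jacobi a b v x = mu * v x ->
  wronskian a u v x - wronskian a u v (x - 1) = (lam - mu) * (u x * v x).
Proof.
  intros Hu Hv.
  replace ((lam - mu) * (u x * v x)) with (lam * u x * v x - u x * (mu * v x)) by ring.
  rewrite <- Hu, <- Hv. unfold wronskian, jacobi. replace (x - 1 + 1)%Z with x by lia. ring.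
Qed.

Lemma wronskian_vanishes (a u v : Z -> R) (alpha e : R) : (forall x, 0 < a x <= alpha) ->
  exp_decaying u -> exp_decaying v -> 0 < e ->
  exists n0 : nat, forall x, (Z.of_nat n0 <= Z.abs x)%Z -> Rabs (wronskian a u v x) <= e.
Proof.
  intros Ha (C & eta & HC & Heta & Hu) Hv He.
  assert (Halpha : 0 < alpha) by (specialize (Ha 0%Z); lra).
  assert (Hac : 0 < 2 * alpha * C) by nra.
  destruct (exp_decaying_vanishes v (e / (2 * alpha * C)) Hv) as [n0 Hn0];
    [apply Rdiv_lt_0_compat; lra|].
  assert (HuC : forall x, Rabs (u x) <= C).
  { intros x. eapply Rle_trans; [apply Hu|]. pose proof (expo_le_1 eta x Heta). unfold expo in *. nra. }
  exists (S n0). intros x Hx. unfold wronskian. rewrite Rabs_mult. specialize (Ha x).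
  rewrite (Rabs_pos_eq (a x)) by lra.
  assert (Hb : Rabs (u (x + 1)%Z * v x - u x * v (x + 1)%Z) <= 2 * (C * (e / (2 * alpha * C)))).
  { unfold Rminus. eapply Rle_trans; [apply Rabs_triang|]. rewrite Rabs_Ropp, !Rabs_mult.
    assert (H : forall y z, (Z.of_nat n0 <= Z.abs z)%Z ->
      Rabs (u y) * Rabs (v z) <= C * (e / (2 * alpha * C))).
    { intros y z Hz. apply Rmult_le_compat; try apply Rabs_pos; auto. }
    pose proof (H (x + 1)%Z x ltac:(lia)). pose proof (H x (x + 1)%Z ltac:(lia)). lra. }
  pose proof (Rabs_pos (u (x + 1)%Z * v x - u x * v (x + 1)%Z)).
  apply Rle_trans with (alpha * (2 * (C * (e / (2 * alpha * C))))); [apply Rmult_le_compat; lra|].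
  right; field; lra.
Qed.

(** By summation by parts [lam - mu] times the product over a box is a difference of Wronskians at
    its ends, which tend to 0. *)
Lemma eigenfunctions_orthogonal (a b u v : Z -> R) (alpha lam mu : R) :
  (forall x, 0 < a x <= alpha) -> exp_decaying u -> exp_decaying v ->
  (forall x, jacobi a b u x = lam * u x) -> (forall x, jacobi a b v x = mu * v x) ->
  lam <> mu -> inner_is u v 0.
Proof.
  intros Ha Hu Hv Hju Hjv Hne. unfold inner_is. apply zsum_to_zbox. intros e He.
  assert (Hp : 0 < Rabs (lam - mu)) by (apply Rabs_pos_lt; lra).
  destruct (wronskian_vanishes a u v alpha (Rabs (lam - mu) * e / 4) Ha Hu Hv) as [n0 Hn0]; [nra|].
  exists (S n0). intros n Hn. unfold Rdist. rewrite Rminus_0_r.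
  assert (Heq : (lam - mu) * zbox n (fun x => u x * v x)
    = wronskian a u v (Z.of_nat n - 1) - wronskian a u v (- Z.of_nat n - 1)).
  { rewrite <- zbox_scal. unfold zbox.
    rewrite (zint_ext _ _ _ (fun x => wronskian a u v x - wronskian a u v (x - 1))).
    - rewrite zint_telescope. f_equal; f_equal; lia.
    - intros x _. symmetry. apply (wronskian_step a b u v lam mu x); auto. }
  apply Rmult_lt_reg_l with (Rabs (lam - mu)); [exact Hp|].
  rewrite <- Rabs_mult, Heq. unfold Rminus at 1.
  eapply Rle_lt_trans; [apply Rabs_triang|]. rewrite Rabs_Ropp.
  pose proof (Hn0 (Z.of_nat n - 1)%Z ltac:(lia)). pose proof (Hn0 (- Z.of_nat n - 1)%Z ltac:(lia)). nra.
Qed.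

(** For equal eigenvalues the Wronskian is constant and tends to 0. Its vanishing at 0 makes [u] and
    [v] proportional. *)
Lemma eigenfunctions_cross (a b u v : Z -> R) (alpha lam : R) :
  (forall x, 0 < a x <= alpha) -> exp_decaying u -> exp_decaying v ->
  (forall x, jacobi a b u x = lam * u x) -> (forall x, jacobi a b v x = lam * v x) ->
  u 1%Z * v 0%Z = u 0%Z * v 1%Z.
Proof.
  intros Ha Hu Hv Hju Hjv.
  assert (Hconst : forall n : nat, wronskian a u v (Z.of_nat n) = wronskian a u v 0).
  { induction n as [|n IH]; [reflexivity|]. rewrite <- IH.
    pose proof (wronskian_step a b u v lam lam (Z.of_nat (S n)) (Hju _) (Hjv _)) as H.
    replace (Z.of_nat (S n) - 1)%Z with (Z.of_nat n) in H by lia. lra. }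
  assert (H0 : wronskian a u v 0 = 0).
  { apply NNPP; intros Hne. apply Rabs_pos_lt in Hne.
    destruct (wronskian_vanishes a u v alpha (Rabs (wronskian a u v 0) / 2) Ha Hu Hv) as [n0 Hn0]; [lra|].
    specialize (Hn0 (Z.of_nat n0) ltac:(lia)). rewrite Hconst in Hn0. lra. }
  unfold wronskian in H0. simpl in H0. specialize (Ha 0%Z).
  apply Rmult_integral in H0. lra.
Qed.

(** Selects one of [u] and [-u], as a nonzero solution cannot vanish at both 0 and 1. Unit modes
    with the same eigenvalue then coincide. *)
Definition sign_normalized (u : Z -> R) : Prop := 0 < u 0%Z \/ u 0%Z = 0 /\ 0 < u 1%Z.

Definition localized_mode (a b u : Z -> R) : Prop :=
  inner_is u u 1 /\ exp_decaying u /\ (exists lam, forall x, jacobi a b u x = lam * u x) /\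
  sign_normalized u.

Lemma localized_modes_orthogonal (a b u v : Z -> R) (alpha : R) :
  (forall x, 0 < a x <= alpha) -> localized_mode a b u -> localized_mode a b v ->
  u <> v -> inner_is u v 0.
Proof.
  intros Ha (Hu1 & Hud & [lam Hju] & Hus) (Hv1 & Hvd & [mu Hjv] & Hvs) Hne.
  destruct (Req_dec lam mu) as [<-|Hlm]; [|apply (eigenfunctions_orthogonal a b u v alpha lam mu); auto].
  exfalso; apply Hne.
  pose proof (eigenfunctions_cross a b u v alpha lam Ha Hud Hvd Hju Hjv) as Hc.
  assert (Hex : exists c, u 0%Z = c * v 0%Z /\ u 1%Z = c * v 1%Z).
  { destruct Hvs as [Hv0|[Hv0 Hv1']].
    - exists (u 0%Z / v 0%Z). split; [field; lra|].
      apply Rmult_eq_reg_l with (v 0%Z); [|lra]. field_simplify; lra.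
    - exists (u 1%Z / v 1%Z). split; [|field; lra]. rewrite Hv0 in *.
      assert (u 0%Z = 0); [|lra]. apply Rmult_eq_reg_r with (v 1%Z); lra. }
  destruct Hex as (c & Hc0 & Hc1).
  assert (Huv : forall x, u x = c * v x).
  { intros x. enough (H : 1 * u x + - c * v x = 0) by lra.
    apply (jacobi_zero a b (fun x => 1 * u x + - c * v x) lam); [intros; apply Ha| | |]; try lra.
    intros y. rewrite jacobi_linear, Hju, Hjv. ring. }
  assert (Hc2 : c ^ 2 = 1).
  { unfold inner_is in Hu1, Hv1. apply zsum_to_zbox in Hu1. apply zsum_to_zbox in Hv1.
    apply (UL_sequence (fun n => zbox n (fun x => u x * u x))); [|exact Hu1].
    replace (c ^ 2) with (c ^ 2 * 1) by ring.
    replace (fun n => zbox n (fun x => u x * u x)) with (fun n => c ^ 2 * zbox n (fun x => v x * v x)).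
    - apply (CV_mult (fun _ => c ^ 2)); [apply Un_cv_const|exact Hv1].
    - apply functional_extensionality; intros n. rewrite <- zbox_scal.
      apply zbox_ext; intros x _. rewrite Huv. ring. }
  assert (Hc' : c = 1).
  { assert (Hcc : (c - 1) * (c + 1) = 0) by (replace ((c - 1) * (c + 1)) with (c ^ 2 - 1) by ring; lra).
    apply Rmult_integral in Hcc. destruct Hcc as [|Hcm]; [lra|].
    replace c with (-1) in * by lra. destruct Hus as [|[]], Hvs as [|[]]; lra. }
  apply functional_extensionality; intros x. rewrite Huv, Hc'. ring.
Qed.

Lemma localized_mode_normalize (a b u : Z -> R) (lam : R) :
  (forall x, 0 < a x) -> exp_decaying u -> (forall x, jacobi a b u x = lam * u x) ->
  (exists x, u x <> 0) -> exists c, c <> 0 /\ localized_mode a b (fun x => c * u x).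
Proof.
  intros Ha Hud Hju [x0 Hx0].
  destruct (exp_decaying_square_summable u Hud) as [l Hl].
  assert (Hlpos : 0 < l).
  { pose proof (zbox_bounded_by_limit _ _ (fun x => pow2_ge_0 (u x)) Hl
      (Z.to_nat (Z.abs x0) + 1)%nat) as H1.
    pose proof (zbox_term_le (Z.to_nat (Z.abs x0) + 1) (fun x => u x ^ 2) x0
      (fun x => pow2_ge_0 (u x)) ltac:(lia)) as H2.
    cbv beta in *. assert (0 < u x0 ^ 2) by nra. lra. }
  assert (Hsg : exists s, s ^ 2 = 1 /\ sign_normalized (fun x => s * u x)).
  { destruct (Rtotal_order (u 0%Z) 0) as [H|[H|H]].
    - exists (-1). split; [ring|]. left; lra.
    - destruct (Rtotal_order (u 1%Z) 0) as [H1|[H1|H1]].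
      + exists (-1). split; [ring|]. right; lra.
      + exfalso. apply Hx0. apply (jacobi_zero a b u lam); auto.
      + exists 1. split; [ring|]. right; lra.
    - exists 1. split; [ring|]. left; lra. }
  destruct Hsg as (s & Hs & Hsn).
  assert (Hq : 0 < / sqrt l) by (apply Rinv_0_lt_compat, sqrt_lt_R0; exact Hlpos).
  assert (Hq2 : (/ sqrt l) ^ 2 * l = 1).
  { rewrite pow_inv, pow2_sqrt by lra. field; lra. }
  assert (Hs0 : s <> 0) by (intros ->; simpl in Hs; lra).
  exists (s * / sqrt l). split; [apply Rmult_integral_contrapositive; lra|].
  split; [|split; [|split]].
  - unfold inner_is. apply zsum_to_zbox.
    replace 1 with (((s * / sqrt l) ^ 2) * l) by (rewrite Rpow_mult_distr, Hs; lra).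
    replace (fun n => zbox n (fun x => s * / sqrt l * u x * (s * / sqrt l * u x)))
      with (fun n => (s * / sqrt l) ^ 2 * zbox n (fun x => u x ^ 2)).
    + apply (CV_mult (fun _ => (s * / sqrt l) ^ 2)); [apply Un_cv_const|exact Hl].
    + apply functional_extensionality; intros n. rewrite <- zbox_scal. apply zbox_ext; intros; ring.
  - destruct Hud as (C & eta & HC & Heta & Hu).
    assert (Hab : 0 < Rabs (s * / sqrt l)).
    { apply Rabs_pos_lt, Rmult_integral_contrapositive; lra. }
    exists (Rabs (s * / sqrt l) * C), eta. split; [apply Rmult_lt_0_compat; auto|]. split; [exact Heta|].
    intros m. rewrite Rabs_mult, Rmult_assoc. apply Rmult_le_compat_l; [lra|apply Hu].
  - exists lam. intros x. transitivity (s * / sqrt l * jacobi a b u x); [unfold jacobi; ring|].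
    rewrite Hju; ring.
  - unfold sign_normalized in *. destruct Hsn as [H|[H H']]; [left|right]; nra.
Qed.

Theorem theorem2p1 (delta : R) (a b : Z -> R)
  (Hdelta : 0 < delta) (Ha : bounded_seq a) (Hb : bounded_seq b)
  (Hadelta : forall n : Z, delta <= a n) :
  forall eps : R, 0 < eps ->
  exists at_ bt : Z -> R,
    sup_dist_lt at_ a eps /\ sup_dist_lt bt b eps /\
    exists (I : Type) (u : I -> Z -> R),
      orthonormal_basis u /\
      (forall i, exists lam : R, is_eigenfunction at_ bt (u i) lam) /\
      (forall i, exp_decaying (u i)).
Proof.
  intros eps Heps. destruct Ha as [alpha Halpha]. destruct Hb as [beta Hbeta].
  assert (Ha : forall x, delta <= a x <= alpha)
    by (intros x; split; [apply Hadelta|eapply Rle_trans; [apply Rle_abs|apply Halpha]]).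
  assert (Ha' : forall x, 0 < a x <= alpha) by (intros x; specialize (Ha x); lra).
  destruct (localized_limit delta alpha beta (eps / 3) a b Hdelta ltac:(lra) Ha Hbeta)
    as (b' & Hb' & Hcomplete).
  exists a, b'. split; [|split].
  - exists 0. split; [exact Heps|]. intros n. rewrite Rminus_diag, Rabs_R0; lra.
  - exists (2 * (eps / 3)). split; [lra|exact Hb'].
  - assert (Hl2 : forall u, inner_is u u 1 -> in_l2 u).
    { intros u Hu. exists 1. unfold inner_is in Hu. rewrite zsum_to_zbox in *.
      replace (fun n => zbox n (fun x => u x ^ 2)) with (fun n => zbox n (fun x => u x * u x)); [exact Hu|].
      apply functional_extensionality; intros n; apply zbox_ext; intros; ring. }
    (* The basis is indexed by all normalized modes themselves: eigenvalues are simple and the sign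
       is fixed, so distinct modes are orthogonal and no enumeration is required. *)
    exists {u : Z -> R | localized_mode a b' u}, (fun i => proj1_sig i).
    split; [split; [|split; [|split]]|split].
    + intros [u Hu]. apply Hl2, Hu.
    + intros [u Hu]. apply Hu.
    + intros [u Hu] [w Hw] Hne. apply (localized_modes_orthogonal a b' u w alpha); auto.
      intros Heq. apply Hne. subst w. f_equal. apply proof_irrelevance.
    + intros psi Hpsi Horth. apply Hcomplete; [exact Hpsi|].
      intros u lam Hud Hju Hnz.
      destruct (localized_mode_normalize a b' u lam (fun x => proj1 (Ha' x)) Hud Hju Hnz) as (c & Hc & Hm).
      specialize (Horth (exist _ _ Hm)). simpl in Horth. unfold inner_is in *. rewrite zsum_to_zbox in *.
      replace 0 with (/ c * 0) by ring.
      replace (fun n => zbox n (fun x => psi x * u x))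
        with (fun n => / c * zbox n (fun x => psi x * (c * u x))).
      * apply (CV_mult (fun _ => / c)); [apply Un_cv_const|exact Horth].
      * apply functional_extensionality; intros n. rewrite <- zbox_scal.
        apply zbox_ext; intros; field; exact Hc.
    + intros [u (H1 & Hd & [lam Hj] & Hs)]. exists lam. split; [apply Hl2; exact H1|exact Hj].
    + intros [u Hu]. apply Hu.
Qed.
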